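(* Let $U\subseteq\mathbb R$ be an open interval and let $\phi : U \to \mathbb R$ be an increasing $C^\infty$ diffeomorphism onto its image. Then $\phi \in P_\infty(U)$ if and only if $\phi$ extends to a holomorphic map $\phi : \mathbb C \setminus (\mathbb R\setminus U) \to \mathbb C$ which maps the complex upper half-plane $\{z\in\mathbb C : \operatorname{Im} z>0\}$ into itself.
   Context: $D$ denotes differentiation. Padé approximants and Schwarzian derivatives: a rational map is a quotient $p/q$ of polynomials with $q \not\equiv 0$; its degree is $\max(\deg p,\deg q)$ when $p,q$ are relatively prime. Let $k \ge 0$ be an integer and $g$ a real-valued function which is $2k$ times differentiable at a real point $y$. The $k$'th Padé approximant to $g$ at $y$, denoted $[g]_y^k$, is the rational map $\mathcal R$ of degree at most $k$ (finite at $y$) with $D^j\mathcal R(y) = D^j g(y)$ for $0 \le j \le 2k$, if such a map exists (it is then unique). If moreover $g$ is $2k+1$ times differentiable at $y$, $Dg(y) \ne 0$, $k\ge 1$, and $\mathcal R = [g]_y^k$ exists, the Schwarzian derivative of order $k$ is $S_k(g)(y) = D^{2k+1}(\mathcal R^{-1}\circ g)(y)$, where $\mathcal R^{-1}$ is the local inverse of $\mathcal R$ sending $g(y)$ to $y$; equivalently $S_k(g)(y) = D^{2k+1}(g-\mathcal R)(y)/Dg(y)$. We say $S_k(g)(y)$ exists when $[g]_y^k$ exists. For an open interval $U$ and integer $d \ge 1$, $P_d(U)$ is the set of functions $f:U\to\mathbb R$ which are $2d+1$ times differentiable with $Df \ne 0$ everywhere on $U$ and such that, for every $x\in U$ and $1\le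 k\le d$, $S_k(f)(x)$ exists and $S_k(f)(x)\ge 0$. Set $P_\infty(U) = \bigcap_{d=1}^\infty P_d(U)$. *)

(* Defs.v *)
From HB Require Import structures.
From mathcomp Require Import all_boot all_order all_algebra.
From mathcomp Require Import all_classical all_reals all_analysis.
From mathcomp Require Import complex.

Set Implicit Arguments.
Unset Strict Implicit.
Unset Printing Implicit Defensive.

Import Order.TTheory GRing.Theory Num.Theory.
Import numFieldNormedType.Exports.

Local Open Scope classical_set_scope.
Local Open Scope ring_scope.

(* [derive1n] is total, so being n times differentiable at x has to be stated
   separately; it involves the lower derivatives on a neighbourhood of x. *)
Fixpoint nderivable (R : realType) (n : nat) (f : R -> R) (x : R) : Prop :=
  if n is m.+1 then
    (\forall t \near x, nderivable m f t) /\ derivable (derive1n m f) x 1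
  else True.

Record ratmap (R : realType) : Type := RatMap {
  ratnum : {poly R};
  ratden : {poly R};
  ratden_neq0 : ratden != 0;
  rat_coprime : coprimep ratnum ratden
}.

Definition ratdeg (R : realType) (r : ratmap R) : nat :=
  maxn (size (ratnum r)).-1 (size (ratden r)).-1.

(* The value at a pole is meaningless. *)
Definition rateval (R : realType) (r : ratmap R) (x : R) : R :=
  (ratnum r).[x] / (ratden r).[x].

(* As [ratnum r] and [ratden r] are coprime, [r] is finite at y exactly when its
   denominator does not vanish there. *)
Definition is_pade (R : realType) (k : nat) (g : R -> R) (y : R)
    (r : ratmap R) : Prop :=
  [/\ (ratdeg r <= k)%N,
      (ratden r).[y] != 0 &
      forall j : nat, (j <= 2 * k)%N ->
        derive1n j (rateval r) y = derive1n j g y].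

Definition is_local_inverse (R : realType) (F : R -> R) (y : R)
    (h : R -> R) : Prop :=
  [/\ h (F y) = y,
      (\forall t \near y, h (F t) = t) &
      (\forall u \near F y, F (h u) = u)].

(* [is_schwarzian k g y s] : the Schwarzian derivative of order k of g at y
   exists and equals s. Since D r (y) = D g (y) != 0 and r (y) = g (y), the
   local inverse h exists and its germ at g (y) is unique. *)
Definition is_schwarzian (R : realType) (k : nat) (g : R -> R) (y s : R)
    : Prop :=
  [/\ (1 <= k)%N, nderivable (2 * k).+1 g y, derive1n 1 g y != 0 &
      exists r : ratmap R, exists h : R -> R,
        [/\ is_pade k g y r,
            is_local_inverse (rateval r) y h &
            s = derive1n (2 * k).+1 (h \o g) y]].

(* Functions on an open set U are represented by total functions; only their
   values on U matter in the definitions below. *)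
Definition Pclass (R : realType) (d : nat) (U : set R) : set (R -> R) :=
  [set f | forall x : R, U x ->
    [/\ nderivable (2 * d).+1 f x,
        derive1n 1 f x != 0 &
        forall k : nat, (1 <= k <= d)%N ->
          exists s : R, is_schwarzian k f x s /\ 0 <= s]].

Definition Pinfty (R : realType) (U : set R) : set (R -> R) :=
  \bigcap_(d in [set d : nat | (1 <= d)%N]) Pclass d U.

Definition smooth_on (R : realType) (U : set R) (f : R -> R) : Prop :=
  forall x : R, U x -> forall n : nat, nderivable n f x.

Definition increasing_diffeo (R : realType) (U : set R) (f : R -> R) : Prop :=
  [/\ (forall x y : R, U x -> U y -> x < y -> f x < f y),
      smooth_on U f &
      exists g : R -> R,
        smooth_on (f @` U) g /\ (forall x : R, U x -> g (f x) = x)].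

Definition slit_plane (R : realType) (U : set R) : set R[i] :=
  ~` ((fun x : R => x%:C%C) @` ~` U).

(* Derivability along 1 over the base field R[i] is complex differentiability. *)
Definition holomorphic_on (R : realType) (A : set R[i]) (F : R[i] -> R[i])
    : Prop :=
  forall z : R[i], A z -> derivable (F : R[i]^o -> R[i]^o) z 1.

(* Main.v *)
Require Import Defs.
From HB Require Import structures.
From mathcomp Require Import all_boot all_order all_algebra.
From mathcomp Require Import all_classical all_reals all_analysis.
From mathcomp Require Import complex.
From mathcomp Require Import ring lra zify.
Import Order.TTheory GRing.Theory Num.Theory.
Import numFieldNormedType.Exports.
Local Open Scope classical_set_scope.
Local Open Scope ring_scope.

(* Let a_i = phi^(i)(x) / i!. Reversing the denominator of the k'th Pade approximant
   at x gives the k'th orthogonal polynomial P of the functional L_x(X^i) = a_{i+1},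
   and S_k(phi)(x) is a positive multiple of L_x(P X^k) = L_x(P^2). Hence membership
   in P_oo(U) means that L_x is positive semidefinite for every x in U.

   If so, all odd derivatives are nonnegative, and Bernstein's estimate gives
   |a_n| <= C M^n; then L_x is nonnegative on polynomials that are nonnegative on
   [-M, M] and extends to a functional Lambda_x on continuous functions there. The
   formula F(z) = phi(x) + Lambda_x(s |-> t / (1 - t s)) with t = z - x defines an
   extension that maps the upper half-plane into itself, and off the real axis it
   does not depend on x.

   Conversely, integrate F(x - 1/s) q(s)^2, with q real, over the boundary of a
   large rectangle standing on the real axis in the upper half-plane. The imaginary
   part of the integral over the bottom side is nonnegative, so the residue
   - L_x(q(-X)^2) at infinity is at most 0. *)

Set Implicit Arguments.
Unset Strict Implicit.
Unset Printing Implicit Defensive.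

(** For a rational phi, [S_k] vanishes as soon as k reaches the degree. The Hankel forms are
    therefore only semidefinite, and orthogonal polynomials need not be unique. Smoothness does not
    make phi analytic; positivity does, but it gives a sign to the odd derivatives only. Bernstein's
    estimate thus bounds the even moments, and Cauchy-Schwarz supplies the others. The bound has to
    be uniform in the base point, since a Taylor remainder at x involves derivatives at points near
    x. The functional plays the part of the measure in the Nevanlinna representation. The kernel t /
    (1 - t s) lies in its domain whenever its pole stays away from [-M, M]: for all nonreal t and
    all small t. Differentiability in t, positivity of the imaginary part and change of base point
    all come from estimates uniform in s. In the converse, q(s)^2 is nonnegative only for real s,
    where nothing is known about F. The bottom side therefore lies at height e > 0; first e tends to
    0 with the rectangle's size K fixed, then K tends to infinity. *)

(** * Taylor estimates on a real segment *)

Lemma mvt (R : realType) (f df : R -> R) (a b : R) : a <= b ->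
  (forall t, a <= t <= b -> is_derive t 1 f (df t)) ->
  exists2 c, a <= c <= b & f b - f a = df c * (b - a).
Proof.
move=> ab fdf.
have [||c] := @MVT_segment R f df a b ab.
- by move=> t; rewrite in_itv /= => /andP[at' tb]; apply: fdf; rewrite !ltW.
- apply: derivable_within_continuous => t; rewrite in_itv /= => abt.
  by case: (fdf t abt).
by rewrite in_itv /= => ac E; exists c.
Qed.

(* [G i] plays the role of the [i]-th derivative of [G 0] on [[0, T]]. *)
Definition tower (R : realType) n (G : nat -> R -> R) (T : R) :=
  forall i t, (i < n)%N -> 0 <= t <= T -> is_derive t 1 (G i) (G i.+1 t).

(** By induction [G 1] is nonnegative, so [G 0] increases from 0. Every Taylor bound below is this
    statement for a difference of two towers. *)
Lemma tower_ge0 (R : realType) n (G : nat -> R -> R) (T : R) :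
  tower n G T -> (forall i, (i < n)%N -> G i 0 = 0) ->
  (forall t, 0 <= t <= T -> 0 <= G n t) ->
  forall t, 0 <= t <= T -> 0 <= G 0%N t.
Proof.
elim: n G => [|n IHn] G //= towG G0 Gn t /andP[t0 tT].
have G1 : forall s, 0 <= s <= T -> 0 <= G 1%N s.
  apply: (IHn (fun i => G i.+1)) => //.
    by move=> i s lin; apply: towG.
  by move=> i lin; apply: G0.
have [|c /andP[c0 ct] E] := @mvt R (G 0%N) (G 1%N) 0 t t0.
  by move=> s /andP[s0 st]; apply: towG; rewrite // s0 (le_trans st).
move: E; rewrite G0 // !subr0 => ->.
by rewrite mulr_ge0 // G1 // c0 (le_trans ct).
Qed.

Lemma horner0_derivn (R : realType) (p : {poly R}) i :
  (derivn i p).[0] = p`_i *+ i`!.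
Proof. by rewrite horner_coef0 coef_derivn addn0 ffactnn. Qed.

Lemma tower_poly (R : realType) n (p : {poly R}) T :
  tower n (fun i => horner (derivn i p)) T.
Proof. by move=> i t _ _; rewrite derivnS; exact: is_derive_poly. Qed.

Lemma tower_sub (R : realType) n (G H : nat -> R -> R) T :
  tower n G T -> tower n H T -> tower n (fun i t => G i t - H i t) T.
Proof.
move=> tG tH i t lin tT.
by have := tG i t lin tT; have := tH i t lin tT => ? ?; exact: is_deriveB.
Qed.

Definition taylor (R : realType) n (a : nat -> R) : {poly R} :=
  \poly_(j < n) (a j / j`!%:R).

Lemma taylor_derivn0 (R : realType) n (a : nat -> R) i : (i < n)%N ->
  (derivn i (taylor n a)).[0] = a i.
Proof.
move=> lin; rewrite horner0_derivn coef_poly lin -[LHS]mulr_natr divfK //.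
Qed.

Lemma tower_taylor_le (R : realType) n (G : nat -> R -> R) (T : R) :
  tower n G T -> (forall t, 0 <= t <= T -> 0 <= G n t) ->
  forall t, 0 <= t <= T -> (taylor n (fun j => G j 0)).[t] <= G 0%N t.
Proof.
move=> towG Gn t tT; rewrite -subr_ge0; set p := taylor n _.
apply: (@tower_ge0 R n (fun i t => G i t - (derivn i p).[t]) T) => //.
- by apply: tower_sub towG _; exact: tower_poly.
- by move=> i lin; rewrite taylor_derivn0 // subrr.
- move=> s sT; rewrite derivn_poly0 ?horner0 ?subr0 ?Gn //.
  exact: size_poly.
Qed.

(** The monomial [q] has n-th derivative [K] and vanishes to order n at 0, so both [q + (G 0 - p)]
    and [q - (G 0 - p)] start towers to which [tower_ge0] applies. *)
Lemma tower_taylor_norm (R : realType) n (G : nat -> R -> R) (T K : R) :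
  tower n G T -> (forall t, 0 <= t <= T -> `|G n t| <= K) ->
  forall t, 0 <= t <= T ->
    `|G 0%N t - (taylor n (fun j => G j 0)).[t]| <= K / n`!%:R * t ^+ n.
Proof.
move=> towG Gn t tT; set p := taylor n _.
have nf : n`!%:R != 0 :> R by rewrite pnatr_eq0 -lt0n fact_gt0.
pose q : {poly R} := (K / n`!%:R) *: 'X^n.
have qE s : q.[s] = K / n`!%:R * s ^+ n by rewrite hornerZ hornerXn.
have qn s : (derivn n q).[s] = K.
  by rewrite derivnZ derivnXn subnn ffactnn expr0 hornerZ hornerMn hornerC
     divfK.
have pn : derivn n p = 0 by apply: derivn_poly0; exact: size_poly.
have q0 i : (i < n)%N -> (derivn i q).[0] = 0.
  by move=> lin; rewrite horner0_derivn coefZ coefXn ltn_eqF // mulr0 mul0rn.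
rewrite -qE ler_norml; apply/andP; split; rewrite -subr_ge0.
  rewrite opprK.
  pose H i t := (G i t - (derivn i p).[t]) - (derivn i (- q)).[t].
  have -> : G 0%N t - p.[t] + q.[t] = H 0%N t by rewrite /H /= hornerN opprK.
  apply: (@tower_ge0 R n H T) => //.
  - by do 2?apply: tower_sub => //; exact: tower_poly.
  - by move=> i lin; rewrite /H taylor_derivn0 // subrr derivnN hornerN q0 // oppr0 subr0.
  - move=> s sT; rewrite /H pn horner0 subr0 derivnN hornerN qn opprK.
    by have := Gn s sT; rewrite ler_norml => /andP[]; lra.
pose H i t := (derivn i q).[t] - (G i t - (derivn i p).[t]).
have -> : q.[t] - (G 0%N t - p.[t]) = H 0%N t by [].
apply: (@tower_ge0 R n H T) => //.
- by do 2?apply: tower_sub => //; exact: tower_poly.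
- by move=> i lin; rewrite /H taylor_derivn0 // subrr q0 // subr0.
- move=> s sT; rewrite /H pn horner0 subr0 qn.
  by have := Gn s sT; rewrite ler_norml => /andP[]; lra.
Qed.

(** * Finite and infinite differentiability on an open set *)

Section smooth.
Variables (R : realType) (V : set R).
Hypothesis openV : open V.
Implicit Types f g : R -> R.

Lemma derive1_eq_on f g : (forall x, V x -> f x = g x) ->
  forall x, V x -> (derive1 f) x = (derive1 g) x.
Proof.
move=> fg x Vx; rewrite !derive1E; apply: near_eq_derive.
by apply: filterS (open_nbhs_nbhs (conj openV Vx)) => y /fg.
Qed.

Lemma derivable_eq_on f g : (forall x, V x -> f x = g x) ->
  forall x, V x -> derivable f x 1 -> derivable g x 1.
Proof.
move=> fg x Vx; apply: near_eq_derivable.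
by apply: filterS (open_nbhs_nbhs (conj openV Vx)) => y /fg.
Qed.

Lemma derive1n_eq_on f g n : (forall x, V x -> f x = g x) ->
  forall x, V x -> (derive1n n f) x = (derive1n n g) x.
Proof.
by move=> fg; elim: n => [|n IHn]; [exact: fg|exact: derive1_eq_on].
Qed.

(** On an open set this amounts to [nderivable n] at each point, without the nested neighbourhoods.
    The closure properties follow by induction on n through [cnS]. *)
Definition cn n f := forall m x, (m < n)%N -> V x -> derivable (derive1n m f) x 1.

Lemma cn0 f : cn 0 f. Proof. by move=> m x; rewrite ltn0. Qed.

Lemma cnS n f :
  cn n.+1 f <-> (forall x, V x -> derivable f x 1) /\ cn n (derive1 f).
Proof.
split=> [cf|[df cf] [|m] x].
  split=> [x Vx|m x mn Vx]; first exact: (cf 0%N).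
  by rewrite -derive1Sn; apply: cf.
by move=> _; apply: df.
by rewrite ltnS derive1Sn => *; apply: cf.
Qed.

Lemma cnW n f : cn n.+1 f -> cn n f.
Proof. by move=> cf m x mn; apply: cf; apply: ltnW. Qed.

Lemma cn_eq n f g : (forall x, V x -> f x = g x) -> cn n f -> cn n g.
Proof.
move=> fg cf m x mn Vx.
apply: (@derivable_eq_on (derive1n m f)) => //; last exact: cf.
exact: derive1n_eq_on.
Qed.

Lemma cn_cst n (c : R) : cn n (fun=> c).
Proof.
elim: n c => [|n IHn] c; first exact: cn0.
apply/cnS; split; first by move=> x _; exact: derivable_cst.
apply: cn_eq (IHn 0) => x _; rewrite derive1E; by rewrite derive_cst.
Qed.

Lemma cn_add n f g : cn n f -> cn n g -> cn n (fun x => f x + g x).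
Proof.
elim: n f g => [|n IHn] f g; first by move=> _ _; exact: cn0.
move=> /cnS[df cf] /cnS[dg cg]; apply/cnS; split.
  by move=> x Vx; apply: derivableD; [apply: df|apply: dg].
apply: cn_eq (IHn _ _ cf cg) => x Vx; rewrite !derive1E deriveD //; auto.
Qed.

Lemma cn_mul n f g : cn n f -> cn n g -> cn n (fun x => f x * g x).
Proof.
elim: n f g => [|n IHn] f g cf0 cg0; first exact: cn0.
have [[df cf] [dg cg]] := ((cnS n f).1 cf0, (cnS n g).1 cg0).
apply/cnS; split.
  by move=> x Vx; apply: derivableM; [apply: df|apply: dg].
apply: cn_eq (cn_add (IHn _ _ (cnW cf0) cg) (IHn _ _ (cnW cg0) cf)) => x Vx.
by rewrite !derive1E (deriveM (df x Vx) (dg x Vx)).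
Qed.

Lemma cn_opp n f : cn n f -> cn n (fun x => - f x).
Proof.
by move=> cf; apply: (cn_eq _ (cn_mul (@cn_cst n (-1)) cf)) => x _; rewrite mulN1r.
Qed.

Lemma cn_inv n f : (forall x, V x -> f x != 0) -> cn n f ->
  cn n (fun x => (f x)^-1).
Proof.
move=> f0; elim: n f f0 => [|n IHn] f f0 cf0; first exact: cn0.
have [df cf] := (cnS n f).1 cf0; apply/cnS; split.
  by move=> x Vx; apply: derivableV; [apply: f0|apply: df].
have cV := IHn _ f0 (cnW cf0).
apply: cn_eq (cn_opp (cn_mul (cn_mul cV cV) cf)) => x Vx.
rewrite !derive1E deriveV ?f0 //; last exact: df.
by rewrite -exprVn expr2 scaleNr.
Qed.

Lemma cn_poly n (p : {poly R}) : cn n (horner p).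
Proof.
elim: n p => [|n IHn] p; first exact: cn0.
apply/cnS; split; first by move=> x _; exact: derivable_horner.
by rewrite -derivE.
Qed.

End smooth.

Lemma cn_comp (R : realType) (V W : set R) n (f g : R -> R) :
  open V -> open W -> (forall x, V x -> W (g x)) ->
  cn W n f -> cn V n g -> cn V n (f \o g).
Proof.
move=> oV oW VW; elim: n f => [|n IHn] f cf0 cg0; first exact: cn0.
have [[df cf] [dg cg]] := ((cnS W n f).1 cf0, (cnS V n g).1 cg0).
apply/cnS; split.
  move=> x Vx; apply: ex_derive; apply: is_derive1_comp; apply: derivableP; auto.
apply: (cn_eq oV) (cn_mul oV (IHn _ cf (cnW cg0)) cg) => x Vx.
by rewrite (derive1_comp (dg x Vx) (df _ (VW _ Vx))).
Qed.

(** Bootstrapping: [h' = 1 / (f' \o h)] is as differentiable as [h] already is, which gains one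
    order at each step. *)
Lemma cn_local_inverse (R : realType) (V W : set R) n (f h : R -> R) :
  open V -> open W -> (forall x, V x -> (derive1 f) x != 0) ->
  (forall y, W y -> V (h y)) ->
  (forall y, W y -> is_derive y 1 h ((derive1 f) (h y))^-1) ->
  cn V n f -> cn W n h.
Proof.
move=> oV oW f0 WV dh; elim: n => [|n IHn] cf0; first exact: cn0.
have [df cf] := (cnS V n f).1 cf0.
apply/cnS; split; first by move=> y /dh[].
have ch := IHn (cnW cf0).
apply: (cn_eq oW) (cn_inv oW _ (cn_comp oW oV WV cf ch)) => y Wy /=.
  by rewrite [RHS]derive1E; have [_ ->] := dh y Wy.
by apply: f0; apply: WV.
Qed.

Definition smooth (R : realType) (V : set R) (f : R -> R) := forall n, cn V n f.

Lemma nderivable_cn (R : realType) (V : set R) n (f : R -> R) : open V ->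
  (forall x, V x -> nderivable n f x) -> cn V n f.
Proof.
move=> oV nf m x; elim: n nf => [|n IHn] nf; first by rewrite ltn0.
rewrite ltnS leq_eqVlt => /orP[/eqP -> /nf[] //|mn Vx].
apply: IHn => // y /nf[/nbhs_singleton] //.
Qed.

Lemma cn_nderivable (R : realType) (V : set R) n (f : R -> R) : open V ->
  cn V n f -> forall x, V x -> nderivable n f x.
Proof.
move=> oV; elim: n => [|n IHn] cf x Vx //=; split; last exact: cf.
by apply: filterS (open_nbhs_nbhs (conj oV Vx)); apply: IHn; apply: cnW.
Qed.

Lemma smooth_onP (R : realType) (V : set R) (f : R -> R) : open V ->
  smooth_on V f <-> smooth V f.
Proof.
move=> oV; split=> sf; first by move=> n; apply: nderivable_cn => // x /sf.
by move=> x Vx n; apply: (cn_nderivable oV) Vx.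
Qed.

(** * Orders of vanishing at 0 *)

Lemma open_dist (R : realType) (V : set R) x : open V -> V x ->
  exists2 d : R, 0 < d & forall t : R, `|t| < d -> V (x + t).
Proof.
move=> oV Vx; have /nbhs_ballP[d /= d0 dV] := open_nbhs_nbhs (conj oV Vx).
exists d => // t td; apply: dV.
by rewrite /ball /= opprD addNKr normrN.
Qed.

Lemma continuous_dist (R : realType) (f : R -> R) x : {for x, continuous f} ->
  forall e : R, 0 < e -> exists2 d : R, 0 < d & forall t : R, `|t| < d -> `|f (x + t) - f x| < e.
Proof.
move=> /cvgr_dist_lt cf e e0; have /nbhs_ballP[d /= d0 dV] := cf e e0.
exists d => // t td; rewrite distrC; apply: dV.
by rewrite /ball /= opprD addNKr normrN.
Qed.

(** The point [t = 0] is left out so that a factor t can be cancelled, as in [bigO_poly_coef]. In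
    exchange, composition has to treat the zeros of the inner function separately, as in
    [bigO_comp1]. *)
Definition bigO (R : realType) n (f : R -> R) := exists C d : R,
  0 < d /\ forall t : R, t != 0 -> `|t| < d -> `|f t| <= C * `|t| ^+ n.

Section bigO.
Variable R : realType.
Implicit Types (f g : R -> R) (p : {poly R}).

Lemma bigO_gt0 n f : bigO n f -> exists C d : R, [/\ 0 < C, 0 < d, d < 1 &
  forall t : R, t != 0 -> `|t| < d -> `|f t| <= C * `|t| ^+ n].
Proof.
move=> [C [d [d0 fC]]]; exists (`|C| + 1), (Num.min d (1/2)); split.
- by rewrite ltr_wpDl.
- by rewrite lt_min d0 /=; lra.
- by rewrite gt_min; apply/orP; right; lra.
- move=> t t0; rewrite lt_min => /andP[td _]; apply: le_trans (fC t t0 td) _.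
  by rewrite ler_wpM2r ?exprn_ge0 //; have := ler_norm C; lra.
Qed.

Lemma bigO_eq n f g : (forall t, f t = g t) -> bigO n f -> bigO n g.
Proof. by move=> fg; congr bigO; apply/funext. Qed.

Lemma bigO_eq_near n f g d0 : 0 < d0 -> (forall t : R, `|t| < d0 -> f t = g t) ->
  bigO n f -> bigO n g.
Proof.
move=> d00 fg [C [d [d0' fC]]]; exists C, (Num.min d d0).
by rewrite lt_min d00 d0'; split => // t t0; rewrite lt_min => /andP[td td0];
  rewrite -fg // fC.
Qed.

Lemma bigO_add n f g : bigO n f -> bigO n g -> bigO n (fun t => f t + g t).
Proof.
move=> [C [d [d0 fC]]] [D [e [e0 gD]]]; exists (C + D), (Num.min d e).
rewrite lt_min d0 e0; split => // t t0; rewrite lt_min => /andP[td te].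
by rewrite mulrDl (le_trans (ler_normD _ _)) // lerD // ?fC ?gD.
Qed.

Lemma bigO_mul m n f g : bigO m f -> bigO n g ->
  bigO (m + n) (fun t => f t * g t).
Proof.
move=> /bigO_gt0[C [d [C0 d0 _ fC]]] [D [e [e0 gD]]].
exists (C * D), (Num.min d e).
rewrite lt_min d0 e0; split => // t t0; rewrite lt_min => /andP[td te].
by rewrite exprD mulrACA normrM ler_pM // ?fC ?gD.
Qed.

Lemma bigO_bounded n f g : bigO n f -> bigO 0 g -> bigO n (fun t => f t * g t).
Proof. by move=> fn g0; have := bigO_mul fn g0; rewrite addn0. Qed.

Lemma bigOW m n f : (m <= n)%N -> bigO n f -> bigO m f.
Proof.
move=> mn /bigO_gt0[C [d [C0 d0 d1 fC]]]; exists C, d; split => // t t0 td.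
apply: le_trans (fC t t0 td) _; rewrite ler_pM2l //.
by rewrite ler_wiXn2l // ltW // (lt_trans td).
Qed.

Lemma bigO_expr n : bigO n (fun t : R => t ^+ n).
Proof. by exists 1, 1; split => // t _ _; rewrite mul1r normrX. Qed.

Lemma bigO_cst c : bigO 0 (fun=> c : R).
Proof. by exists `|c|, 1; split => // t _ _; rewrite expr0 mulr1. Qed.

Lemma bigO_opp n f : bigO n f -> bigO n (fun t => - f t).
Proof. by move=> [C [d [d0 fC]]]; exists C, d; split => // t *; rewrite normrN fC. Qed.

Lemma bigO_sub n f g : bigO n f -> bigO n g -> bigO n (fun t => f t - g t).
Proof. by move=> fn /bigO_opp; apply: bigO_add. Qed.

Lemma bigO_poly0 p : bigO 0 (horner p).
Proof.
elim/poly_ind: p => [|p c IHp].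
  by apply: bigO_eq (bigO_cst 0) => t; rewrite horner0.
apply: bigO_eq (bigO_add (bigO_bounded IHp (bigOW (leq0n 1) (@bigO_expr 1))) (bigO_cst c)) => t.
by rewrite hornerMXaddC.
Qed.

Lemma bigO_poly n p : (forall j, (j < n)%N -> p`_j = 0) -> bigO n (horner p).
Proof.
move=> pj; have -> : p = drop_poly n p * 'X^n.
  rewrite -[LHS](poly_take_drop n); rewrite (_ : take_poly n p = 0) ?add0r //.
  by apply/polyP => i; rewrite coef_take_poly coef0; case: ltnP => // /pj.
apply: bigO_eq (bigO_mul (bigO_poly0 (drop_poly n p)) (@bigO_expr n)) => t.
by rewrite hornerM hornerXn.
Qed.

(** This is how limits as a parameter tends to 0 are taken throughout: an error linear in the
    parameter is bounded, then discarded. *)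
Lemma small_le0 (a C d : R) : 0 < d ->
  (forall t : R, 0 < t -> t < d -> a <= C * t) -> a <= 0.
Proof.
move=> d0 h; rewrite leNgt; apply/negP => a0.
have C0 : 0 < `|C| + 1 by rewrite ltr_wpDl.
pose t := Num.min (d / 2) (a / (2 * (`|C| + 1))).
have t0 : 0 < t by rewrite lt_min !divr_gt0 // mulr_gt0.
have td : t < d by rewrite gt_min; apply/orP; left; lra.
have := h t t0 td; apply/negP; rewrite -ltNge.
have tle : t <= a / (2 * (`|C| + 1)) by rewrite ge_min lexx orbT.
apply: (@le_lt_trans _ _ ((`|C| + 1) * (a / (2 * (`|C| + 1))))).
  apply: (@le_trans _ _ ((`|C| + 1) * t)); last by rewrite ler_pM2l.
  by rewrite ler_pM2r //; have := ler_norm C; lra.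
have -> : (`|C| + 1) * (a / (2 * (`|C| + 1))) = a / 2.
  by field; rewrite gt_eqF.
lra.
Qed.

(** The constant coefficient is at most a multiple of [|t|] for all small t, hence 0; then a factor
    t is cancelled and the argument repeated. *)
Lemma bigO_poly_coef n p : bigO n (horner p) -> forall j, (j < n)%N -> p`_j = 0.
Proof.
elim: n p => [|n IHn] p On; first by move=> j; rewrite ltn0.
have p0 : p`_0 = 0.
  have [q pE] : exists q : {poly R}, p = q * 'X + (p`_0)%:P.
    elim/poly_ind: p {On} => [|q c _]; first by exists 0; rewrite mul0r coef0 add0r.
    by exists q; rewrite coefD coefMX coefC /= add0r.
  have /bigO_gt0[D [e [D0 e0 e1 qD]]] := bigO_poly0 q.
  have /bigO_gt0[C [d [C0 d0 d1 fC]]] := bigOW (isT : (1 <= n.+1)%N) On.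
  apply/eqP; rewrite -normr_le0.
  have de0 : 0 < Num.min d e by rewrite lt_min d0.
  apply: (@small_le0 _ (C + D) _ de0) => t t0; rewrite lt_min => /andP[td te].
  have tN : `|t| = t by rewrite ger0_norm // ltW.
  have := fC t (lt0r_neq0 t0); have := qD t (lt0r_neq0 t0).
  have ptE : p.[t] = q.[t] * t + p`_0 by rewrite {1}pE !hornerE.
  rewrite ptE tN expr0 expr1 mulr1 => /(_ te) qt /(_ td) pt.
  rewrite mulrDl -[p`_0](addKr (q.[t] * t)) (le_trans (ler_normD _ _)) // addrC lerD //.
  by rewrite normrN normrM tN ler_pM2r.
have [q pE] : exists q : {poly R}, p = q * 'X.
  elim/poly_ind: p p0 {On} => [|q c _]; first by exists 0; rewrite mul0r.
  by rewrite coefD coefMX coefC /= add0r => ->; exists q; rewrite addr0.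
have qn : bigO n (horner q).
  have [C [d [d0 fC]]] := On; exists C, d; split => // t t0 td.
  have := fC t t0 td; rewrite pE !hornerE normrM exprSr mulrA ler_pM2r //.
  by rewrite normr_gt0.
by move=> [|j] //; rewrite ltnS pE coefMX => jn; rewrite /= (IHn q).
Qed.

End bigO.

(** * Taylor expansion at a point and its uniqueness *)

Lemma is_derive_affine (R : realType) (x c r : R) :
  is_derive r 1 (fun r : R => x + c * r) c.
Proof.
apply: is_derive_eq (is_deriveD (is_derive_cst x r 1)
  (is_deriveZ c (is_derive_id r 1))) _.
by rewrite add0r [_ *: _]mulr1.
Qed.

(** With c = 1 and c = -1, towers on [[0, T]] describe a function on both sides of x. *)
Lemma tower_affine (R : realType) (V : set R) (f : R -> R) (x c T : R) n :
  smooth V f -> (forall r : R, 0 <= r <= T -> V (x + c * r)) ->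
  tower n (fun i r => c ^+ i * derive1n i f (x + c * r)) T.
Proof.
move=> sf Vr i r lin rT.
have h1 : is_derive (x + c * r) 1 (derive1n i f) (derive1n i.+1 f (x + c * r)).
  by rewrite derive1nS derive1E; apply/derivableP/(sf i.+1)/Vr.
have h2 := is_deriveZ (c ^+ i) (@is_derive1_comp R _ _ r _ _ h1 (is_derive_affine x c r)).
apply: is_derive_eq h2 _.
by rewrite [_ *: _]mulrCA exprSr mulrC -mulrA mulrCA.
Qed.

Lemma taylorZ (R : realType) n (a : nat -> R) (c t : R) :
  (taylor n (fun j => c ^+ j * a j)).[t] = (taylor n a).[c * t].
Proof.
rewrite !horner_poly; apply: eq_bigr => i _.
by rewrite exprMn [c ^+ i * a i]mulrC -!mulrA; congr (_ * _); rewrite mulrCA.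
Qed.

Lemma taylor_affine (R : realType) (V : set R) (f : R -> R) (x c s K : R) n :
  smooth V f -> `|c| = 1 -> (forall r : R, 0 <= r <= s -> V (x + c * r)) ->
  (forall r : R, 0 <= r <= s -> `|derive1n n f (x + c * r)| <= K) -> 0 <= s ->
  `|f (x + c * s) - (taylor n (fun j => derive1n j f x)).[c * s]| <=
    K / n`!%:R * s ^+ n.
Proof.
move=> sf c1 Vr fK s0.
rewrite -taylorZ.
have -> : (fun j => c ^+ j * derive1n j f x) = (fun j => c ^+ j * derive1n j f (x + c * 0)).
  by rewrite mulr0 addr0.
rewrite -[f (x + c * s)]mul1r.
apply: (tower_taylor_norm (tower_affine sf Vr)); last by rewrite s0 lexx.
move=> r rs; rewrite normrM normrX c1 expr1n mul1r.
exact: fK.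
Qed.

Lemma taylor_norm (R : realType) (V : set R) (f : R -> R) (x K d t : R) n :
  smooth V f -> (forall r : R, `|r| < d -> V (x + r)) ->
  (forall r : R, `|r| < d -> `|derive1n n f (x + r)| <= K) -> `|t| < d ->
  `|f (x + t) - (taylor n (fun j => derive1n j f x)).[t]| <=
    K / n`!%:R * `|t| ^+ n.
Proof.
move=> sf Vr fK td.
have [c c1 tE] : exists2 c : R, `|c| = 1 & t = c * `|t|.
  have [t0|t0] := leP 0 t.
    by exists 1; rewrite ?normr1 // mul1r ger0_norm.
  by exists (-1); rewrite ?normrN1 // ltr0_norm // mulrNN mul1r.
rewrite {1 2}tE; apply: (taylor_affine (V := V)) => // r /andP[r0 rt].
  by apply: Vr; rewrite normrM c1 mul1r ger0_norm // (le_lt_trans rt).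
by apply: fK; rewrite normrM c1 mul1r ger0_norm // (le_lt_trans rt).
Qed.

Lemma taylor_bigO (R : realType) (V : set R) f x n : open V -> smooth V f -> V x ->
  bigO n (fun t => f (x + t) - (taylor n (fun j => derive1n j f x)).[t]).
Proof.
move=> oV sf Vx.
have [d1 d10 d1V] := open_dist oV Vx.
have cfn : {for x, continuous (derive1n n f)}.
  exact/differentiable_continuous/derivable1_diffP/(sf n.+1 n).
have [d2 d20 d2f] := continuous_dist cfn ltr01.
exists ((`|derive1n n f x| + 1) / n`!%:R), (Num.min d1 d2).
rewrite lt_min d10 d20; split=> // t t0 td.
apply: (taylor_norm (V := V) (d := Num.min d1 d2)) => // r; rewrite lt_min => /andP[r1 r2].
  exact: d1V.
rewrite -(subrK (derive1n n f x) (derive1n n f (x + r))) addrC.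
by apply: le_trans (ler_normD _ _) _; rewrite lerD2l ltW // d2f.
Qed.

(** Derivatives are computed through this lemma, by exhibiting a polynomial that approximates well
    enough: those of [h \o g], the moments at a displaced base point and the coefficients of the
    holomorphic extension. *)
Lemma taylor_unique (R : realType) (V : set R) f x n (p : {poly R}) :
  open V -> smooth V f -> V x ->
  bigO n (fun t => f (x + t) - p.[t]) ->
  forall j, (j < n)%N -> derive1n j f x = p`_j * j`!%:R.
Proof.
move=> oV sf Vx fp j jn.
have := bigO_sub fp (taylor_bigO n oV sf Vx).
set q := taylor _ _ => h.
have /bigO_poly_coef/(_ _ jn) : bigO n (horner (q - p)).
  by apply: bigO_eq h => t; rewrite !hornerE; ring.
rewrite coefB coef_poly jn => /subr0_eq <-.
by rewrite divfK // pnatr_eq0 -lt0n fact_gt0.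
Qed.

Lemma derive1n_eq_bigO (R : realType) (V : set R) f g x n :
  open V -> smooth V f -> smooth V g -> V x ->
  (forall j, (j < n)%N -> derive1n j f x = derive1n j g x) <->
  bigO n (fun t => f (x + t) - g (x + t)).
Proof.
move=> oV sf sg Vx; have ft := taylor_bigO n oV sf Vx; have gt := taylor_bigO n oV sg Vx.
split=> [fg|fg j jn].
  apply: bigO_eq (bigO_sub ft gt) => t; rewrite opprB addrA addrAC.
  suff -> : taylor n (fun j => derive1n j f x) = taylor n (fun j => derive1n j g x).
    by ring.
  by apply/polyP => i; rewrite !coef_poly; case: ltnP => // /fg ->.
rewrite (taylor_unique oV sf Vx (p := taylor n (fun j => derive1n j g x)) (n := n)) //.
  by rewrite coef_poly jn divfK.
by apply: bigO_eq (bigO_add fg gt) => t; ring.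
Qed.

(** * Hankel forms and orthogonal polynomials *)

Section moments.
Variable R : realFieldType.
Implicit Types (m : nat -> R) (p q : {poly R}).

(* The linear functional on polynomials with moments [m]; [psd m n] says that the
   leading [n] x [n] section of the Hankel matrix [m (i + j)] is positive semidefinite. *)
Definition mom m p := \sum_(i < size p) p`_i * m i.

Lemma mom_widen m p n : (size p <= n)%N -> mom m p = \sum_(i < n) p`_i * m i.
Proof.
move=> pn; rewrite /mom (big_ord_widen n (fun i => p`_i * m i) pn) big_mkcond.
apply: eq_bigr => i _; case: ltnP => // pi.
by rewrite nth_default ?mul0r.
Qed.

Lemma momD m p q : mom m (p + q) = mom m p + mom m q.
Proof.
pose n := maxn (size p) (size q).
rewrite !(@mom_widen m _ n) ?size_polyD ?leq_max ?leqnn ?orbT // -big_split /=.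
by apply: eq_bigr => i _; rewrite coefD mulrDl.
Qed.

Lemma momZ m c p : mom m (c *: p) = c * mom m p.
Proof.
rewrite !(@mom_widen m _ (size p)) ?size_scale_leq // mulr_sumr.
by apply: eq_bigr => i _; rewrite coefZ mulrA.
Qed.

Lemma momN m p : mom m (- p) = - mom m p.
Proof. by rewrite -scaleN1r momZ mulN1r. Qed.

Lemma momB m p q : mom m (p - q) = mom m p - mom m q.
Proof. by rewrite momD momN. Qed.

Lemma mom0 m : mom m 0 = 0.
Proof. by rewrite -[0](scale0r 0) momZ mul0r. Qed.

Lemma mom_sum m (I : Type) (r : seq I) (P : pred I) (F : I -> {poly R}) :
  mom m (\sum_(i <- r | P i) F i) = \sum_(i <- r | P i) mom m (F i).
Proof. by elim/big_rec2: _ => [|i x p _ <-]; rewrite ?mom0 ?momD. Qed.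

Lemma momMXn m p k n : (size p <= n)%N ->
  mom m (p * 'X^k) = \sum_(i < n) p`_i * m (i + k)%N.
Proof.
move=> pn; rewrite (@mom_widen m _ (k + n)) ?big_split_ord /=; last first.
  rewrite (leq_trans (size_polyMleq _ _)) // size_polyXn addnS /= addnC.
  by rewrite leq_add2l.
rewrite big1 ?add0r; last first.
  by move=> i _; rewrite coefMXn ltn_ord mul0r.
by apply: eq_bigr => i _; rewrite coefMXn ltnNge leq_addr /= addKn addnC.
Qed.

Lemma momXn m k : mom m 'X^k = m k.
Proof. by rewrite -['X^k]mul1r (@momMXn _ _ _ 1%N) ?size_poly1 // big_ord1 coef1 mul1r. Qed.

Lemma mom_expand m p q : mom m (p * q) = \sum_(j < size q) q`_j * mom m (p * 'X^j).
Proof.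
rewrite -{1}[q]coefK poly_def mulr_sumr mom_sum.
by apply: eq_bigr => j _; rewrite -scalerAr momZ.
Qed.

Definition psd m n := forall p, (size p <= n)%N -> 0 <= mom m (p ^+ 2).

Definition orth m n p :=
  [/\ p \is monic, size p = n.+1 & forall j, (j < n)%N -> mom m (p * 'X^j) = 0].

Lemma orth_mom m n p q : orth m n p -> (size q <= n)%N -> mom m (p * q) = 0.
Proof.
move=> [_ _ h] qn; rewrite mom_expand big1 // => j _.
by rewrite h ?mulr0 // (leq_trans (ltn_ord j)).
Qed.

Lemma orth_decomp m n p q : orth m n p -> (size q <= n.+1)%N ->
  exists c r, q = c *: p + r /\ (size r <= n)%N.
Proof.
move=> [mp sp _] qn; exists q`_n, (q - q`_n *: p); split; first by rewrite addrC subrK.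
apply/leq_sizeP => j; rewrite leq_eqVlt => /orP[/eqP <-|nj].
  have pn : p`_n = 1 by move/monicP: mp; rewrite /lead_coef sp.
  by rewrite coefB coefZ pn mulr1 subrr.
rewrite coefB coefZ !(@nth_default _ 0 _ j) ?mulr0 ?subr0 //.
  by rewrite sp.
exact: leq_trans qn _.
Qed.

Lemma orth_sqr m n p : orth m n p -> mom m (p ^+ 2) = mom m (p * 'X^n).
Proof.
move=> o; have [mp sp _] := o.
have pE : p = 'X^n + (p - 'X^n) by rewrite addrC subrK.
rewrite expr2 {2}pE mulrDr momD [X in _ + X](orth_mom o) ?addr0 //.
apply/leq_sizeP => j; rewrite leq_eqVlt => /orP[/eqP <-|nj].
  have pn : p`_n = 1 by move/monicP: mp; rewrite /lead_coef sp.
  by rewrite coefB coefXn eqxx pn subrr.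
by rewrite coefB coefXn gtn_eqF // nth_default ?subr0 // sp.
Qed.

(** In [q = c p + r] the cross term vanishes by orthogonality, and [mom (p ^+ 2)] equals
    [mom (p * 'X^n)]: one new sign decides the next section of the matrix. *)
Lemma psdS m n p : psd m n -> orth m n p -> 0 <= mom m (p * 'X^n) -> psd m n.+1.
Proof.
move=> pm o p0 q qn; have [c [r [-> rn]]] := orth_decomp o qn.
have -> : (c *: p + r) ^+ 2 = c ^+ 2 *: p ^+ 2 + (2 * c) *: (p * r) + r ^+ 2.
  rewrite -!mul_polyC; rewrite !(rmorphM, rmorphXn) /= rmorph_nat; ring.
rewrite !momD !momZ (orth_mom o rn) mulr0 addr0 (orth_sqr o).
by rewrite addr_ge0 ?pm // mulr_ge0 // sqr_ge0.
Qed.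

(* The Hankel system for the coefficients is solvable even when its matrix is
   singular: a [v] in the kernel has [mom (v ^+ 2) = 0], hence by positivity
   [mom (v * 'X^n) = 0]. *)
Lemma psd_orth m n : psd m n.+1 -> exists p, orth m n p.
Proof.
move=> pm.
pose H := \matrix_(i < n, j < n) m (i + j)%N.
pose b := \row_(j < n) m (n + j)%N.
have /submxP[w bE] : (b <= H)%MS.
  rewrite submxE; apply/eqP/rowP => k; rewrite [RHS]mxE.
  pose v := rVpoly (col k (cokermx H))^T.
  have vn : (size v <= n)%N by exact: size_poly.
  have vX j : mom m (v * 'X^j) = \sum_(i < n) cokermx H i k * m (i + j)%N.
    rewrite (momMXn _ _ vn); apply: eq_bigr => i _.
    by rewrite coef_rVpoly_ord !mxE.
  have v0 j : (j < n)%N -> mom m (v * 'X^j) = 0.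
    move=> jn; rewrite vX.
    have := mulmx_coker H => /matrixP/(_ (Ordinal jn) k); rewrite !mxE => E; rewrite -[RHS]E.
    by apply: eq_bigr => i _; rewrite !mxE mulrC addnC.
  have vv : mom m (v ^+ 2) = 0.
    rewrite expr2 mom_expand big1 // => j _.
    by rewrite v0 ?mulr0 // (leq_trans (ltn_ord j)).
  (* Since [v ^+ 2] has moment 0, the square of ['X^n + (c / 2) v] has a moment affine in c.
     Nonnegativity for all c forces the slope to be 0. *)
  have : forall c, 0 <= mom m ('X^n ^+ 2) + c * mom m (v * 'X^n).
    move=> c.
    have E : ('X^n + (c / 2) *: v) ^+ 2 =
        'X^n ^+ 2 + c *: (v * 'X^n) + (c / 2) ^+ 2 *: v ^+ 2.
      have {2}-> : c = 2 * (c / 2) by field.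
      rewrite -!mul_polyC; rewrite !(rmorphM, rmorphXn) /= rmorph_nat; ring.
    have -> : mom m ('X^n ^+ 2) + c * mom m (v * 'X^n) = mom m (('X^n + (c / 2) *: v) ^+ 2).
      by rewrite E !momD !momZ vv mulr0 addr0.
    apply: pm; rewrite (leq_trans (size_polyD _ _)) // size_polyXn geq_max leqnn /=.
    by rewrite (leq_trans (size_scale_leq _ _)) // leqW.
  set A := mom m _; set B := mom m _ => h.
  have B0 : B = 0.
    apply/eqP/negP => /negP B0.
    by have := h (- (A + 1) / B); rewrite divfK //; lra.
  rewrite mxE -[RHS]B0 /B vX; apply: eq_bigr => i _.
  by rewrite !mxE mulrC addnC.
pose q := \poly_(i < n) (if insub i is Some i' then w 0 i' else 0).
have qE (i : 'I_n) : q`_i = w 0 i.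
  by rewrite coef_poly ltn_ord insubT // => ?; congr (w 0 _); apply/val_inj.
have qn : (size q <= n)%N by exact: size_poly.
have sp : size ('X^n - q) = n.+1.
  by rewrite size_polyDl ?size_polyXn // size_polyN.
exists ('X^n - q); split => //.
  by rewrite monicE lead_coefDl ?lead_coefXn // size_polyN size_polyXn.
move=> j jn; rewrite mulrBl momB -exprD momXn (momMXn _ _ qn).
move/rowP: bE => /(_ (Ordinal jn)); rewrite !mxE /= => ->.
apply/eqP; rewrite subr_eq0; apply/eqP; apply: eq_bigr => i _.
by rewrite qE !mxE.
Qed.

End moments.

(** * Orders of vanishing under inversion and composition *)

Lemma bigO_inv (R : realType) (f : R -> R) :
  bigO 1 (fun t => f t - f 0) -> f 0 != 0 -> bigO 0 (fun t => (f t)^-1).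
Proof.
move=> /bigO_gt0[C [d [C0 d0 d1 fC]]] f0.
have F0 : 0 < `|f 0| by rewrite normr_gt0.
exists (2 / `|f 0|), (Num.min d (`|f 0| / (2 * C))).
split; first by rewrite lt_min d0 divr_gt0 // mulr_gt0.
move=> t t0; rewrite lt_min => /andP[td]; rewrite ltr_pdivlMr ?mulr_gt0 // => tC.
have := fC t t0 td; rewrite expr1 expr0 mulr1 => ft.
have h : `|f 0| / 2 <= `|f t|.
  have := ler_normD (f t) (f 0 - f t); rewrite addrC subrK distrC => h1.
  have : C * `|t| <= `|f 0| / 2.
    by rewrite ler_pdivlMr // -mulrA mulrCA [C * 2]mulrC mulrC ltW // mulrC.
  lra.
rewrite normrV ?unitfE -?normr_gt0 ?(lt_le_trans _ h) ?divr_gt0 //.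
rewrite -[2 / _]invrK invf_div lef_pV2 // posrE ?divr_gt0 //.
by rewrite (lt_le_trans _ h) ?divr_gt0.
Qed.

Lemma bigO_comp1 (R : realType) n (f v : R -> R) :
  bigO n f -> f 0 = 0 -> bigO 1 v -> bigO n (f \o v).
Proof.
move=> /bigO_gt0[C [d [C0 d0 d1 fC]]] f0 /bigO_gt0[D [e [D0 e0 e1 vD]]].
exists (C * D ^+ n), (Num.min e (d / D)).
split; first by rewrite lt_min e0 divr_gt0.
move=> t t0; rewrite lt_min => /andP[te]; rewrite ltr_pdivlMr // => tD.
have := vD t t0 te; rewrite expr1 => vt.
have [v0|v0] := eqVneq (v t) 0.
  by rewrite /= v0 f0 normr0 !mulr_ge0 ?exprn_ge0 // ltW.
apply: le_trans (fC _ v0 _) _; first by rewrite (le_lt_trans vt) // mulrC.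
by rewrite -mulrA ler_pM2l // -exprMn lerXn2r // nnegrE ?mulr_ge0 // ltW.
Qed.

(** From [a^(j+1) - b^(j+1) = a (a^j - b^j) + (a - b) b^j]: for j > 0 each summand has a factor of
    order 1 beside one of order n. *)
Lemma bigO_exprB (R : realType) n (a b : R -> R) i :
  bigO 1 a -> bigO 1 b -> bigO n (fun t => a t - b t) -> (1 < i)%N ->
  bigO n.+1 (fun t => a t ^+ i - b t ^+ i).
Proof.
move=> a1 b1 ab.
have b0 j : bigO j (fun t => b t ^+ j).
  elim: j => [|j IHj]; first exact: bigO_cst.
  by apply: bigO_eq (bigO_mul b1 IHj) => t; rewrite exprS.
have step j : (0 < j)%N -> bigO n (fun t => a t ^+ j - b t ^+ j) ->
    bigO n.+1 (fun t => a t ^+ j.+1 - b t ^+ j.+1).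
  move=> j0 h; have := bigO_mul ab (bigOW j0 (b0 j)); rewrite addn1 => h2.
  apply: bigO_eq (bigO_add (bigO_mul a1 h) h2) => t.
  by rewrite !exprS; ring.
case: i => [|[|i]] // _; apply: (step) => //.
elim: i => [|i IHi]; first by apply: bigO_eq ab => t; rewrite !expr1.
by apply: bigOW (leqnSn n) _; exact: (step i.+1).
Qed.

Lemma bigO_sum (R : realType) n m (F : nat -> R -> R) :
  (forall i, bigO n (F i)) -> bigO n (fun t => \sum_(i < m) F i t).
Proof.
move=> Fn; elim: m => [|m IHm].
  by apply: bigO_eq (@bigO_poly R n 0 _) => [t|j _]; rewrite ?coef0 // horner0 big_ord0.
by apply: bigO_eq (bigO_add IHm (Fn m)) => t; rewrite big_ord_recr.
Qed.

(** Powers of degree at least 2 gain an order by [bigO_exprB], so only the linear term of p is seen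
    at order n. *)
Lemma bigO_hornerB (R : realType) n (a b : R -> R) (p : {poly R}) :
  bigO 1 a -> bigO 1 b -> bigO n (fun t => a t - b t) ->
  bigO n.+1 (fun t => p.[a t] - p.[b t] - p`_1 * (a t - b t)).
Proof.
move=> a1 b1 ab.
pose F i t := p`_i * (if (1 < i)%N then a t ^+ i - b t ^+ i else 0).
have Fn i : bigO n.+1 (F i).
  rewrite /F; case: ltnP => i1.
    by apply: bigO_eq (bigO_bounded (bigO_exprB a1 b1 ab i1) (bigO_cst p`_i)) => t; rewrite mulrC.
  by apply: bigO_eq (@bigO_poly R n.+1 0 _) => [t|j _]; rewrite ?coef0 // horner0 mulr0.
apply: bigO_eq (bigO_sum (size p).+2 Fn) => t.
have pw s : p.[s] = \sum_(i < (size p).+2) p`_i * s ^+ i.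
  by rewrite (@horner_coef_wide _ (size p).+2) // -addn2 leq_addr.
rewrite !pw -sumrB.
rewrite [LHS]big_ord_recl big_ord_recl.
rewrite [X in _ = X - _]big_ord_recl [X in _ = (_ + X) - _]big_ord_recl /F /= !mulr0 !add0r !expr0 !expr1.
rewrite subrr add0r mulrBr /bump /= !add1n [in RHS]addrC addKr.
by apply: eq_bigr => i _; rewrite /bump /= !add1n /= mulrBr.
Qed.

(** * Local inverses *)

Section local_inverse.
Variables (R : realType) (V : set R) (f : R -> R) (x : R).
Hypotheses (openV : open V) (sf : smooth V f) (Vx : V x).

Lemma smooth_continuous n y : V y -> {for y, continuous (derive1n n f)}.
Proof.
move=> Vy; exact/differentiable_continuous/derivable1_diffP/(sf (n := n.+1) (ltnSn n)).
Qed.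

Lemma smooth_near_continuous n : {near x, continuous (derive1n n f)}.
Proof.
by apply: filterS (open_nbhs_nbhs (conj openV Vx)) => y; apply: smooth_continuous.
Qed.

Lemma smooth_is_derive n y : V y ->
  is_derive y 1 (derive1n n f) (derive1n n.+1 f y).
Proof.
by move=> Vy; rewrite derive1nS derive1E; apply/derivableP/(sf (n := n.+1) (ltnSn n)).
Qed.

(** On the closed ball of radius [d] the derivative is positive, so f is injective there. [h] picks
    the preimage lying in this ball, with the default x where there is none. That h is also a right
    inverse near [f x] follows from continuity. *)
Lemma local_inverse_exists : 0 < derive1 f x -> exists h, is_local_inverse f x h.
Proof.
move=> f'0.
have [d1 d10 d1V] := open_dist openV Vx.
have [d2 d20 d2f] := continuous_dist (@smooth_continuous 1 x Vx) f'0.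
pose d := Num.min d1 d2 / 2.
have m0 : 0 < Num.min d1 d2 by rewrite lt_min d10.
have d0 : 0 < d by rewrite divr_gt0.
have near_d t : `|t| <= d -> V (x + t) /\ 0 < derive1 f (x + t).
  move=> td; have td' : `|t| < Num.min d1 d2.
    by apply: le_lt_trans td _; rewrite /d; lra.
  move: td'; rewrite lt_min => /andP[td1 td2]; split; first exact: d1V.
  by have := d2f t td2; rewrite derive1n1 ltr_norml => /andP[]; lra.
have incr s t : `|s - x| <= d -> `|t - x| <= d -> s < t -> f s < f t.
  move=> sd td st.
  have [|c /andP[sc ct] E] := @mvt R f (derive1 f) s t (ltW st).
    move=> c /andP[sc ct]; have [|Vc _] := near_d (c - x).
      move: sd td; rewrite !ler_norml; lra.
    rewrite addrC subrK in Vc.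
    by have := @smooth_is_derive 0 c Vc; rewrite derive1n1 derive1n0.
  rewrite -subr_gt0 E mulr_gt0 ?subr_gt0 //.
  have [|_] := near_d (c - x); last by rewrite addrC subrK.
  move: sd td; rewrite !ler_norml; lra.
pose h u := xget x [set t | `|t - x| <= d /\ f t = u].
have hK t : `|t - x| <= d -> h (f t) = t.
  move=> td; have : `|h (f t) - x| <= d /\ f (h (f t)) = f t.
    have P : exists s, [set s | `|s - x| <= d /\ f s = f t] s by exists t; split.
    exact: (xgetPex x P).
  move: (h (f t)) => s [sd fs].
  by have [st|st|//] := ltgtP s t; [have := incr s t sd td st|have := incr t s td sd st];
    rewrite fs ltxx.
have near_hK : {near x, cancel f h}.
  apply/nbhs_ballP; exists d => //= t.
  by rewrite /ball /= distrC => /ltW /hK.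
exists h; split => //.
  by apply: hK; rewrite subrr normr0 ltW.
exact: near_continuous_can_sym (@smooth_near_continuous 0) near_hK.
Qed.

(* Expanding [h (g (x + t)) - h (f (x + t))] to first order in [g - f]. *)
Lemma local_inverse_derive1n (h g : R -> R) n :
  derive1 f x != 0 -> is_local_inverse f x h -> smooth V g -> (1 < n)%N ->
  bigO n (fun t => g (x + t) - f (x + t)) ->
  derive1n n (h \o g) x = (derive1n n g x - derive1n n f x) / derive1 f x.
Proof.
move=> f'0 [hfx hf fh] sg n1 gf.
have gfx : g x = f x.
  by apply: ((derive1n_eq_bigO n openV sg sf Vx).2 gf 0%N); apply: leq_trans n1.
(* Differentiating [h \o g] needs three nested neighbourhoods: on [V1] f is regular and inverted by
   h, on [W] h takes values in [V1] and is a right inverse, and g maps [V2] into [W]. *)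
pose V1 := interior [set t | [/\ V t, derive1 f t != 0 & h (f t) = t]].
have oV1 : open V1 by exact: open_interior.
have V1P t : V1 t -> [/\ V t, derive1 f t != 0 & h (f t) = t].
  by move=> /interior_subset.
have V1x : V1 x.
  have h1 := open_nbhs_nbhs (conj openV Vx).
  have h2 : \forall t \near x, derive1 f t != 0.
    have N0 : 0 < `|derive1 f x| by rewrite normr_gt0.
    have [d d0 df] := continuous_dist (@smooth_continuous 1 x Vx) N0.
    apply/nbhs_ballP; exists d => //= t; rewrite /ball /= distrC => td.
    have := df _ td; rewrite [x + _]addrC subrK derive1n1; apply: contraTN => /eqP ->.
    by rewrite sub0r normrN ltxx.
  by apply: filterS3 h1 h2 hf => t *; split.
have hcont : {near f x, continuous h}.
  by apply: near_can_continuous hf (@smooth_near_continuous 0).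
pose W := interior [set y | V1 (h y) /\ f (h y) = y].
have oW : open W by exact: open_interior.
have WP y : W y -> V1 (h y) /\ f (h y) = y by move=> /interior_subset.
have Wfx : W (f x).
  have h1 : \forall y \near f x, V1 (h y).
    have := nbhs_singleton hcont; apply; rewrite hfx.
    exact: open_nbhs_nbhs.
  by apply: filterS2 h1 fh => y *; split.
have dh y : W y -> is_derive y 1 h (derive1 f (h y))^-1.
  move=> /WP[V1h fhy]; have [Vh f'h _] := V1P _ V1h.
  rewrite -{1}fhy; apply: is_derive_inverse => //.
  - by apply: filterS (open_nbhs_nbhs (conj oV1 V1h)) => t /V1P[].
  - by apply: filterS (open_nbhs_nbhs (conj openV Vh)) => t; apply: (@smooth_continuous 0).
  - by have := @smooth_is_derive 0 _ Vh; rewrite derive1n1 derive1n0.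
have sV1 (u : R -> R) : smooth V u -> smooth V1 u.
  by move=> su m j y jm /V1P[Vy _ _]; apply: (su m).
have sh : smooth W h.
  move=> m; apply: (cn_local_inverse (V := V1) (f := f)) => //.
  - by move=> t /V1P[].
  - by move=> y /WP[].
  - exact: sV1.
pose V2 := interior [set t | V1 t /\ W (g t)].
have oV2 : open V2 by exact: open_interior.
have V2P t : V2 t -> V1 t /\ W (g t) by move=> /interior_subset.
have V2x : V2 x.
  have h1 : \forall t \near x, W (g t).
    have cg : {for x, continuous g}.
      exact/differentiable_continuous/derivable1_diffP/(sg 1%N 0%N).
    by apply: cg; rewrite gfx; exact: open_nbhs_nbhs.
  by apply: filterS2 h1 (open_nbhs_nbhs (conj oV1 V1x)) => t *; split.
have shg : smooth V2 (h \o g).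
  move=> m; apply: (cn_comp oV2 oW) => //; first by move=> t /V2P[].
  by move=> j y jm /V2P[/V1P[Vy _ _] _]; apply: (sg m).
pose a t := g (x + t) - f x; pose b t := f (x + t) - f x.
have diff1 (u : R -> R) : smooth V u -> bigO 1 (fun t => u (x + t) - u x).
  move=> su; apply: bigO_eq (taylor_bigO 1 openV su Vx) => t.
  by rewrite horner_poly big_ord1 fact0 divr1 expr0 mulr1.
have a1 : bigO 1 a by rewrite /a -gfx; exact: diff1.
have b1 : bigO 1 b by exact: diff1.
have ab : bigO n (fun t => a t - b t).
  by apply: bigO_eq gf => t; rewrite /a /b; ring.
pose H := taylor n.+1 (fun j => derive1n j h (f x)).
have H1 : H`_1 = (derive1 f x)^-1.
  rewrite coef_poly ltnS (ltnW n1) [1`!]/= divr1 derive1n1 derive1E.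
  by have := dh _ Wfx; rewrite hfx => -[_ ->].
have hH : bigO n.+1 (fun v => h (f x + v) - H.[v]) := taylor_bigO n.+1 oW sh Wfx.
have hH0 : h (f x + 0) - H.[0] = 0.
  by rewrite addr0 horner_coef0 coef_poly /= fact0 divr1 subrr.
have hHa := bigO_comp1 hH hH0 a1; have hHb := bigO_comp1 hH hH0 b1.
(* Replacing h by its Taylor polynomial [H] costs order n + 1, as [a] and [b] are of order 1; in [H]
   only the linear coefficient [1 / f'(x)] survives. *)
have main : bigO n.+1 (fun t => (h \o g) (x + t) - (x + t) - (derive1 f x)^-1 * (g (x + t) - f (x + t))).
  have [d d0 hf'] : exists2 d : R, 0 < d & forall t, `|t| < d -> h (f (x + t)) = x + t.
    have [d d0 dV] := open_dist oV1 V1x.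
    by exists d => // t /dV /V1P[].
  apply: (bigO_eq_near d0 _ (bigO_add (bigO_sub hHa hHb) (bigO_hornerB H a1 b1 ab))).
  move=> t td; rewrite /= H1 /a /b ![f x + _]addrC !subrK (hf' _ td).
  ring.
set e := derive1n n g x - derive1n n f x.
have gfe : bigO n.+1 (fun t => g (x + t) - f (x + t) - e / n`!%:R * t ^+ n).
  apply: bigO_eq (bigO_sub (taylor_bigO n.+1 openV sg Vx) (taylor_bigO n.+1 openV sf Vx)) => t.
  suff -> : taylor n.+1 (fun j => derive1n j g x) = taylor n.+1 (fun j => derive1n j f x) + (e / n`!%:R) *: 'X^n.
    by rewrite !hornerE; ring.
  apply/polyP => i; rewrite coefD coefZ coefXn !coef_poly ltnS.
  case: ltngtP => [ni|ni|->]; rewrite ?mulr0 ?addr0 //.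
    by rewrite ((derive1n_eq_bigO n openV sg sf Vx).2 gf).
  by rewrite mulr1 -mulrDl /e addrC subrK.
(* As n > 1, the terms [x] and ['X] do not meet the coefficient of degree n, which carries the
   claimed derivative. *)
pose p := x%:P + 'X + (e / derive1 f x / n`!%:R) *: 'X^n.
have hp : bigO n.+1 (fun t => (h \o g) (x + t) - p.[t]).
  apply: bigO_eq (bigO_add main (bigO_bounded gfe (bigO_cst (derive1 f x)^-1))) => t.
  by rewrite /p !hornerE; ring.
rewrite (taylor_unique oV2 shg V2x hp (ltnSn n)).
have [n0 n2] : (n == 0)%N = false /\ (n == 1)%N = false.
  by case: (n) n1 => [|[]].
rewrite !coefD coefC coefX coefZ coefXn eqxx n0 n2.
by rewrite !add0r mulr1 divfK.
Qed.

End local_inverse.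

(** * Pade approximants and Schwarzian derivatives as moments *)

Section pade.
Variables (R : realType) (U : set R) (phi : R -> R) (x : R).
Hypotheses (openU : open U) (sphi : smooth U phi) (Ux : U x).
Hypothesis dphi : 0 < derive1 phi x.

Definition tcoef (f : R -> R) (y : R) i : R := derive1n i f y / i`!%:R.
Definition hmom (f : R -> R) (y : R) i := tcoef f y i.+1.

(* For [q] the denominator of a Pade approximant, the reversed polynomial of [q] is
   the orthogonal polynomial: its orthogonality relations are the linear equations
   saying that [q * phi] has vanishing coefficients in degrees [k + 1, ..., 2 k]. *)
Lemma mom_rev (q A : {poly R}) k j (a : nat -> R) :
  (size q <= k.+1)%N -> (forall i, (i <= (k + j).+1)%N -> A`_i = a i) ->
  mom (fun i => a i.+1) ((\poly_(i < k.+1) q`_(k - i)) * 'X^j) =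
  (q * A)`_(k + j).+1.
Proof.
move=> qk Aa; rewrite (momMXn _ _ (size_poly _ _)) coefM.
rewrite -(big_mkord xpredT (fun i => q`_i * A`_((k + j).+1 - i))).
rewrite (big_cat_nat (n := k.+1)) //=; last by rewrite ltnS ltnW // ltnS leq_addr.
rewrite [X in _ = _ + X]big_nat [X in _ = _ + X]big1 ?addr0; last first.
  by move=> i /andP[ki _]; rewrite nth_default ?mul0r // (leq_trans qk).
rewrite big_mkord (reindex_inj rev_ord_inj) /=; apply: eq_bigr => i _.
have ik : (i <= k)%N by rewrite -ltnS.
rewrite subSS coef_poly ltnS leq_subr subKn // Aa; last by rewrite leq_subr.
by congr (_ * a _); lia.
Qed.

Section ratmap.
Variable r : ratmap R.
Hypothesis denx : (ratden r).[x] != 0.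

Definition rat_dom := U `&` [set y | (ratden r).[y] != 0].

Lemma open_rat_dom : open rat_dom.
Proof.
apply: openI => //.
rewrite (_ : [set y | _] = horner (ratden r) @^-1` [set y | y != 0]) //.
apply: open_comp (open_neq (y := 0 : R)) => y _.
exact: continuous_horner.
Qed.

Lemma smooth_rateval : smooth rat_dom (rateval r).
Proof.
move=> n; apply: cn_mul; [exact: open_rat_dom|exact: cn_poly|].
apply: cn_inv; [exact: open_rat_dom|by move=> y []|].
apply: cn_poly; exact: open_rat_dom.
Qed.

Lemma smooth_rat_dom f : smooth U f -> smooth rat_dom f.
Proof. by move=> sf n m y mn [Uy _]; apply: (sf n). Qed.

Lemma rat_domx : rat_dom x. Proof. by split. Qed.

Definition shiftp (p : {poly R}) := p \Po ('X + x%:P).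

Lemma shiftpE p t : (shiftp p).[t] = p.[x + t].
Proof. by rewrite horner_comp !hornerE addrC. Qed.

(** Multiplying by the denominator, which is invertible near x, makes the contact condition linear
    in the coefficients of numerator and denominator. A general [psi] is allowed because a corrected
    phi is used in [schwarzian_orth]. *)
Lemma rateval_bigO n (psi : R -> R) (A : {poly R}) :
  bigO n (fun t => psi (x + t) - A.[t]) ->
  bigO n (fun t => psi (x + t) - rateval r (x + t)) <->
  forall i, (i < n)%N -> (shiftp (ratden r) * A - shiftp (ratnum r))`_i = 0.
Proof.
move=> phiA.
have q0 : (shiftp (ratden r)).[0] != 0 by rewrite shiftpE addr0.
have [d d0 dV] := open_dist open_rat_dom rat_domx.
have eqE t : `|t| < d -> (shiftp (ratden r) * A - shiftp (ratnum r)).[t] =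
    (shiftp (ratden r)).[t] * ((psi (x + t) - rateval r (x + t)) - (psi (x + t) - A.[t])).
  move=> /dV[_ /= nz]; rewrite !(hornerE, hornerM) !shiftpE /rateval; field; exact: nz.
split=> [h|h].
  apply: bigO_poly_coef.
  have := bigO_bounded (bigO_sub h phiA) (bigO_poly0 (shiftp (ratden r))).
  by apply: (bigO_eq_near d0) => t td; rewrite eqE // mulrC.
have := bigO_bounded (bigO_poly h) (bigO_inv (f := horner (shiftp (ratden r))) _ q0).
move=> h1; apply: (bigO_eq_near d0) (bigO_add (h1 _) phiA) => [t td|].
  rewrite eqE // mulrC mulKf ?subrK // shiftpE.
  by have [_] := dV _ td.
have -> : (fun t => (shiftp (ratden r)).[t] - (shiftp (ratden r)).[0]) =
    horner (shiftp (ratden r) - ((shiftp (ratden r)).[0])%:P).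
  by apply/funext => t; rewrite !hornerE.
by apply: bigO_poly => -[] // _; rewrite coefB coefC /= horner_coef0 subrr.
Qed.

End ratmap.

Lemma size_shiftp p : size (shiftp p) = size p.
Proof. by rewrite size_comp_poly2 // size_XaddC. Qed.

(** With [q] and [p] the normalized denominator and numerator, [q * A - p] vanishes up to degree 2k,
    and its coefficient of degree 2k + 1 is the first defect of contact. As [p] has degree at most
    k, reading these coefficients of [q * A] as moments gives orthogonality and the value at
    ['X^k]. *)
Lemma schwarzian_orth k s : is_schwarzian k phi x s ->
  exists p, orth (hmom phi x) k p /\
    mom (hmom phi x) (p * 'X^k) = s * derive1 phi x / (2 * k).+1`!%:R.
Proof.
move=> [k0 _ _ [r [h [[rdeg denx rj] hinv ->]]]].
set n := (2 * k).+1.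
have n1 : (1 < n)%N by rewrite /n ltnS muln_gt0.
have oV := @open_rat_dom r; have Vx := rat_domx denx.
have sV := smooth_rat_dom (r := r) sphi; have sr := smooth_rateval (r := r).
have rn := (derive1n_eq_bigO n oV sr sV Vx).1 (fun j jn => rj j jn).
have rn' : bigO n (fun t => phi (x + t) - rateval r (x + t)).
  by apply: bigO_eq (bigO_opp rn) => t; rewrite opprB.
have r1 : derive1 (rateval r) x = derive1 phi x.
  by have := rj 1%N; rewrite !derive1n1; apply; rewrite muln_gt0.
rewrite (local_inverse_derive1n oV sr Vx _ hinv sV n1 rn') r1 ?gt_eqF // divfK ?gt_eqF //.
set e := _ - _.
pose c := (ratden r).[x].
pose q := c^-1 *: shiftp (ratden r); pose p := c^-1 *: shiftp (ratnum r).
pose A := taylor n.+1 (fun j => derive1n j phi x).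
have [sp sq] : (size p <= k.+1)%N /\ (size q <= k.+1)%N.
  rewrite !(leq_trans (size_scale_leq _ _)) // size_shiftp;
  by move: rdeg; rewrite /ratdeg; lia.
have q0 : q`_0 = 1.
  by rewrite coefZ -horner_coef0 shiftpE addr0 mulVf.
have phiA := taylor_bigO n.+1 oV sV Vx.
have rA := taylor_bigO n.+1 oV sr Vx.
(* Removing the first defect from phi produces a function with one more order of contact with r, so
   that [rateval_bigO] also determines the coefficient of degree n. *)
pose psi y := phi y - e / n`!%:R * (y - x) ^+ n.
pose B := A - (e / n`!%:R) *: 'X^n.
have psiB : bigO n.+1 (fun t => psi (x + t) - B.[t]).
  by apply: bigO_eq phiA => t; rewrite /psi /B !hornerE [x + t - x]addrAC subrr add0r; ring.
have psir : bigO n.+1 (fun t => psi (x + t) - rateval r (x + t)).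
  apply: bigO_eq (bigO_sub phiA rA) => t; rewrite /psi [x + t - x]addrAC subrr add0r.
  suff -> : taylor n.+1 (fun j => derive1n j phi x) =
      taylor n.+1 (fun j => derive1n j (rateval r) x) + (e / n`!%:R) *: 'X^n.
    by rewrite !hornerE; ring.
  apply/polyP => j; rewrite coefD coefZ coefXn !coef_poly ltnS.
  case: ltngtP => [nj|nj|->]; rewrite ?mulr0 ?addr0 //.
    by rewrite rj.
  by rewrite mulr1 -mulrDl /e addrC subrK.
have key i : (i <= n)%N -> (q * A)`_i = p`_i + (i == n)%:R * (e / n`!%:R).
  move=> ile; have /(_ i ile) := (rateval_bigO denx psiB).1 psir.
  move=> /(congr1 ( *%R c^-1)); rewrite mulr0 -coefZ scalerBr scalerAl -/q -/p.
  rewrite /B mulrBr -scalerAr !coefB coefZ coefMXn => /eqP.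
  rewrite subr_eq0 subr_eq => /eqP ->; congr (_ + _).
  case: ltngtP ile => // [_ _|-> _]; first by rewrite mul0r mulr0.
  by rewrite subnn q0 mul1r mulr1.
pose P := \poly_(i < k.+1) q`_(k - i).
have Pk : P`_k = 1 by rewrite coef_poly ltnSn subnn q0.
have sP : size P = k.+1 by rewrite size_poly_eq // subnn q0 oner_neq0.
have momP j : (j <= k)%N -> mom (hmom phi x) (P * 'X^j) = (q * A)`_(k + j).+1.
  move=> jk; apply: (mom_rev (a := tcoef phi x)) => // i ij.
  by rewrite coef_poly ifT // ltnS (leq_trans ij) // /n mul2n -addnn ltnS leq_add2l.
have pkj j : p`_(k + j).+1 = 0.
  by rewrite nth_default // (leq_trans sp) // ltnS leq_addr.
exists P; split.
  split; [by rewrite monicE /lead_coef sP Pk|exact: sP|].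
  move=> j jk; rewrite (momP _ (ltnW jk)) key; last first.
    by rewrite /n mul2n -addnn ltnS leq_add2l ltnW.
  by rewrite pkj ltn_eqF ?mul0r ?addr0 // /n mul2n -addnn ltnS ltn_add2l.
rewrite (momP _ (leqnn k)) addnn -mul2n key // eqxx mul1r.
by rewrite /n mul2n -addnn pkj add0r.
Qed.

Lemma orth_schwarzian k p : (0 < k)%N -> orth (hmom phi x) k p ->
  exists s, is_schwarzian k phi x s.
Proof.
move=> k0 [mp sp op].
pose A := taylor (2 * k).+1 (fun j => derive1n j phi x).
pose q := \poly_(i < k.+1) p`_(k - i).
have pk : p`_k = 1 by move/monicP: mp; rewrite /lead_coef sp.
have q0 : q`_0 = 1 by rewrite coef_poly /= subn0.
have qrev : \poly_(i < k.+1) q`_(k - i) = p.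
  apply/polyP => i; rewrite coef_poly; case: ltnP => [ik|ik].
    by rewrite coef_poly ltnS leq_subr subKn.
  by rewrite nth_default // sp.
have qA j : (j < k)%N -> (q * A)`_(k + j).+1 = 0.
  move=> jk; rewrite -(mom_rev (a := tcoef phi x)) ?size_poly ?qrev ?op // => i ij.
  by rewrite coef_poly ifT // ltnS (leq_trans ij) // mul2n -addnn ltn_add2l.
pose num0 := take_poly k.+1 (q * A).
pose num := num0 \Po ('X - x%:P); pose den := q \Po ('X - x%:P).
have denx : den.[x] = 1.
  by rewrite horner_comp !hornerE subrr horner_coef0.
have den0 : den != 0 by apply/eqP => d0; move: denx; rewrite d0 horner0 => /eqP; rewrite eq_sym oner_eq0.
(* [ratmap] requires coprimality. The common factor divides [den], which is 1 at x, so cancelling it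
   creates no pole at x and loses no contact. *)
pose g := gcdp num den.
have g0 : g != 0 by rewrite gcdp_eq0 negb_and den0 orbT.
have numE : num = (num %/ g) * g by rewrite divpK // dvdp_gcdl.
have denE : den = (den %/ g) * g by rewrite divpK // dvdp_gcdr.
have dg0 : den %/ g != 0 by apply: contra_neq den0 => E; rewrite denE E mul0r.
have cop : coprimep (num %/ g) (den %/ g).
  by apply: coprimep_div_gcd; rewrite den0 orbT.
pose r := RatMap dg0 cop.
have rdenx : (ratden r).[x] != 0.
  by apply: contra_eq_neq denx => E; rewrite denE hornerM E mul0r eq_sym oner_neq0.
have size_sub (f : {poly R}) : size (f \Po ('X - x%:P)) = size f.
  by rewrite size_comp_poly2 // size_XsubC.
have rdeg : (ratdeg r <= k)%N.
  rewrite /ratdeg geq_max.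
  have h1 : (size (ratnum r) <= k.+1)%N.
    by rewrite (leq_trans (leq_divp _ _)) // size_sub size_take_poly.
  have h2 : (size (ratden r) <= k.+1)%N.
    by rewrite (leq_trans (leq_divp _ _)) // size_sub size_poly.
  by rewrite -!subn1 !leq_subLR !add1n h1 h2.
have oV := @open_rat_dom r; have Vx := rat_domx rdenx.
have sV := smooth_rat_dom (r := r) sphi; have sr := smooth_rateval (r := r).
have shiftK f : shiftp (f \Po ('X - x%:P)) = f.
  by rewrite /shiftp -comp_polyA comp_polyB comp_polyX comp_polyC addrK comp_polyXr.
have phiA := taylor_bigO (2 * k).+1 openU sphi Ux.
have rphi : bigO (2 * k).+1 (fun t => phi (x + t) - rateval r (x + t)).
  apply/(rateval_bigO rdenx phiA) => i ik.
  have h : shiftp g * (shiftp (ratden r) * A - shiftp (ratnum r)) = q * A - num0.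
    rewrite mulrBr mulrA /shiftp -!comp_polyM -/(shiftp _) -/(shiftp _).
    by rewrite ![g * _]mulrC -denE -numE !shiftK.
  have h0 j : (j <= i)%N -> (q * A - num0)`_j = 0.
    move=> ji; rewrite coefB coef_take_poly; case: ltnP => kj; first by rewrite subrr.
    rewrite subr0; have -> : j = (k + (j - k.+1)).+1 by lia.
    by apply: qA; lia.
  have gx : (shiftp g)`_0 != 0.
    rewrite -horner_coef0 shiftpE addr0; apply: contra_eq_neq denx => E.
    by rewrite denE hornerM E mulr0 eq_sym oner_neq0.
  move: h; set F := _ - _ => h.
  (* The product of [shiftp g] with [F] vanishes to the required order and [shiftp g] has nonzero
     constant coefficient, so the coefficients of [F] vanish one after the other. *)
  elim/ltn_ind: i ik h0 => i IHi ik h0.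
  have := h0 i (leqnn i); rewrite -h coefM big_ord_recl /= subn0 big1 ?addr0.
    by move=> /eqP; rewrite mulf_eq0 (negPf gx) => /eqP.
  move=> j _; have ji := ltn_ord j; rewrite /bump /= add1n IHi ?mulr0 //.
  - by rewrite ltn_subrL /= (leq_trans _ ji).
  - exact: leq_ltn_trans (leq_subr _ _) ik.
  - by move=> l li; apply: h0; apply: leq_trans li (leq_subr _ _).
have rj : forall j, (j < (2 * k).+1)%N -> derive1n j (rateval r) x = derive1n j phi x.
  apply/(derive1n_eq_bigO _ oV sr sV Vx).
  by apply: bigO_eq (bigO_opp rphi) => t; rewrite opprB.
have r1 : derive1 (rateval r) x = derive1 phi x.
  by have := rj 1%N; rewrite !derive1n1; apply; rewrite ltnS muln_gt0.
have [h hinv] := local_inverse_exists oV sr Vx (eq_ind_r (fun z => 0 < z) dphi r1).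
exists (derive1n (2 * k).+1 (h \o phi) x); split => //.
- by apply: (cn_nderivable openU) => //; apply: sphi.
- by rewrite derive1n1 gt_eqF.
- by exists r, h; split => //; split.
Qed.

(** Each [S_k] extends positivity from degree below k to degree k through [psdS]; the start, degree
    0, is [phi'(x) > 0]. Conversely positivity first produces the orthogonal polynomial, hence the
    approximant, and then the sign. *)
Lemma schwarzian_psd : (forall k, (0 < k)%N -> exists2 s, is_schwarzian k phi x s & 0 <= s) <->
  forall n, psd (hmom phi x) n.
Proof.
split=> [h|h k k0].
  elim=> [|n IHn].
    by move=> p; rewrite leqn0 size_poly_eq0 => /eqP ->; rewrite expr0n mom0.
  case: n IHn => [|n] IHn.
    move=> p p1; rewrite (size1_polyC p1) -rmorphXn /= -alg_polyC momZ.
    by rewrite -(expr0 'X) momXn mulr_ge0 ?sqr_ge0 // /hmom /tcoef divr1 derive1n1 ltW.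
  have [//|s /schwarzian_orth[p [op pE]] s0] := h n.+1.
  apply: psdS IHn op _; rewrite pE divr_ge0 // mulr_ge0 // ltW //.
have [p op] := psd_orth (h k.+1).
have [s ss] := orth_schwarzian k0 op; exists s => //.
(* This [p'] need not be [p], since a singular Hankel matrix may allow several orthogonal
   polynomials; its square serves equally well. *)
have [p' [op' pE]] := schwarzian_orth ss.
have := h k.+1 p'; rewrite (orth_sqr op') pE.
have [_ -> _] := op'; rewrite leqnn => /(_ isT).
by rewrite pmulr_lge0 ?invr_gt0 ?ltr0n ?fact_gt0 // pmulr_lge0.
Qed.

End pade.

(** * Positivity on polynomials that are nonnegative on [-M, M] *)

Lemma expr_small (R : realType) (r e : R) : 0 <= r < 1 -> 0 < e -> exists n, r ^+ n <= e.
Proof.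
move=> /andP[r0 r1] e0.
have /cvgrPdist_le /(_ _ e0)[n _ h] : r ^+ k @[k --> \oo] --> (0 : R).
  by apply: cvg_expr; rewrite ger0_norm.
by exists n; have := h n (leqnn n); rewrite sub0r normrN ger0_norm ?exprn_ge0.
Qed.

Section positivity.
Variables (R : realType) (m : nat -> R) (M C : R).
Hypothesis M0 : 0 < M.
Hypothesis mpsd : forall n, psd m n.
Hypothesis mbnd : forall n, m (2 * n)%N <= C * M ^+ (2 * n).
Implicit Types p q : {poly R}.
Local Notation L := (mom m).

Lemma mom_sqr_ge0 p : 0 <= L (p ^+ 2).
Proof. exact: (mpsd (leqnn _)). Qed.

Lemma discr_le (a b d : R) : (forall c, 0 <= a + 2 * b * c + d * c ^+ 2) ->
  b ^+ 2 <= a * d.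
Proof.
move=> h.
have a0 : 0 <= a by have := h 0; rewrite mulr0 expr0n mulr0 !addr0.
have [d0|d0|d0] := ltgtP 0 d.
- have := h (- b / d); rewrite -(pmulr_lge0 _ d0).
  have -> : (a + 2 * b * (- b / d) + d * (- b / d) ^+ 2) * d = a * d - b ^+ 2.
    by field; rewrite gt_eqF.
  by rewrite subr_ge0.
- exfalso.
  (* For d < 0 this c is at least 1 and makes [2 b + d c] at most [- |a| - 1], so the quadratic is
     negative there. *)
  pose c := (`|a| + 1 + `|2 * b|) / (- d) + 1.
  have nd : 0 < - d by rewrite oppr_gt0.
  have c1 : 1 <= c by rewrite lerDr divr_ge0 ?ltW // addr_ge0 // addr_ge0.
  have := h c; apply/negP; rewrite -ltNge.
  have dc : d * c = - (`|a| + 1 + `|2 * b|) + d.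
    by rewrite /c; field; rewrite ?oppr_eq0 lt_eqF.
  rewrite expr2 mulrA -addrA -mulrDl dc.
  have : (2 * b - (`|a| + 1 + `|2 * b|) + d) * c <= (- `|a| - 1) * 1.
    have h1 : 2 * b - (`|a| + 1 + `|2 * b|) + d <= - `|a| - 1.
      by have := ler_norm (2 * b); lra.
    apply: (@le_trans _ _ ((- `|a| - 1) * c)); first by rewrite ler_wpM2r // (le_trans _ c1).
    by rewrite ler_wnM2l //; have := normr_ge0 a; lra.
  have := ler_norm a; lra.
- suff -> : b = 0 by rewrite expr0n -d0 mulr0.
  apply/eqP/negP => /negP b0.
  have := h (- (a + 1) / (2 * b)); rewrite -d0 mul0r addr0 mulrC divfK ?mulf_neq0 //.
  by lra.
Qed.

Lemma mom_CS p q : L (p * q) ^+ 2 <= L (p ^+ 2) * L (q ^+ 2).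
Proof.
apply: discr_le => c; have := mom_sqr_ge0 (p + c *: q).
have -> : (p + c *: q) ^+ 2 = p ^+ 2 + (2 * c) *: (p * q) + c ^+ 2 *: q ^+ 2.
  rewrite -!mul_polyC; rewrite !(rmorphM, rmorphXn) /= rmorph_nat; ring.
by rewrite !momD !momZ; rewrite mulrAC [L (q ^+ 2) * _]mulrC.
Qed.

(** Only even moments are bounded by hypothesis; an odd one is controlled by its two neighbours
    through Cauchy-Schwarz. *)
Lemma mom_bound n : `|m n| <= C * M ^+ n.
Proof.
have ev k : 0 <= m (2 * k)%N.
  by rewrite -(momXn m) mulnC exprM mom_sqr_ge0.
have C0 : 0 <= C by have := mbnd 0; rewrite expr0 mulr1; exact: le_trans (ev 0).
have -> : n = (odd n + 2 * n./2)%N by rewrite mul2n odd_double_half.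
set k := n./2; case: (odd n); rewrite ?add0n ?add1n; last first.
  by rewrite ger0_norm ?ev.
rewrite -ler_sqr ?nnegrE ?mulr_ge0 // ?exprn_ge0 // ?(ltW M0) //.
rewrite real_normK ?num_real //.
have := mom_CS ('X^k) ('X^(k.+1)).
rewrite -exprD momXn -!exprM !momXn addnS addnn -mul2n ![(_ * 2)%N]mulnC.
move=> /le_trans; apply.
apply: le_trans (ler_pM (ev _) (ev _) (mbnd _) (mbnd _)) _.
by rewrite exprMn -exprM mulrACA -expr2 -exprD; (have -> : (2 * k + 2 * k.+1 = (2 * k).+1 * 2)%N by lia); exact: lexx.
Qed.

(* [u j = L ('X^j * p) ^+ 2] is log-convex and [O (M ^+ (2 * j))], so its first ratio
   is at most [M ^+ 2]. *)
Lemma momX2 p : L ('X^2 * p ^+ 2) <= M ^+ 2 * L (p ^+ 2).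
Proof.
pose u j := L (('X^j * p) ^+ 2).
have u0 j : 0 <= u j by exact: mom_sqr_ge0.
have -> : 'X^2 * p ^+ 2 = ('X^1 * p) ^+ 2 by rewrite expr1 exprMn.
have -> : p ^+ 2 = ('X^0 * p) ^+ 2 by rewrite expr0 mul1r.
rewrite -/(u 1%N) -/(u 0%N).
have lc j : u j.+1 ^+ 2 <= u j * u j.+2.
  have := mom_CS ('X^j * p) ('X^(j.+2) * p).
  suff -> : 'X^j * p * ('X^(j.+2) * p) = ('X^(j.+1) * p) ^+ 2 by [].
  by rewrite mulrACA -expr2 exprMn -exprD -exprM (_ : (j + j.+2 = j.+1 * 2)%N) //; lia.
have [D uD] : exists D, forall j, u j <= D * (M ^+ 2) ^+ j.
  exists (\sum_(i < size (p ^+ 2)) `|(p ^+ 2)`_i| * (C * M ^+ i)) => j.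
  rewrite /u exprMn -!exprM ['X^_ * _]mulrC (@momMXn _ _ _ _ (size (p ^+ 2))) //.
  rewrite mulr_suml; apply: ler_sum => i _.
  apply: le_trans (ler_norm _) _; rewrite normrM -!mulrA ler_wpM2l //.
  apply: le_trans (mom_bound _) _.
  by rewrite -exprD mulnC.
have [//|lt] := leP (u 1%N) (M ^+ 2 * u 0%N).
have [u00|u00] := eqVneq (u 0%N) 0.
  have := lc 0%N; rewrite u00 mul0r => h.
  have : u 1%N ^+ 2 == 0 by rewrite eq_le h sqr_ge0.
  by rewrite expf_eq0 /= => /eqP u10; move: lt; rewrite u10 u00 mulr0 ltxx.
have u0p : 0 < u 0%N by rewrite lt_neqAle eq_sym u00 u0.
pose r := u 1%N / u 0%N.
have M2 : 0 < M ^+ 2 by rewrite exprn_gt0.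
have rM : M ^+ 2 < r by rewrite ltr_pdivlMr.
have r0 : 0 < r by exact: lt_trans rM.
have step j : 0 < u j /\ r * u j <= u j.+1.
  elim: j => [|j [uj IHj]]; first by rewrite u0p /r divfK.
  have uj1 : 0 < u j.+1 by apply: lt_le_trans IHj; rewrite mulr_gt0.
  split => //; rewrite -(ler_pM2l uj) -(ler_pM2l uj1).
  have h1 : u j.+1 * (u j * (r * u j.+1)) <= u j.+1 * (u j.+1 * u j.+1).
    by rewrite ler_pM2l // mulrCA mulrA ler_pM2r.
  apply: le_trans h1 _; rewrite ler_pM2l // -expr2; exact: lc.
have grow j : r ^+ j * u 0%N <= u j.
  elim: j => [|j IHj]; first by rewrite expr0 mul1r.
  by apply: le_trans (step j).2; rewrite exprS -mulrA ler_pM2l.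
have D1 : 0 < `|D| + 1 by rewrite ltr_wpDl.
have [n hn] : exists n, (M ^+ 2 / r) ^+ n <= u 0%N / (2 * (`|D| + 1)).
  apply: expr_small; last by rewrite divr_gt0 ?mulr_gt0.
  by rewrite divr_ge0 ?(ltW r0) ?(ltW M2) // ltr_pdivrMr // mul1r.
have := le_trans (grow n) (uD n); rewrite mulrC -ler_pdivlMr ?exprn_gt0 // -mulrA -expr_div_n.
move=> h; have : u 0%N <= (`|D| + 1) * (u 0%N / (2 * (`|D| + 1))).
  apply: le_trans h _; apply: le_trans (_ : (`|D| + 1) * (M ^+ 2 / r) ^+ n <= _).
    by rewrite ler_wpM2r ?exprn_ge0 ?divr_ge0 ?(ltW r0) ?(ltW M2) //; have := ler_norm D; lra.
  by rewrite ler_wpM2l // ltW.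
have -> : (`|D| + 1) * (u 0%N / (2 * (`|D| + 1))) = u 0%N / 2 by field; rewrite gt_eqF.
lra.
Qed.

Inductive sos : {poly R} -> Prop :=
| sos0 : sos 0
| sos_add q p : sos p -> sos (q ^+ 2 + p).

Lemma sosD p q : sos p -> sos q -> sos (p + q).
Proof. by move=> sp sq; elim: sp => [|r s _ h]; rewrite ?add0r // -addrA; constructor. Qed.

Lemma sos_sqr p : sos (p ^+ 2).
Proof. by rewrite -[_ ^+ 2]addr0; do 2!constructor. Qed.

Lemma sos_mul p q : sos p -> sos q -> sos (p * q).
Proof.
move=> sp sq; elim: sp => [|r s _ h]; first by rewrite mul0r; constructor.
rewrite mulrDl; apply: sosD h.
elim: sq => [|u v _ h]; first by rewrite mulr0; constructor.
by rewrite mulrDr -exprMn; constructor.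
Qed.

Let g : {poly R} := (M ^+ 2)%:P - 'X^2.

Definition qmod p := exists a b, [/\ sos a, sos b & p = a + b * g].

Lemma qmod_sos p : sos p -> qmod p.
Proof. by move=> sp; exists p, 0; split; [|constructor|rewrite mul0r addr0]. Qed.

Lemma qmodD p q : qmod p -> qmod q -> qmod (p + q).
Proof.
move=> [a [b [sa sb ->]]] [c [d [sc sd ->]]].
by exists (a + c), (b + d); split; [exact: sosD|exact: sosD|ring].
Qed.

(** With a single generator g the cross term contains [g ^+ 2], itself a square, so the quadratic
    module is closed under products. This allows a positive polynomial to be treated factor by
    factor. *)
Lemma qmodM p q : qmod p -> qmod q -> qmod (p * q).
Proof.
move=> [a [b [sa sb ->]]] [c [d [sc sd ->]]].
exists (a * c + b * d * g ^+ 2), (a * d + b * c); split.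
- by apply: sosD; [exact: sos_mul|apply: sos_mul (sos_sqr _); exact: sos_mul].
- by apply: sosD; exact: sos_mul.
- by ring.
Qed.

Lemma qmodC c : 0 <= c -> qmod c%:P.
Proof.
by move=> c0; rewrite -(sqr_sqrtr c0) rmorphXn; apply/qmod_sos/sos_sqr.
Qed.

(** For e = 1 or e = -1, [2 M (M + e X) = (M + e X)^2 + (M^2 - X^2)]. *)
Lemma qmod_linear (e : R) : e ^+ 2 = 1 -> qmod (M%:P + e *: 'X).
Proof.
move=> e1.
have -> : M%:P + e *: 'X = ((2 * M)^-1)%:P * ((M%:P + e *: 'X) ^+ 2 + g).
  have -> : (M%:P + e *: 'X) ^+ 2 + g = (2 * M)%:P * (M%:P + e *: 'X).
    have e1' : e%:P ^+ 2 = 1 :> {poly R} by rewrite -rmorphXn /= e1.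
    rewrite /g -mul_polyC !rmorphXn rmorphM /= rmorph_nat sqrrD exprMn e1'.
    by ring.
  by rewrite mulrA -rmorphM /= mulVf ?mul1r // mulf_neq0 ?gt_eqF.
apply: qmodM; first by apply: qmodC; rewrite invr_ge0 mulr_ge0 // ltW.
apply: qmodD; first exact/qmod_sos/sos_sqr.
exists 0, 1; split; [constructor| |by rewrite add0r mul1r].
by rewrite -(expr1n _ 2); exact: sos_sqr.
Qed.

Lemma mom_sos_ge0 p : sos p -> 0 <= L p.
Proof. by elim=> [|q r _ h]; rewrite ?mom0 // momD addr_ge0 ?mom_sqr_ge0. Qed.

(** [momX2] says precisely that the functional is nonnegative on [g] times a square. *)
Lemma mom_qmod_ge0 p : qmod p -> 0 <= L p.
Proof.
move=> [a [b [sa sb ->]]]; rewrite momD addr_ge0 //; first exact: mom_sos_ge0.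
elim: sb => [|q r _ h]; first by rewrite mul0r mom0.
rewrite mulrDl momD addr_ge0 // /g mulrBr mulrC mul_polyC momB momZ subr_ge0.
by rewrite mulrC; exact: momX2.
Qed.

(* A real root outside [-M, M] or a pair of conjugate roots can be split off,
   and the corresponding factor is in the quadratic module of [M^2 - X^2]. *)
Lemma gt0_qmod p : (forall s : R, - M <= s <= M -> 0 < p.[s]) -> qmod p.
Proof.
have [n] := ubnP (size p); elim: n p => // n IHn p; rewrite ltnS => pn p0.
have [p1|p1] := leqP (size p) 1.
  move: p0; rewrite (size1_polyC p1) => /(_ 0); rewrite hornerC => h.
  by apply/qmodC/ltW/h; rewrite oppr_le0 !ltW.
have [z rz] : exists z, root (map_poly (real_complex R) p) z.
  by apply/closed_rootP; rewrite size_map_poly gtn_eqF.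
have [b0|b0] := eqVneq (complex.Im z) 0.
  have pa : root p (complex.Re z).
    have zE : z = (complex.Re z)%:C%C by case: z b0 {rz} => ? ? /= ->.
    by move: rz; rewrite {1}zE fmorph_root.
  move: pa; set a := complex.Re z => pa.
  have [p2 pE] := factor_theorem p a pa.
  have p2n : (size p2 < n)%N.
    have p20 : p2 != 0.
      by apply: contraTneq p1 => E; rewrite pE E mul0r size_poly0.
    by apply: leq_trans pn; rewrite pE size_Mmonic ?monicXsubC // size_XsubC addn2.
  have aM : a < - M \/ M < a.
    apply/orP; rewrite -[_ || _]negbK negb_or -!leNgt; apply/negP => aM.
    by have := p0 a aM; rewrite (rootP pa) ltxx.
  case: aM => aM.
    rewrite pE; apply: qmodM.
      apply: IHn => // s sM; have := p0 s sM; rewrite pE hornerM hornerXsubC.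
      by rewrite pmulr_lgt0 //; move: sM aM; lra.
    rewrite (_ : 'X - a%:P = (- a - M)%:P + (M%:P + 1 *: 'X)); last first.
      by rewrite scale1r !rmorphB rmorphN /=; ring.
    apply: qmodD; first by apply: qmodC; move: aM; lra.
    by apply: qmod_linear; rewrite expr1n.
  have -> : p = (- p2) * (a%:P - 'X) by rewrite pE mulNr -mulrN opprB.
  apply: qmodM.
    apply: IHn; rewrite ?size_polyN // => s sM; have := p0 s sM.
    rewrite pE hornerM hornerXsubC hornerN -mulrNN.
    by rewrite pmulr_lgt0 //; move: sM aM; lra.
  rewrite (_ : a%:P - 'X = (a - M)%:P + (M%:P + (- 1) *: 'X)); last first.
    by rewrite scaleN1r !rmorphB /=; ring.
  apply: qmodD; first by apply: qmodC; move: aM; lra.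
  by apply: qmod_linear; rewrite sqrrN expr1n.
pose a := complex.Re z; pose b := complex.Im z.
pose q := ('X - a%:P) ^+ 2 + (b ^+ 2)%:P.
have qz : (map_poly (real_complex R) q).[z] = 0.
  rewrite /q rmorphD rmorphXn rmorphB /= map_polyX !map_polyC /=.
  rewrite hornerD hornerC horner_exp hornerXsubC /a /b.
  case: z {rz a b q b0} => a b /=; simpc.
  by rewrite expr2; simpc; congr (_ +i* _)%C; ring.
have q0 s : 0 < q.[s].
  rewrite /q hornerD hornerC horner_exp hornerXsubC ltr_wpDl ?sqr_ge0 //.
  by rewrite exprn_even_gt0.
have sq : size q = 3%N.
  rewrite /q size_polyDl; first by rewrite size_exp_XsubC.
  by rewrite size_exp_XsubC (leq_ltn_trans (size_polyC_leq1 _)).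
have qn0 : q != 0 by rewrite -size_poly_gt0 sq.
(* The remainder has degree at most 1 and real coefficients, and vanishes at the nonreal [z]; so it
   is 0. *)
have r0 : p %% q = 0.
  have rs : (size (p %% q)%R <= 2)%N by rewrite -ltnS -sq ltn_modp.
  have rz0 : (map_poly (real_complex R) (p %% q)).[z] = 0.
    move: rz => /rootP; rewrite {1}(divp_eq p q) rmorphD rmorphM /= hornerD hornerM.
    by rewrite qz mulr0 add0r.
  move: rz0; rewrite (@horner_coef_wide _ 2) ?size_map_poly // big_ord_recl big_ord1.
  rewrite !coef_map /= expr0 expr1 mulr1 => E.
  have E1 : (p %% q)`_1 = 0.
    move: E => /(congr1 (@complex.Im R)); rewrite /b in b0 *.
    case: (z) b0 => u v /=; simpc => v0 /eqP; rewrite mulf_eq0 (negPf v0) orbF.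
    by move/eqP.
  have E0 : (p %% q)`_0 = 0.
    by move: E; rewrite E1 mul0r addr0 => /complexI.
  by apply/polyP => -[|[|i]]; rewrite coef0 // nth_default // (leq_trans rs).
have pE : p = (p %/ q) * q by rewrite {1}(divp_eq p q) r0 addr0.
rewrite pE; apply: qmodM; last first.
  apply: qmodD; first exact/qmod_sos/sos_sqr.
  by apply: qmodC; exact: sqr_ge0.
apply: IHn.
  by rewrite size_divp // sq /=; apply: leq_trans pn; rewrite ltn_subrL (ltnW p1).
move=> s sM; have := p0 s sM; rewrite {1}pE hornerM.
by rewrite pmulr_lgt0.
Qed.

(** Splitting off roots needs strict positivity on the interval; adding a constant e > 0 provides
    it, and e then tends to 0. *)
Lemma mom_ge0 p : (forall s : R, - M <= s <= M -> 0 <= p.[s]) -> 0 <= L p.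
Proof.
move=> p0; rewrite -oppr_le0.
apply: (@small_le0 _ _ (L 1) 1) => // e e0 _.
rewrite -subr_ge0 opprK addrC mulrC -momZ -momD.
apply/mom_qmod_ge0/gt0_qmod => s sM.
by rewrite hornerD hornerZ hornerC mulr1 ltr_wpDl // p0.
Qed.

End positivity.

(** * The modulus of complex numbers *)

Section cabs.
Variable R : realType.
Implicit Types z w : R[i].

(** The norm of [R[i]] takes its values in [R[i]], which is only partially ordered. A modulus with
    values in R keeps the estimates in a totally ordered field. *)
Definition cabs z : R := Num.sqrt (complex.Re z ^+ 2 + complex.Im z ^+ 2).

Lemma normCE z : `|z| = (cabs z)%:C%C. Proof. exact: normc_def. Qed.

Lemma cabs_ge0 z : 0 <= cabs z. Proof. exact: sqrtr_ge0. Qed.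

Lemma cabsM z w : cabs (z * w) = cabs z * cabs w.
Proof. by apply/complexI; rewrite rmorphM /= -!normCE normrM. Qed.

Lemma cabsD z w : cabs (z + w) <= cabs z + cabs w.
Proof. by rewrite -lecR rmorphD /= -!normCE ler_normD. Qed.

Lemma cabsN z : cabs (- z) = cabs z.
Proof. by apply/complexI; rewrite -!normCE normrN. Qed.

Lemma cabsB z w : cabs (z - w) <= cabs z + cabs w.
Proof. by rewrite -(cabsN w) cabsD. Qed.

Lemma cabs_distC z w : cabs (z - w) = cabs (w - z).
Proof. by rewrite -cabsN opprB. Qed.

Lemma cabs_lerB z w : cabs z - cabs w <= cabs (z - w).
Proof. by rewrite lerBlDr -{1}(subrK w z) cabsD. Qed.

Lemma cabsX z n : cabs (z ^+ n) = cabs z ^+ n.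
Proof. by apply/complexI; rewrite rmorphXn /= -!normCE normrX. Qed.

Lemma cabsV z : cabs z^-1 = (cabs z)^-1.
Proof. by apply/complexI; rewrite fmorphV /= -!normCE normfV. Qed.

Lemma cabs0 : cabs 0 = 0.
Proof. by apply/complexI; rewrite -normCE normr0. Qed.

Lemma cabs1 : cabs 1 = 1.
Proof. by apply/complexI; rewrite -normCE normr1. Qed.

Lemma cabs_eq0 z : (cabs z == 0) = (z == 0).
Proof. by rewrite -[RHS]normr_eq0 normCE fmorph_eq0. Qed.

Lemma cabs_gt0 z : (0 < cabs z) = (z != 0).
Proof. by rewrite lt_neqAle cabs_ge0 andbT eq_sym cabs_eq0. Qed.

Lemma cabsR (x : R) : cabs x%:C%C = `|x|.
Proof. by rewrite /cabs /= expr0n addr0 sqrtr_sqr. Qed.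

Lemma Re_le_cabs z : `|complex.Re z| <= cabs z.
Proof. by rewrite -sqrtr_sqr ler_wsqrtr // lerDl sqr_ge0. Qed.

Lemma Im_le_cabs z : `|complex.Im z| <= cabs z.
Proof. by rewrite -sqrtr_sqr ler_wsqrtr // lerDr sqr_ge0. Qed.

Lemma cabs_le z : cabs z <= `|complex.Re z| + `|complex.Im z|.
Proof.
rewrite -[leRHS]ger0_norm ?addr_ge0 // -sqrtr_sqr ler_wsqrtr //.
rewrite sqrrD !real_normK ?num_real //.
have : 0 <= `|complex.Re z| * `|complex.Im z| by rewrite mulr_ge0.
by rewrite -mulr_natl; lra.
Qed.

Lemma sqr_cabs z : cabs z ^+ 2 = complex.Re z ^+ 2 + complex.Im z ^+ 2.
Proof. by rewrite sqr_sqrtr // addr_ge0 // sqr_ge0. Qed.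

End cabs.

(** * Uniform limits of polynomials on [-M, M] *)

Section approximable.
Variables (R : realType) (M : R).
Implicit Types (f g : R -> R) (p q : {poly R}).

Local Notation I s := (- M <= s <= M).

(** Stands in for continuity on the segment: it provides directly the polynomials through which the
    functional is extended. *)
Definition apx f := forall e : R, 0 < e ->
  exists p : {poly R}, forall s : R, I s -> `|f s - p.[s]| <= e.

Lemma apx_eq f g : (forall s : R, I s -> f s = g s) -> apx f -> apx g.
Proof. by move=> fg h e /h[p pf]; exists p => s Is; rewrite -fg // pf. Qed.

Lemma apx_poly p : apx (horner p).
Proof. by move=> e e0; exists p => s _; rewrite subrr normr0 ltW. Qed.

Lemma apx_bounded f : apx f -> exists2 K : R, 0 < K & forall s : R, I s -> `|f s| <= K.
Proof.
move=> /(_ 1 ltr01)[p pf].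
pose K := \sum_(i < size p) `|p`_i| * `|M| ^+ i.
have pK s : I s -> `|p.[s]| <= K.
  move=> Is; rewrite horner_coef; apply: le_trans (ler_norm_sum _ _ _) _.
  apply: ler_sum => i _; rewrite normrM ler_wpM2l // normrX.
  by rewrite lerXn2r ?nnegrE // (le_trans _ (ler_norm M)) // ler_norml.
exists (`|K| + 1) => [|s Is]; first by rewrite ltr_wpDl.
rewrite -(subrK p.[s] (f s)) addrC (le_trans (ler_normD _ _)) // lerD ?pf //.
by rewrite (le_trans (pK s Is)) ?ler_norm.
Qed.

Lemma apxD f g : apx f -> apx g -> apx (fun s => f s + g s).
Proof.
move=> hf hg e e0; have e2 : 0 < e / 2 by rewrite divr_gt0.
have [p pf] := hf _ e2; have [q qg] := hg _ e2.
exists (p + q) => s Is; rewrite hornerD opprD addrACA (le_trans (ler_normD _ _)) //.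
by have := pf s Is; have := qg s Is; lra.
Qed.

Lemma apxM f g : apx f -> apx g -> apx (fun s => f s * g s).
Proof.
move=> hf hg e e0.
have [K K0 fK] := apx_bounded hf; have [K' K'0 gK] := apx_bounded hg.
(* The bound [d <= 1] gives [|q| <= K' + 1] on the segment, and the total error [K d + d (K' + 1)]
   is then at most e. *)
pose d := Num.min 1 (e / (K + K' + 1)).
have S0 : 0 < K + K' + 1 by rewrite !addr_gt0.
have d0 : 0 < d by rewrite lt_min ltr01 divr_gt0.
have [p pf] := hf _ d0; have [q qg] := hg _ d0.
exists (p * q) => s Is; rewrite hornerM.
have -> : f s * g s - p.[s] * q.[s] =
   f s * (g s - q.[s]) + (f s - p.[s]) * (g s - (g s - q.[s])) by ring.
apply: (@le_trans _ _ (K * d + d * (K' + 1))).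
  apply: le_trans (ler_normD _ _) _; rewrite !normrM.
  apply: lerD; apply: ler_pM; rewrite ?normr_ge0 ?fK ?gK ?pf ?qg //.
  apply: le_trans (ler_normB _ _) _; rewrite lerD ?gK //.
  by apply: le_trans (qg s Is) _; rewrite /d ge_min lexx.
rewrite [K * d]mulrC -mulrDr addrA -ler_pdivlMr //.
by rewrite /d ge_min lexx orbT.
Qed.

Lemma apx_cst c : apx (fun=> c).
Proof. by apply: apx_eq (apx_poly c%:P) => s _; rewrite hornerC. Qed.

Lemma apx_id : apx id.
Proof. by apply: apx_eq (apx_poly 'X) => s _; rewrite hornerX. Qed.

Lemma apxZ c f : apx f -> apx (fun s => c * f s).
Proof. by apply: apxM; apply: apx_cst. Qed.

Lemma apxN f : apx f -> apx (fun s => - f s).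
Proof. by move=> /(apxZ (-1)); apply: apx_eq => s _; rewrite mulN1r. Qed.

Lemma apxB f g : apx f -> apx g -> apx (fun s => f s - g s).
Proof. by move=> hf /apxN; apply: apxD. Qed.

Lemma apxX f n : apx f -> apx (fun s => f s ^+ n).
Proof.
move=> hf; elim: n => [|n IHn]; first exact: apx_cst.
by apply: apx_eq (apxM hf IHn) => s _; rewrite exprS.
Qed.

Lemma apx_lim f : (forall e : R, 0 < e -> exists2 g, apx g &
  forall s : R, I s -> `|f s - g s| <= e) -> apx f.
Proof.
move=> h e e0; have e2 : 0 < e / 2 by rewrite divr_gt0.
have [g hg fg] := h _ e2; have [p pg] := hg _ e2.
exists p => s Is; have := fg s Is; have := pg s Is => h1 h2.
have -> : f s - p.[s] = (f s - g s) + (g s - p.[s]) by ring.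
by apply: le_trans (ler_normD _ _) _; lra.
Qed.

Lemma apx_geom f n : apx f -> apx (fun s => \sum_(i < n) f s ^+ i).
Proof.
move=> hf; elim: n => [|n IHn].
  by apply: apx_eq (apx_cst 0) => s _; rewrite big_ord0.
by apply: apx_eq (apxD IHn (apxX n hf)) => s _; rewrite big_ord_recr.
Qed.

(* [1/f = K^-1 \sum_i (1 - f/K)^i] converges uniformly when [0 < d <= f <= K]. *)
Lemma apxV f (d : R) : 0 < d -> apx f -> (forall s : R, I s -> d <= f s) ->
  apx (fun s => (f s)^-1).
Proof.
move=> d0 hf fd; have [K K0 fK] := apx_bounded hf.
apply: apx_lim => e e0.
(* Dividing by [K + d] instead of [K] gives [0 <= r < 1] without comparing d with K, whose order is
   unknown when the segment is empty. *)
pose r := 1 - d / (K + d).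
have Kd : 0 < K + d by rewrite addr_gt0.
have r01 : 0 <= r < 1.
  apply/andP; split; last by rewrite gtrBl divr_gt0.
  by rewrite subr_ge0 ler_pdivrMr // mul1r lerDr ltW.
have [n rn] := expr_small r01 (mulr_gt0 e0 d0).
pose h s := 1 - f s / (K + d).
have ah : apx h.
  apply: apxB (apx_cst 1) _; apply: apx_eq (apxZ (K + d)^-1 hf) => s _; exact: mulrC.
exists (fun s => (K + d)^-1 * \sum_(i < n) h s ^+ i).
  exact/apxZ/apx_geom.
move=> s Is.
have fs0 : 0 < f s by apply: lt_le_trans (fd s Is).
have hE : (K + d)^-1 * (\sum_(i < n) h s ^+ i) = (1 - h s ^+ n) / f s.
  have E := subrX1 (h s) n.
  have h1 : h s - 1 = - (f s / (K + d)) by rewrite /h; ring.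
  rewrite -[1 - _]opprB E h1; field.
  by rewrite !gt_eqF.
have hs0 : 0 <= h s.
  rewrite /h subr_ge0 ler_pdivrMr // mul1r.
  by apply: le_trans (ler_norm _) _; apply: le_trans (fK s Is) _; rewrite lerDl ltW.
have -> : (f s)^-1 - (K + d)^-1 * (\sum_(i < n) h s ^+ i) = h s ^+ n / f s.
  by rewrite hE; ring.
rewrite ger0_norm ?divr_ge0 ?exprn_ge0 ?(ltW fs0) // ler_pdivrMr //.
apply: (@le_trans _ _ (r ^+ n)).
  apply: lerXn2r; rewrite ?nnegrE.
  - exact: hs0.
  - by case/andP: r01.
  - by rewrite /h /r lerD2l lerN2 ler_pM2r ?invr_gt0 ?fd.
by apply: le_trans rn _; rewrite ler_pM2l ?fd.
Qed.

End approximable.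

(** * Extension of a positive functional to approximable functions *)

Section functional.
Variables (R : realType) (m : nat -> R) (M : R).
Local Notation I s := (- M <= s <= M).
Hypothesis m_ge0 : forall p, (forall s : R, I s -> 0 <= p.[s]) -> 0 <= mom m p.
Implicit Types (f g : R -> R) (p q : {poly R}).
Local Notation L := (mom m).

(* The extension of the positive functional [L] to the uniform closure of the
   polynomials on [[- M, M]]. The [sup] is a junk value unless [apx M f]. *)
Definition lam f := sup [set L p | p in [set p | forall s : R, I s -> p.[s] <= f s]].

Lemma L_mono p q : (forall s : R, I s -> p.[s] <= q.[s]) -> L p <= L q.
Proof.
move=> pq; rewrite -subr_ge0 -momB; apply: m_ge0 => s Is.
by rewrite hornerD hornerN subr_ge0 pq.
Qed.

Lemma L1_ge0 : 0 <= L 1.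
Proof. by apply: m_ge0 => s _; rewrite hornerC. Qed.

(** [p - e] competes in the supremum and [p + e] bounds it. Linearity of [lam] is transferred from
    polynomials by this estimate and [small_le0]. *)
Lemma lam_approx f p e : (forall s : R, I s -> `|f s - p.[s]| <= e) ->
  `|lam f - L p| <= e * L 1.
Proof.
move=> fp; rewrite ler_norml.
have ub : ubound [set L p | p in [set p | forall s : R, I s -> p.[s] <= f s]] (L (p + e *: 1)).
  move=> _ [q /= qf <-]; apply: L_mono => s Is; rewrite hornerD hornerZ hornerC mulr1.
  apply: le_trans (qf s Is) _; have := fp s Is; rewrite ler_norml => /andP[]; lra.
have mem : [set L p | p in [set p | forall s : R, I s -> p.[s] <= f s]] (L (p - e *: 1)).
  exists (p - e *: 1) => //= s Is; rewrite hornerD hornerN hornerZ hornerC mulr1.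
  have := fp s Is; rewrite ler_norml => /andP[]; lra.
have h1 : lam f <= L (p + e *: 1) by apply: ge_sup => //; exists (L (p - e *: 1)).
have h2 : L (p - e *: 1) <= lam f by apply: ub_le_sup => //; exists (L (p + e *: 1)).
move: h1 h2; rewrite momD momB momZ; lra.
Qed.

Lemma lam_poly p : lam (horner p) = L p.
Proof.
apply/eqP; rewrite -subr_eq0 -normr_le0 -(mul0r (L 1)).
by apply: lam_approx => s _; rewrite subrr normr0.
Qed.

Lemma lam_eq f g : (forall s : R, I s -> f s = g s) -> lam f = lam g.
Proof.
move=> fg; rewrite /lam; congr (sup (_ @` _)); apply/funext => p; apply/propext.
by split=> h s Is; [rewrite -fg // h|rewrite fg // h].
Qed.

Lemma lamD f g : apx M f -> apx M g -> lam (fun s => f s + g s) = lam f + lam g.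
Proof.
move=> hf hg; apply/esym.
have L0 := L1_ge0.
apply/eqP; rewrite -subr_eq0 -normr_le0.
apply: (@small_le0 _ _ (4 * L 1) 1) => // e e0 _.
have [p fp] := hf e e0; have [q gq] := hg e e0.
have h3 : `|lam (fun s => f s + g s) - L (p + q)| <= (2 * e) * L 1.
  apply: lam_approx => s Is; rewrite hornerD opprD addrACA.
  apply: le_trans (ler_normD _ _) _; have := fp s Is; have := gq s Is; lra.
have h1 := lam_approx fp; have h2 := lam_approx gq.
move: h1 h2 h3; rewrite momD !ler_norml => /andP[? ?] /andP[? ?] /andP[? ?].
by apply/andP; split; lra.
Qed.

Lemma lamZ c f : apx M f -> lam (fun s => c * f s) = c * lam f.
Proof.
move=> hf; have L0 := L1_ge0.
apply/eqP; rewrite -subr_eq0 -normr_le0.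
apply: (@small_le0 _ _ (2 * `|c| * L 1) 1) => // e e0 _.
have [p fp] := hf e e0.
have h1 := lam_approx fp.
have h2 : `|lam (fun s => c * f s) - L (c *: p)| <= (`|c| * e) * L 1.
  apply: lam_approx => s Is; rewrite hornerZ -mulrBr normrM ler_wpM2l //.
  exact: fp.
have -> : lam (fun s => c * f s) - c * lam f =
   (lam (fun s => c * f s) - L (c *: p)) - c * (lam f - L p) by rewrite momZ; ring.
apply: le_trans (ler_normB _ _) _; rewrite normrM.
have := ler_wpM2l (normr_ge0 c) h1; lra.
Qed.

Lemma lam_ge0 f : apx M f -> (forall s : R, I s -> 0 <= f s) -> 0 <= lam f.
Proof.
move=> hf f0; rewrite -(mom0 m); apply: ub_le_sup; last first.
  by exists 0 => //= s Is; rewrite horner0 f0.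
have [p fp] := hf 1 ltr01; exists (L (p + 1 *: 1)) => _ [q /= qf <-].
apply: L_mono => s Is; rewrite hornerD hornerZ hornerC mulr1.
apply: le_trans (qf s Is) _; have := fp s Is; rewrite ler_norml => /andP[]; lra.
Qed.

Lemma lam_mono f g : apx M f -> apx M g -> (forall s : R, I s -> f s <= g s) -> lam f <= lam g.
Proof.
move=> hf hg fg; rewrite -subr_ge0 -mulN1r -lamZ // -lamD //; last exact: apxZ.
by apply: lam_ge0 => [|s Is]; [exact/apxD/apxZ|rewrite mulN1r subr_ge0 fg].
Qed.

Lemma lam_cst c : lam (fun=> c) = c * L 1.
Proof.
rewrite -momZ -lam_poly; apply: lam_eq => s _.
by rewrite hornerZ hornerC mulr1.
Qed.

Lemma lam_norm f K : apx M f -> (forall s : R, I s -> `|f s| <= K) -> `|lam f| <= K * L 1.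
Proof.
move=> hf fK; rewrite ler_norml -mulNr -!lam_cst.
by apply/andP; split; apply: lam_mono => //; try exact: apx_cst;
  move=> s /fK; rewrite ler_norml => /andP[].
Qed.

Lemma lam_sum n (F : nat -> R -> R) : (forall i, apx M (F i)) ->
  lam (fun s => \sum_(i < n) F i s) = \sum_(i < n) lam (F i).
Proof.
move=> hF.
have aS k : apx M (fun s => \sum_(i < k) F i s).
  elim: k => [|k IHk]; first by apply: apx_eq (apx_cst M 0) => s _; rewrite big_ord0.
  by apply: apx_eq (apxD IHk (hF k)) => s _; rewrite big_ord_recr.
elim: n => [|n IHn].
  rewrite big_ord0 -[RHS](mul0r (mom m 1)) -lam_cst.
  by apply: lam_eq => s _; rewrite big_ord0.
rewrite big_ord_recr /= -IHn -lamD //.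
by apply: lam_eq => s _; rewrite big_ord_recr.
Qed.

End functional.

(** * Image of a functional under a weighted change of variable *)

Section push.
Variables (R : realType) (m1 m2 : nat -> R) (M1 M2 M : R) (sg w : R -> R).
Hypothesis M1M : M1 <= M.
Hypothesis m1_ge0 : forall p : {poly R}, (forall s : R, - M1 <= s <= M1 -> 0 <= p.[s]) -> 0 <= mom m1 p.
Hypothesis m2_ge0 : forall p : {poly R}, (forall s : R, - M2 <= s <= M2 -> 0 <= p.[s]) -> 0 <= mom m2 p.
Hypothesis apx_sg : apx M2 sg.
Hypothesis apx_w : apx M2 w.
Hypothesis sgM : forall s : R, - M2 <= s <= M2 -> - M <= sg s <= M.
Hypothesis m12 : forall n, m1 n = lam m2 M2 (fun s => w s * sg s ^+ n).

Lemma apx_horner (p : {poly R}) (f : R -> R) : apx M2 f -> apx M2 (fun s => p.[f s]).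
Proof.
move=> hf; elim/poly_ind: p => [|p c IHp].
  by apply: apx_eq (apx_cst M2 0) => s _; rewrite horner0.
apply: apx_eq (apxD (apxM IHp hf) (apx_cst M2 c)) => s _.
by rewrite hornerMXaddC.
Qed.

Lemma mom_push (p : {poly R}) : mom m1 p = lam m2 M2 (fun s => w s * p.[sg s]).
Proof.
have h i : apx M2 (fun s => p`_i * (w s * sg s ^+ i)) by apply/apxZ/apxM/apxX.
have -> : mom m1 p = \sum_(i < size p) lam m2 M2 (fun s => p`_i * (w s * sg s ^+ i)).
  by apply: eq_bigr => i _; rewrite m12 (lamZ m2_ge0) //; apply/apxM/apxX.
rewrite -(lam_sum m2_ge0 _ h); apply: (lam_eq m2) => s _.
by rewrite horner_coef mulr_sumr; apply: eq_bigr => i _; rewrite mulrCA.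
Qed.

Lemma apx_push f : apx M f -> apx M2 (fun s => f (sg s)).
Proof.
move=> hf; apply: apx_lim => e e0; have [p fp] := hf e e0.
by exists (fun s => p.[sg s]) => [|s Is]; [exact: apx_horner|exact/fp/sgM].
Qed.

(* If the moments [m1] are those of the image under [sg] of the weighted functional
   [w * m2], the two functionals agree on all approximable functions. *)
Lemma lam_push f : apx M f -> lam m1 M1 f = lam m2 M2 (fun s => w s * f (sg s)).
Proof.
move=> hf; have [K K0 wK] := apx_bounded apx_w.
have L1 := L1_ge0 m1_ge0; have L2 := L1_ge0 m2_ge0.
apply/eqP; rewrite -subr_eq0 -normr_le0.
apply: (@small_le0 _ _ (mom m1 1 + K * mom m2 1) 1) => // e e0 _.
have [p fp] := hf e e0.
have h1 : `|lam m1 M1 f - mom m1 p| <= e * mom m1 1.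
  apply: (lam_approx m1_ge0) => s /andP[s1 s2]; apply: fp.
  by rewrite (le_trans _ s1) ?lerN2 // (le_trans s2).
have a1 := apxM apx_w (apx_push hf); have a2 := apxM apx_w (apx_horner p apx_sg).
have h2 : `|lam m2 M2 (fun s => w s * f (sg s)) - mom m1 p| <= (K * e) * mom m2 1.
  rewrite mom_push -mulN1r -(lamZ m2_ge0) // -(lamD m2_ge0) //; last exact: apxZ.
  apply: (lam_norm m2_ge0) => [|s Is]; first exact/apxD/apxZ.
  by rewrite mulN1r -mulrBr normrM ler_pM ?wK // fp // sgM.
have -> : lam m1 M1 f - lam m2 M2 (fun s => w s * f (sg s)) = (lam m1 M1 f - mom m1 p)
  - (lam m2 M2 (fun s => w s * f (sg s)) - mom m1 p) by ring.
apply: le_trans (ler_normB _ _) _; lra.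
Qed.

End push.

(** * The functional on complex-valued functions *)

Section complex_functional.
Variables (R : realType) (M : R).
Local Notation I s := (- M <= s <= M).
Implicit Types (f g : R -> R[i]).
Local Notation Re := (@complex.Re R).
Local Notation Im := (@complex.Im R).

Definition apxc f := apx M (fun s => Re (f s)) /\ apx M (fun s => Im (f s)).

Lemma cReM (z w : R[i]) : Re (z * w) = Re z * Re w - Im z * Im w.
Proof. by case: z w => [? ?] [? ?]. Qed.
Lemma cImM (z w : R[i]) : Im (z * w) = Re z * Im w + Im z * Re w.
Proof. by case: z w => [? ?] [? ?]. Qed.
Lemma cReD (z w : R[i]) : Re (z + w) = Re z + Re w.
Proof. by case: z w => [? ?] [? ?]. Qed.
Lemma cImD (z w : R[i]) : Im (z + w) = Im z + Im w.
Proof. by case: z w => [? ?] [? ?]. Qed.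
Lemma cReV (z : R[i]) : Re z^-1 = Re z * (cabs z ^+ 2)^-1.
Proof. by rewrite sqr_cabs; case: z => [? ?]. Qed.
Lemma cImV (z : R[i]) : Im z^-1 = - (Im z * (cabs z ^+ 2)^-1).
Proof. by rewrite sqr_cabs; case: z => [? ?]. Qed.

Lemma apxc_eq f g : (forall s, I s -> f s = g s) -> apxc f -> apxc g.
Proof. by move=> fg [h1 h2]; split; [apply: apx_eq h1|apply: apx_eq h2] => s /fg ->. Qed.

Lemma apxcD f g : apxc f -> apxc g -> apxc (fun s => f s + g s).
Proof.
move=> [f1 f2] [g1 g2]; split.
  by apply: apx_eq (apxD f1 g1) => s _; rewrite cReD.
by apply: apx_eq (apxD f2 g2) => s _; rewrite cImD.
Qed.

Lemma apxcM f g : apxc f -> apxc g -> apxc (fun s => f s * g s).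
Proof.
move=> [f1 f2] [g1 g2]; split.
  by apply: apx_eq (apxB (apxM f1 g1) (apxM f2 g2)) => s _; rewrite cReM.
by apply: apx_eq (apxD (apxM f1 g2) (apxM f2 g1)) => s _; rewrite cImM.
Qed.

Lemma apxcV f (d : R) : 0 < d -> (forall s : R, I s -> d <= cabs (f s)) ->
  apxc f -> apxc (fun s => (f s)^-1).
Proof.
move=> d0 fd [f1 f2].
have h : apx M (fun s => (cabs (f s) ^+ 2)^-1).
  apply: (@apxV _ _ _ (d ^+ 2)); rewrite ?exprn_gt0 //.
    by apply: apx_eq (apxD (apxX 2 f1) (apxX 2 f2)) => s _; rewrite sqr_cabs.
  by move=> s Is; rewrite lerXn2r ?nnegrE ?cabs_ge0 ?(ltW d0) // fd.
split; first by apply: apx_eq (apxM f1 h) => s _; rewrite cReV.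
by apply: apx_eq (apxN (apxM f2 h)) => s _; rewrite cImV.
Qed.

Lemma apxc_cst c : apxc (fun=> c). Proof. by split; exact: apx_cst. Qed.

Lemma apxcR (f : R -> R) : apx M f -> apxc (fun s => (f s)%:C%C).
Proof. by move=> hf; split => //=; exact: apx_cst. Qed.

Variable m : nat -> R.
Hypothesis m_ge0 : forall p : {poly R}, (forall s, I s -> 0 <= p.[s]) -> 0 <= mom m p.

Definition lamc f : R[i] :=
  (lam m M (fun s => Re (f s)) +i* lam m M (fun s => Im (f s)))%C.

Lemma lamc_eq f g : (forall s, I s -> f s = g s) -> lamc f = lamc g.
Proof. by move=> fg; congr (_ +i* _)%C; apply: (lam_eq m) => s /fg ->. Qed.

Lemma lamcD f g : apxc f -> apxc g -> lamc (fun s => f s + g s) = lamc f + lamc g.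
Proof.
move=> [f1 f2] [g1 g2]; rewrite /lamc; simpc; rewrite -!(lamD m_ge0) //.
by congr (_ +i* _)%C; apply: (lam_eq m) => s _; rewrite ?cReD ?cImD.
Qed.

Lemma lamcZ c f : apxc f -> lamc (fun s => c * f s) = c * lamc f.
Proof.
move=> [f1 f2]; case: c => a b; rewrite /lamc; simpc.
rewrite -mulNr -!(lamZ m_ge0) // -!(lamD m_ge0) //; try exact: apxZ.
by congr (_ +i* _)%C; apply: (lam_eq m) => s _; rewrite ?cReM ?cImM /= ?mulNr.
Qed.

Lemma lamcB f g : apxc f -> apxc g -> lamc (fun s => f s - g s) = lamc f - lamc g.
Proof.
move=> hf hg; rewrite -[- lamc g]mulN1r -lamcZ // -lamcD //; last exact: apxcM (apxc_cst _) hg.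
by apply: lamc_eq => s _; rewrite mulN1r.
Qed.

Lemma lamcR (f : R -> R) : lamc (fun s => (f s)%:C%C) = (lam m M f)%:C%C.
Proof. by congr (_ +i* _)%C; rewrite (lam_cst m_ge0) mul0r. Qed.

(** The factor 2 comes from bounding real and imaginary parts separately; it is harmless in all
    uses. *)
Lemma lamc_norm f K : apxc f -> (forall s : R, I s -> cabs (f s) <= K) ->
  cabs (lamc f) <= 2 * K * mom m 1.
Proof.
move=> [f1 f2] fK; apply: le_trans (cabs_le _) _; rewrite /=.
have h1 : `|lam m M (fun s => Re (f s))| <= K * mom m 1.
  by apply: (lam_norm m_ge0) f1 _ => s Is; rewrite (le_trans (Re_le_cabs _)) ?fK.
have h2 : `|lam m M (fun s => Im (f s))| <= K * mom m 1.
  by apply: (lam_norm m_ge0) f2 _ => s Is; rewrite (le_trans (Im_le_cabs _)) ?fK.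
lra.
Qed.

End complex_functional.

(** * Complex differentiability by real estimates *)

Definition cderiv (R : realType) (f : R[i] -> R[i]) z l :=
  forall e : R, 0 < e -> exists2 d : R, 0 < d & forall h : R[i], h != 0 -> cabs h < d ->
    cabs (f (z + h) - f z - l * h) <= e * cabs h.

(** Balls of [R[i]] have radii in [R[i]]; a positive complex number is real, so its real part serves
    as radius. *)
Lemma near_cabs (R : realType) (A : R[i] -> Prop) (z : R[i]^o) :
  (\forall w \near z, A w) <-> exists2 d : R, 0 < d & forall h, cabs h < d -> A (z + h).
Proof.
split=> [/nbhs_ballP[d /= d0 zA]|[d d0 zA]].
  have dE : d = (complex.Re d)%:C%C by case: d d0 {zA} => a b; rewrite ltcE /= => /andP[/eqP -> _].
  exists (complex.Re d) => [|h hd]; first by rewrite -ltcR -dE.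
  by apply: zA; rewrite /ball /= opprD addNKr normrN normCE dE ltcR.
apply/nbhs_ballP; exists d%:C%C => [|w]; first by rewrite /= ltcR.
rewrite /ball /= distrC normCE ltcR => /zA.
by rewrite addrC subrK.
Qed.

Lemma cderiv_is_derive (R : realType) (f : R[i] -> R[i]) z l :
  cderiv f z l <-> is_derive (z : R[i]^o) 1 (f : R[i]^o -> R[i]^o) l.
Proof.
have quot k (e : R) : k != 0 -> (`|l - k^-1 *: (f (k *: (1 : R[i]^o) + z) - f z)| <= e%:C%C) =
    (cabs (f (z + k) - f z - l * k) <= e * cabs k).
  move=> k0; rewrite [k *: (1 : R[i]^o)]mulr1 [k + z]addrC -(ler_pM2r (_ : 0 < `|k|)) ?normr_gt0 //.
  rewrite -normrM !normCE -rmorphM lecR /=; congr (_ <= _).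
  rewrite -cabsN; congr cabs.
  by rewrite [_ *: _]/(_ * _) mulrBl mulrAC mulVf // mul1r opprB; ring.
suff key : cderiv f z l <->
    (fun h : R[i]^o => h^-1 *: (f (h *: (1 : R[i]^o) + z) - f z : R[i]^o)) @ (0 : R[i]^o)^' --> (l : R[i]^o).
  split=> [/key fl|[df dl]]; last by apply/key; rewrite -dl; exact: df.
  by split; [apply/cvg_ex; exists l|exact: cvg_lim fl].
split=> [fl|/cvgr_dist_le fl e e0].
  apply/cvgrPdist_le => e e0.
  have eE : e = (complex.Re e)%:C%C by case: e e0 => a b; rewrite ltcE /= => /andP[/eqP -> _].
  have e0' : 0 < complex.Re e by rewrite -ltcR -eE.
  rewrite near_withinE; apply/near_cabs; have [d d0 h] := fl _ e0'.
  by exists d => // k kd; rewrite add0r => k0; rewrite eE quot //; exact: h.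
have eC : (0 : R[i]) < e%:C%C by rewrite ltcR.
have := fl _ eC; rewrite near_withinE => /near_cabs[d d0 h].
by exists d => // k k0 kd; rewrite -quot //; have := h k kd; rewrite add0r; exact.
Qed.

Lemma cderivP (R : realType) (f : R[i] -> R[i]) z :
  derivable (f : R[i]^o -> R[i]^o) z 1 <-> exists l, cderiv f z l.
Proof.
split=> [df|[l /cderiv_is_derive []//]].
by eexists; apply/cderiv_is_derive/derivableP.
Qed.

Lemma cderiv_quadratic (R : realType) (f : R[i] -> R[i]) z l (C d : R) : 0 < d ->
  (forall h, h != 0 -> cabs h < d -> cabs (f (z + h) - f z - l * h) <= C * cabs h ^+ 2) ->
  cderiv f z l.
Proof.
move=> d0 fC e e0.
have C0 : 0 < `|C| + 1 by rewrite ltr_wpDl.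
exists (Num.min d (e / (`|C| + 1))); first by rewrite lt_min d0 divr_gt0.
move=> h h0; rewrite lt_min => /andP[hd he]; apply: le_trans (fC h h0 hd) _.
rewrite expr2 mulrA ler_wpM2r ?cabs_ge0 //.
move: he; rewrite ltr_pdivlMr // => /ltW; apply: le_trans.
rewrite mulrC ler_wpM2l ?cabs_ge0 //; have := ler_norm C; lra.
Qed.

(** * The kernel t / (1 - t s) *)

Section kernel.
Variables (R : realType) (m : nat -> R) (M : R).
Hypothesis M0 : 0 < M.
Local Notation I s := (- M <= s <= M).
Hypothesis m_ge0 : forall p : {poly R}, (forall s, I s -> 0 <= p.[s]) -> 0 <= mom m p.
Implicit Types (t z h : R[i]).
Local Notation Re := (@complex.Re R).
Local Notation Im := (@complex.Im R).

(* [s |-> t / (1 - t * s)] is the generating function [\sum_n t ^+ n.+1 * s ^+ n]. *)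
Definition ker t (s : R) : R[i] := t / (1 - t * s%:C%C).

(** The constant d is explicit because approximability of the inverse and the remainder of the
    derivative both need a bound uniform in s. *)
Definition sep t (d : R) := 0 < d /\ forall s : R, I s -> d <= cabs (1 - t * s%:C%C).

Lemma I_norm (s : R) : I s -> `|s| <= M. Proof. by rewrite ler_norml. Qed.

(** Multiplied by the conjugate of t, [1 - t s] becomes [conj t - |t|^2 s], whose imaginary part is
    [- Im t] for every real s. *)
Lemma sep_nonreal t : Im t != 0 -> exists d, sep t d.
Proof.
move=> t0; have tp : 0 < cabs t.
  by rewrite cabs_gt0; apply: contra_neq t0 => ->.
exists (`|Im t| / cabs t); split; first by rewrite divr_gt0 // normr_gt0.
move=> s _; rewrite ler_pdivrMr // mulrC.
have -> : cabs t * cabs (1 - t * s%:C%C) = cabs (t^*%C - (cabs t ^+ 2 * s)%:C%C).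
  have -> : cabs t = cabs t^*%C by rewrite /cabs; case: (t) => a b /=; rewrite sqrrN.
  rewrite -cabsM; congr cabs; rewrite mulrBr mulr1 mulrA; congr (_ - _).
  rewrite rmorphM /=; congr (_ * _).
  have -> : cabs t^*%C = cabs t by rewrite /cabs; case: (t) => a b /=; rewrite sqrrN.
  rewrite sqr_cabs; case: (t) => a b /=; simpc; congr (_ +i* _)%C; ring.
apply: le_trans (Im_le_cabs _); rewrite -[leLHS]normrN.
by case: (t) => a b /=; simpc.
Qed.

Lemma sep_small t : cabs t * M < 1 -> sep t (1 - cabs t * M).
Proof.
move=> tM; split; first by rewrite subr_gt0.
move=> s /I_norm sM; have := cabs_lerB 1 (t * s%:C%C); rewrite cabs1 cabsM cabsR.
have := ler_wpM2l (cabs_ge0 t) sM; lra.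
Qed.

Lemma sep_near t h d : sep t d -> cabs h * M <= d / 2 -> sep (t + h) (d / 2).
Proof.
move=> [d0 td] hd; split; first by rewrite divr_gt0.
move=> s Is; rewrite mulrDl opprD addrA.
have := cabs_lerB (1 - t * s%:C%C) (h * s%:C%C); rewrite cabsM cabsR.
have := ler_wpM2l (cabs_ge0 h) (I_norm Is); have := td s Is; lra.
Qed.

Lemma apxc_den t : apxc M (fun s => 1 - t * s%:C%C).
Proof.
apply: apxc_eq (apxcD (apxc_cst M 1) (apxcM (apxc_cst M (- t)) (apxcR (apx_id M)))) => s _.
by rewrite mulNr.
Qed.

Lemma apxc_Vden t d : sep t d -> apxc M (fun s => (1 - t * s%:C%C)^-1).
Proof. by move=> [d0 td]; exact: apxcV d0 td (apxc_den t). Qed.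

Lemma apxc_ker t d : sep t d -> apxc M (ker t).
Proof. by move=> /apxc_Vden h; exact: apxcM (apxc_cst M t) h. Qed.

Lemma sep_neq0 t d s : sep t d -> I s -> 1 - t * s%:C%C != 0.
Proof. by move=> [d0 td] /td h; rewrite -cabs_gt0 (lt_le_trans d0). Qed.

(** Differentiation under the functional: the pointwise remainder is
    [h^2 s / ((1 - t s)^2 (1 - (t + h) s))]. The radius [d / (2 M)] keeps the second denominator at
    least d / 2, so the remainder is [O(h^2)] uniformly in s. *)
Lemma lamc_ker_cderiv t d : sep t d ->
  cderiv (fun t => lamc M m (ker t)) t (lamc M m (fun s => (1 - t * s%:C%C)^-1 * (1 - t * s%:C%C)^-1)).
Proof.
move=> st; have [d0 td] := st.
pose g (s : R) : R[i] := (1 - t * s%:C%C)^-1 * (1 - t * s%:C%C)^-1; rewrite -/g.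
have ag : apxc M g by exact: apxcM (apxc_Vden st) (apxc_Vden st).
have d2 : 0 < d / (2 * M) by rewrite divr_gt0 // mulr_gt0.
apply: (@cderiv_quadratic _ _ _ _ (2 * (M / (d ^+ 2 * (d / 2))) * mom m 1) (d / (2 * M))) => // h h0 hd.
have hM : cabs h * M <= d / 2.
  by move: hd; rewrite ltr_pdivlMr ?mulr_gt0 // => hd; lra.
have sth := sep_near st hM.
have akh := apxc_ker sth; have ak := apxc_ker st.
rewrite [_ * h]mulrC -(lamcZ m_ge0 _ ag) -(lamcB m_ge0 akh ak) -(lamcB m_ge0 _ (apxcM (apxc_cst M h) ag)); last first.
  apply: apxc_eq (apxcD akh (apxcM (apxc_cst M (-1)) ak)) => s _; by rewrite mulN1r.
have -> : 2 * (M / (d ^+ 2 * (d / 2))) * mom m 1 * cabs h ^+ 2 =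
  2 * (cabs h ^+ 2 * (M / (d ^+ 2 * (d / 2)))) * mom m 1 by ring.
apply: (lamc_norm m_ge0).
  apply: apxc_eq (apxcD (apxcD akh (apxcM (apxc_cst M (-1)) ak)) (apxcM (apxc_cst M (-1)) (apxcM (apxc_cst M h) ag))) => s _.
  by rewrite !mulN1r.
move=> s Is; have n1 := sep_neq0 st Is; have n2 := sep_neq0 sth Is.
have -> : ker (t + h) s - ker t s - h * g s =
    h ^+ 2 * (s%:C%C / ((1 - t * s%:C%C) ^+ 2 * (1 - (t + h) * s%:C%C))).
  by rewrite /ker /g; field; rewrite n1 n2.
rewrite !(cabsM, cabsX, cabsV) cabsR ler_wpM2l ?exprn_ge0 ?cabs_ge0 //.
apply: ler_pM; rewrite ?normr_ge0 ?invr_ge0 ?mulr_ge0 ?exprn_ge0 ?cabs_ge0 ?I_norm //.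
have p1 := lt_le_trans d0 (td s Is); have p2 := lt_le_trans sth.1 (sth.2 s Is).
rewrite lef_pV2 ?posrE ?mulr_gt0 ?exprn_gt0 // ?divr_gt0 //.
apply: ler_pM; rewrite ?exprn_ge0 ?(ltW d0) ?divr_ge0 ?(ltW d0) //; last exact: sth.2.
by rewrite lerXn2r ?nnegrE ?(ltW d0) ?(ltW p1) ?td.
Qed.

Lemma Im_ker t s : 1 - t * s%:C%C != 0 ->
  Im (ker t s) = Im t / cabs (1 - t * s%:C%C) ^+ 2.
Proof.
move=> _; rewrite /ker cImM cReV cImV; move: (_ ^-1) => N; case: t => a b /=.
by rewrite !(mul0r, mulr0, addr0, subr0, add0r, oppr0); ring.
Qed.

(** Strictness needs a uniform lower bound: [Im (ker t s) >= Im t / K^2] on the whole segment, and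
    the total mass [mom m 1] is positive. *)
Lemma Im_lamc_ker t : 0 < mom m 1 -> 0 < Im t -> 0 < Im (lamc M m (ker t)).
Proof.
move=> m1 t0; have [d st] := sep_nonreal (lt0r_neq0 t0).
pose K := 1 + cabs t * M.
have K0 : 0 < K by rewrite ltr_pwDl // mulr_ge0 ?cabs_ge0 // ltW.
apply: (@lt_le_trans _ _ (Im t / K ^+ 2 * mom m 1)).
  by rewrite mulr_gt0 // divr_gt0 // exprn_gt0.
rewrite -(lam_cst m_ge0) /=; have [_ h2] := apxc_ker st.
apply: (lam_mono m_ge0) (apx_cst _ _) h2 _ => s Is; rewrite Im_ker; last exact: sep_neq0 st Is.
have p1 := lt_le_trans st.1 (st.2 s Is).
rewrite ler_pM2l // lef_pV2 ?posrE ?exprn_gt0 //.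
rewrite lerXn2r ?nnegrE ?(ltW K0) ?(ltW p1) //.
apply: le_trans (cabsB _ _) _; rewrite cabs1 lerD2l cabsM cabsR ler_wpM2l ?cabs_ge0 //.
exact: I_norm.
Qed.

Definition kr (t s : R) : R := t / (1 - t * s).

Lemma kerR (t s : R) : ker t%:C%C s = (kr t s)%:C%C.
Proof. by rewrite /ker /kr !(rmorphM, rmorphB, fmorphV, rmorph1). Qed.

Lemma apx_kr (sg : R -> R) (M' t : R) : apx M sg ->
  (forall s : R, I s -> - M' <= sg s <= M') -> `|t| * M' <= 1 / 2 ->
  apx M (fun s => kr t (sg s)).
Proof.
move=> hs sM tM; apply: apxZ; apply: (@apxV _ _ _ (1 / 2)) => //.
  by apply: apxB (apx_cst _ _) (apxZ _ hs).
move=> s Is; have sM' : `|sg s| <= M' by rewrite ler_norml sM.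
have := ler_wpM2l (normr_ge0 t) sM'; rewrite -normrM.
have := ler_norm (t * sg s); lra.
Qed.

(** A finite geometric sum whose remainder [w t^(N+1) sg^N / (1 - t sg)] has denominator at least
    1/2. It is used with [sg = id], [w = 1] to recover phi, and with the change of variable to find
    the moments at another point. *)
Lemma lam_kr_taylor (sg w : R -> R) (M' K t : R) N : apx M sg -> apx M w ->
  (forall s : R, I s -> - M' <= sg s <= M') -> (forall s : R, I s -> `|w s| <= K) ->
  `|t| * M' <= 1 / 2 ->
  `|lam m M (fun s => w s * kr t (sg s)) -
    \sum_(n < N) lam m M (fun s => w s * sg s ^+ n) * t ^+ n.+1| <=
   2 * K * `|t| ^+ N.+1 * M' ^+ N * mom m 1.
Proof.
move=> hs hw sM wK tM.
have ak := apx_kr hs sM tM.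
have aF i : apx M (fun s => t ^+ i.+1 * (w s * sg s ^+ i)) by apply/apxZ/apxM/apxX.
have -> : \sum_(n < N) lam m M (fun s => w s * sg s ^+ n) * t ^+ n.+1 =
    lam m M (fun s => \sum_(n < N) t ^+ n.+1 * (w s * sg s ^+ n)).
  rewrite (lam_sum m_ge0 _ aF); apply: eq_bigr => i _.
  by rewrite mulrC -(lamZ m_ge0) //; apply/apxM/apxX.
have aS : apx M (fun s => \sum_(n < N) t ^+ n.+1 * (w s * sg s ^+ n)).
  elim: N => [|k IHk]; first by apply: apx_eq (apx_cst M 0) => s _; rewrite big_ord0.
  by apply: apx_eq (apxD IHk (aF k)) => s _; rewrite big_ord_recr.
rewrite -mulN1r -(lamZ m_ge0) // -(lamD m_ge0) //; [|exact: apxM|exact: apxZ].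
apply: (lam_norm m_ge0) => [|s Is]; first by apply: apxD; [exact: apxM|exact: apxZ].
have sM' : `|sg s| <= M' by rewrite ler_norml sM.
have den : 1 / 2 <= 1 - t * sg s.
  have := ler_wpM2l (normr_ge0 t) sM'; rewrite -normrM.
  have := ler_norm (t * sg s); lra.
have den0 : 0 < 1 - t * sg s by apply: lt_le_trans den.
have -> : w s * kr t (sg s) + -1 * (\sum_(n < N) t ^+ n.+1 * (w s * sg s ^+ n)) =
    w s * (t ^+ N.+1 * sg s ^+ N * (1 - t * sg s)^-1).
  have -> : \sum_(n < N) t ^+ n.+1 * (w s * sg s ^+ n) = w s * t * \sum_(n < N) (t * sg s) ^+ n.
    rewrite mulr_sumr; apply: eq_bigr => i _; rewrite exprS exprMn; ring.
  have E := subrX1 (t * sg s) N.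
  have -> : \sum_(n < N) (t * sg s) ^+ n = (1 - (t * sg s) ^+ N) / (1 - t * sg s).
    by rewrite -[1 - _ ^+ N]opprB E; field; rewrite gt_eqF.
  rewrite /kr exprMn exprS; field; by rewrite gt_eqF.
rewrite !normrM !normrX normrV ?unitfE ?gt_eqF // (ger0_norm (ltW den0)).
have -> : 2 * K * `|t| ^+ N.+1 * M' ^+ N = K * (`|t| ^+ N.+1 * M' ^+ N * 2) by ring.
have hN : `|sg s| ^+ N <= M' ^+ N by rewrite lerXn2r ?nnegrE // (le_trans _ sM').
have hV : (1 - t * sg s)^-1 <= 2.
  by rewrite -[2]invrK lef_pV2 ?posrE // -div1r.
apply: ler_pM; rewrite ?wK ?mulr_ge0 ?exprn_ge0 ?invr_ge0 ?normr_ge0 ?(ltW den0) //.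
apply: ler_pM; rewrite ?mulr_ge0 ?exprn_ge0 ?invr_ge0 ?normr_ge0 ?(ltW den0) //.
by rewrite ler_wpM2l ?exprn_ge0.
Qed.

End kernel.

(** Stated over any field because it serves for real t, where it yields the moments at the new base
    point, and for complex t, where it compares the two extensions. *)
Lemma kernel_shift (F : fieldType) (d t s : F) : 1 - d * s != 0 ->
  1 - (d + t) * s != 0 ->
  (d + t) / (1 - (d + t) * s) = d / (1 - d * s) +
    (1 - d * s)^-1 * (1 - d * s)^-1 * (t / (1 - t * (s * (1 - d * s)^-1))).
Proof.
move=> h2 h3.
have E : 1 - t * (s * (1 - d * s)^-1) = (1 - (d + t) * s) / (1 - d * s).
  by field; exact: h2.
rewrite E; field; by rewrite h2 h3.
Qed.

(** * Construction of the holomorphic extension *)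

Section extension.
Variables (R : realType) (U : set R) (phi : R -> R).
Hypotheses (openU : open U) (sphi : smooth U phi).
Hypothesis incr : forall x y, U x -> U y -> x < y -> phi x < phi y.
Hypothesis dphi : forall x, U x -> 0 < derive1 phi x.
Hypothesis psdU : forall x, U x -> forall n, psd (hmom phi x) n.

Lemma odd_derive_ge0 y k : U y -> 0 <= derive1n (2 * k).+1 phi y.
Proof.
move=> Uy; have : 0 <= hmom phi y (2 * k)%N.
  by rewrite -(momXn (hmom phi y)) mulnC exprM; apply: psdU (leqnn _).
by rewrite /hmom /tcoef pmulr_lge0 // invr_gt0 ltr0n fact_gt0.
Qed.

(* All odd derivatives of [phi] are nonnegative, so every term of the Taylor
   expansion of the odd part of [phi] at [y] and its remainder are. *)
Lemma bernstein y (T : R) j : 0 <= T -> (forall t : R, `|t| <= T -> U (y + t)) ->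
  tcoef phi y (2 * j).+1 * T ^+ (2 * j).+1 <= (phi (y + T) - phi (y - T)) / 2.
Proof.
move=> T0 UT.
have Uc (c : R) : `|c| = 1 -> forall r : R, 0 <= r <= T -> U (y + c * r).
  by move=> c1 r /andP[r0 rT]; apply: UT; rewrite normrM c1 mul1r ger0_norm.
pose n := (2 * j).+3.
pose G i t := 1 ^+ i * derive1n i phi (y + 1 * t) - (-1) ^+ i * derive1n i phi (y + (-1) * t).
have towG : tower n G T.
  by apply: tower_sub; apply: tower_affine sphi _; apply: Uc; rewrite ?normrN normr1.
have nE : n = (2 * j.+1).+1 by rewrite /n mulnS.
have sgn k : (-1) ^+ (2 * k).+1 = -1 :> R by rewrite exprS exprM sqrrN expr1n expr1n mulr1.
have Gn t : 0 <= t <= T -> 0 <= G n t.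
  move=> tT; rewrite /G nE sgn expr1n mul1r mulN1r opprK.
  by apply: addr_ge0; apply: odd_derive_ge0; apply: Uc tT; rewrite ?normrN normr1.
have := tower_taylor_le towG Gn (t := T); rewrite T0 lexx => /(_ isT).
rewrite {2}/G /= !mul1r mulN1r => h.
rewrite ler_pdivlMr //; apply: le_trans h.
have U0 : U y by rewrite -[y]addr0; apply: UT; rewrite normr0.
have term i : 0 <= G i 0 / i`!%:R * T ^+ i.
  apply: mulr_ge0; last by rewrite exprn_ge0.
  apply: divr_ge0 => //; rewrite /G expr1n mul1r !mulr0 addr0.
  have -> : i = (odd i + 2 * i./2)%N by rewrite mul2n odd_double_half.
  case: (odd i); rewrite ?add1n ?add0n; last first.
    by rewrite exprM sqrrN expr1n expr1n mul1r subrr.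
  by rewrite sgn mulN1r opprK; apply: addr_ge0; apply: odd_derive_ge0.
have jn : ((2 * j).+1 < n)%N by rewrite /n.
rewrite horner_poly (bigD1 (Ordinal jn)) //= -[leLHS]addr0 lerD ?sumr_ge0 //.
rewrite /G expr1n mul1r !mulr0 addr0 sgn mulN1r opprK /tcoef.
by rewrite le_eqVlt; apply/orP; left; apply/eqP; ring.
Qed.

(** Base points range within rho of x and Bernstein's estimate is applied with [T = 2 rho], so
    [3 rho] must stay inside U. *)
Definition good (x rho : R) := 0 < rho /\ forall t : R, `|t| <= 3 * rho -> U (x + t).

Lemma good_exists x : U x -> exists rho, good x rho.
Proof.
move=> Ux; have [d d0 dU] := open_dist openU Ux.
exists (d / 4); split; first by rewrite divr_gt0.
by move=> t td; apply: dU; apply: le_lt_trans td _; lra.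
Qed.

(** The inverse of the [T = 2 rho] of Bernstein's estimate. For [|t| < rho] it gives
    [|t| * rad rho < 1 / 2], which drives the geometric convergence. *)
Definition rad (rho : R) : R := (2 * rho)^-1.

Lemma rad_gt0 rho : 0 < rho -> 0 < rad rho.
Proof. by move=> r0; rewrite invr_gt0 mulr_gt0. Qed.

Lemma homo_phi x y : U x -> U y -> x <= y -> phi x <= phi y.
Proof. by move=> Ux Uy; rewrite le_eqVlt => /orP[/eqP -> //|xy]; apply/ltW/incr. Qed.

(** Since phi increases, its increment over the largest segment bounds those around every y near x,
    which makes [C] independent of y. [phi_lam] needs this for the Taylor remainder, taken at
    intermediate points. *)
Lemma growth x rho : good x rho -> exists2 C : R, 0 <= C &
  forall y, `|y - x| <= rho -> forall n, hmom phi y (2 * n)%N <= C * rad rho ^+ (2 * n).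
Proof.
move=> [r0 gU]; pose B := (phi (x + 3 * rho) - phi (x - 3 * rho)) / 2.
have T0 : 0 < 2 * rho by rewrite mulr_gt0.
have Ur : U (x + 3 * rho) by apply: gU; rewrite ger0_norm // mulr_ge0 // ltW.
have Ul : U (x - 3 * rho) by apply: gU; rewrite normrN ger0_norm // mulr_ge0 // ltW.
have Uin t : `|t - x| <= 3 * rho -> U t.
  by move=> h; rewrite -[t](subrK x) addrC; apply: gU.
exists (B / (2 * rho)).
  rewrite divr_ge0 ?(ltW T0) // divr_ge0 // subr_ge0.
  by apply: homo_phi => //; lra.
move=> y yx n; have := @bernstein y (2 * rho) n (ltW T0).
have UT (t : R) : `|t| <= 2 * rho -> U (y + t).
  move=> tr; apply: Uin; move: yx tr; rewrite !ler_norml; lra.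
move=> /(_ UT) h; rewrite /hmom.
have hB : (phi (y + 2 * rho) - phi (y - 2 * rho)) / 2 <= B.
  rewrite /B ler_pM2r ?invr_gt0 //; apply: lerB; apply: homo_phi => //.
  - by apply: UT; rewrite ger0_norm ?(ltW T0).
  - by move: yx; rewrite ler_norml; lra.
  - by apply: UT; rewrite normrN ger0_norm ?(ltW T0).
  - by move: yx; rewrite ler_norml; lra.
have := le_trans h hB; rewrite -ler_pdivlMr ?exprn_gt0 // => /le_trans; apply.
by rewrite /rad exprS invfM exprVn mulrA.
Qed.

Lemma hmom_ge0 x rho : good x rho -> forall p : {poly R},
  (forall s : R, - rad rho <= s <= rad rho -> 0 <= p.[s]) -> 0 <= mom (hmom phi x) p.
Proof.
move=> g p; have [C C0 h] := growth g.
have Ux : U x by rewrite -[x]addr0; apply: g.2; rewrite normr0 mulr_ge0 // ltW // g.1.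
apply: (@mom_ge0 R (hmom phi x) (rad rho) C (rad_gt0 g.1) (psdU Ux)).
by apply: h; rewrite subrr normr0 ltW // g.1.
Qed.

Lemma taylor_hmom x n t : (taylor n.+1 (fun j => derive1n j phi x)).[t] =
  phi x + \sum_(i < n) hmom phi x i * t ^+ i.+1.
Proof.
rewrite horner_poly big_ord_recl /= expr0 mulr1 fact0 divr1; congr (_ + _).
Qed.

(** Both sides are compared with the same Taylor polynomial: each differs from it by at most a
    constant times [(1/2)^n]. *)
Lemma phi_lam x rho t : good x rho -> `|t| < rho ->
  phi (x + t) = phi x + lam (hmom phi x) (rad rho) (kr t).
Proof.
move=> g tr; have [r0 gU] := g.
have [C C0 h] := growth g; have M0 := rad_gt0 r0.
have m_ge0 := hmom_ge0 g.
apply/eqP; rewrite -subr_eq0 -normr_le0.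
pose D := rho * C + 2 * rho * mom (hmom phi x) 1.
have L1 : 0 <= mom (hmom phi x) 1 := L1_ge0 m_ge0.
have D0 : 0 <= D by rewrite addr_ge0 // mulr_ge0 // ?mulr_ge0 // ltW.
apply: (@small_le0 _ _ D 1) => // e e0 _.
have [n ne] : exists n, (1 / 2 : R) ^+ n <= e.
  by apply: expr_small e0; lra.
have tM : `|t| * rad rho <= 1 / 2.
  by rewrite ler_pdivrMr ?mulr_gt0 //; lra.
have h1 : `|phi (x + t) - (taylor n.+1 (fun j => derive1n j phi x)).[t]| <= rho * C * (1 / 2) ^+ n.
  have K : forall r : R, `|r| < rho -> `|derive1n n.+1 phi (x + r)| <= C * rad rho ^+ n * n.+1`!%:R.
    move=> r rr; rewrite -ler_pdivrMr ?ltr0n ?fact_gt0 //.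
    rewrite -[n.+1`!%:R in leLHS]ger0_norm // -normf_div.
    apply: (@mom_bound R (hmom phi (x + r)) (rad rho) C M0).
      apply: psdU; apply: gU; apply: ltW; apply: lt_le_trans rr _; lra.
    by apply: h; rewrite [x + r]addrC addrK ltW.
  have := taylor_norm sphi (K := C * rad rho ^+ n * n.+1`!%:R) (d := rho) (x := x) (n := n.+1) (t := t).
  move=> /(_ _ K tr) h2; apply: le_trans (h2 _) _.
    by move=> r rr; apply: gU; apply: ltW; apply: lt_le_trans rr _; lra.
  rewrite mulfK ?pnatr_eq0 -?lt0n ?fact_gt0 // exprS.
  have -> : C * rad rho ^+ n * (`|t| * `|t| ^+ n) = `|t| * C * (`|t| * rad rho) ^+ n.
    by rewrite exprMn; ring.
  apply: ler_pM; rewrite ?mulr_ge0 ?exprn_ge0 ?mulr_ge0 ?(ltW M0) //.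
    by rewrite ler_wpM2r // ltW.
  by rewrite lerXn2r ?nnegrE ?mulr_ge0 ?(ltW M0).
have h2 := @lam_kr_taylor R (hmom phi x) (rad rho) m_ge0 id (fun=> 1) (rad rho) 1 t n
  (apx_id _) (apx_cst _ 1) (fun s h => h) _ tM.
have {}h2 := h2 (fun s _ => eq_ind_r (fun z => z <= 1) (lexx 1) (normr1 R)).
have sE : \sum_(i < n) lam (hmom phi x) (rad rho) (fun s => 1 * id s ^+ i) * t ^+ i.+1 =
    \sum_(i < n) hmom phi x i * t ^+ i.+1.
  apply: eq_bigr => i _; congr (_ * _); rewrite -(momXn (hmom phi x)) -(lam_poly m_ge0).
  by apply: lam_eq => s _; rewrite mul1r hornerXn.
have lE : lam (hmom phi x) (rad rho) (fun s => 1 * kr t (id s)) = lam (hmom phi x) (rad rho) (kr t).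
  by apply: lam_eq => s _; rewrite mul1r.
rewrite sE lE in h2.
have h3 : 2 * 1 * `|t| ^+ n.+1 * rad rho ^+ n * mom (hmom phi x) 1 <= 2 * rho * mom (hmom phi x) 1 * (1 / 2) ^+ n.
  have -> : 2 * 1 * `|t| ^+ n.+1 * rad rho ^+ n * mom (hmom phi x) 1 =
     2 * `|t| * mom (hmom phi x) 1 * (`|t| * rad rho) ^+ n by rewrite exprMn exprS; ring.
  apply: ler_pM; rewrite ?mulr_ge0 ?exprn_ge0 ?mulr_ge0 ?(ltW M0) //.
    by rewrite ler_wpM2r // ler_wpM2l // ltW.
  by rewrite lerXn2r ?nnegrE ?mulr_ge0 ?(ltW M0).
have := taylor_hmom x n t => tE; rewrite tE in h1.
have {}h2 := le_trans h2 h3.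
have E : phi (x + t) - (phi x + lam (hmom phi x) (rad rho) (kr t)) =
   (phi (x + t) - (phi x + \sum_(i < n) hmom phi x i * t ^+ i.+1)) -
   (lam (hmom phi x) (rad rho) (kr t) - \sum_(i < n) hmom phi x i * t ^+ i.+1) by ring.
rewrite E; apply: le_trans (ler_normB _ _) _; apply: le_trans (lerD h1 h2) _.
by rewrite -mulrDl ler_wpM2l.
Qed.

(* The holomorphic extension of [phi], expanded at the base point [x]. *)
Definition pick x rho (z : R[i]) : R[i] :=
  (phi x)%:C%C + lamc (rad rho) (hmom phi x) (ker (z - x%:C%C)).

Lemma pickR x rho t : good x rho -> `|t| < rho ->
  pick x rho (x + t)%:C%C = (phi (x + t))%:C%C.
Proof.
move=> g tr; rewrite /pick -rmorphB /= [x + t]addrC addrK.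
have m_ge0 := hmom_ge0 g.
rewrite (lamc_eq _ (g := fun s => (kr t s)%:C%C)); last by move=> s _; exact: kerR.
by rewrite (lamcR m_ge0) -rmorphD /= -phi_lam // addrC.
Qed.

Lemma pick_deriv x rho z : good x rho ->
  complex.Im z != 0 \/ cabs (z - x%:C%C) < rho -> exists l, cderiv (pick x rho) z l.
Proof.
move=> g zx; have [r0 _] := g; have M0 := rad_gt0 r0.
have [d st] : exists d, sep (rad rho) (z - x%:C%C) d.
  case: zx => [z0|zr].
    apply: sep_nonreal; rewrite cImD (_ : complex.Im (- _) = 0) ?addr0 //.
    by rewrite /= oppr0.
  exists (1 - cabs (z - x%:C%C) * rad rho); apply: sep_small.
  by rewrite ltr_pdivrMr ?mulr_gt0 //; lra.
have := lamc_ker_cderiv M0 (hmom_ge0 g) st.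
set l := lamc _ _ _ => h; exists l => e /h[d' d'0 hd]; exists d' => // k k0 kd.
have := hd k k0 kd; rewrite /pick.
suff -> : (phi x)%:C%C + lamc (rad rho) (hmom phi x) (ker (z + k - x%:C%C)) -
   ((phi x)%:C%C + lamc (rad rho) (hmom phi x) (ker (z - x%:C%C))) =
   lamc (rad rho) (hmom phi x) (ker (z - x%:C%C + k)) - lamc (rad rho) (hmom phi x) (ker (z - x%:C%C)) by [].
by rewrite opprD addrACA subrr add0r addrAC.
Qed.

Lemma Im_pick x rho z : good x rho -> 0 < complex.Im z -> 0 < complex.Im (pick x rho z).
Proof.
move=> g z0; rewrite /pick cImD add0r.
apply: (Im_lamc_ker (rad_gt0 g.1) (hmom_ge0 g)).
  rewrite -(expr0 'X) momXn /hmom /tcoef divr1 derive1n1 dphi //.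
  by rewrite -[x]addr0; apply: g.2; rewrite normr0 mulr_ge0 // ltW // g.1.
by rewrite cImD (_ : complex.Im (- _) = 0) ?addr0 //= oppr0.
Qed.

(* Moving the base point by [d] amounts to pushing the functional forward by
   [s |-> s / (1 - d * s)] with weight [(1 - d * s) ^- 2]. *)
Lemma pick_near x y rx ry (z : R[i]) : good x rx -> good y ry -> `|y - x| <= rx / 2 ->
  complex.Im z != 0 -> pick x rx z = pick y ry z.
Proof.
move=> gx gy yx z0; pose d := y - x; pose M := rad rx.
have yd : y = x + d by rewrite /d; ring.
rewrite -/d in yx; clearbody d.
have [r0 _] := gx; have M0 : 0 < M := rad_gt0 r0.
have mx := hmom_ge0 gx; have my := hmom_ge0 gy.
(* From [|d| <= rx / 2] and [M = 1 / (2 rx)]. It keeps [1 - d s] at least 3/4, hence its inverse at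
   most 2, [sg] within [2 M] and [w] at most 4. *)
have dM : `|d| * M <= 1 / 4.
  by rewrite /M ler_pdivrMr ?mulr_gt0 //; move: yx; lra.
have den (s : R) : - M <= s <= M -> 3 / 4 <= 1 - d * s.
  move=> /I_norm sM; have := ler_wpM2l (normr_ge0 d) sM; rewrite -normrM.
  have := ler_norm (d * s); lra.
have ad : apx M (fun s => (1 - d * s)^-1).
  by apply: (@apxV _ _ _ (3 / 4)) den => //; apply: apxB (apx_cst _ _) (apxZ _ (apx_id _)).
pose w s := (1 - d * s)^-1 * (1 - d * s)^-1; pose sg s := s * (1 - d * s)^-1.
have aw : apx M w := apxM ad ad.
have asg : apx M sg := apxM (apx_id _) ad.
have Vden (s : R) : - M <= s <= M -> 0 < (1 - d * s)^-1 <= 2.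
  move=> /den h; have h0 : 0 < 1 - d * s by apply: lt_le_trans h.
  rewrite invr_gt0 h0 /= -[2]invrK lef_pV2 ?posrE //; lra.
have sg2 (s : R) : - M <= s <= M -> - (2 * M) <= sg s <= 2 * M.
  move=> sM; rewrite -ler_norml normrM mulrC; have /andP[v0 v2] := Vden s sM.
  by rewrite (gtr0_norm v0); apply: ler_pM; rewrite ?I_norm ?(ltW v0).
have w4 (s : R) : - M <= s <= M -> `|w s| <= 4.
  move=> sM; have /andP[v0 v2] := Vden s sM.
  rewrite normrM gtr0_norm // (_ : 4 = 2 * 2 :> R); last by ring.
  by apply: ler_pM => //; exact: ltW.
have krD (t s : R) : `|t| * (2 * M) <= 1 / 2 -> - M <= s <= M -> kr (d + t) s = kr d s + w s * kr t (sg s).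
  move=> tM sM; have h1 := den s sM.
  have h2 : 1 - d * s != 0 by rewrite gt_eqF //; apply: lt_le_trans h1; lra.
  have h3 : 1 - (d + t) * s != 0.
    rewrite gt_eqF //; have := ler_wpM2l (normr_ge0 t) (I_norm sM); rewrite -normrM.
    have := ler_norm (t * s); lra.
  exact: kernel_shift.
have phiE (t : R) : `|t| < rx / 8 -> phi (y + t) = phi y + lam (hmom phi x) M (fun s => w s * kr t (sg s)).
  move=> tr.
  have tM : `|t| * (2 * M) <= 1 / 2.
    by rewrite mulrA ler_pdivrMr ?mulr_gt0 //; move: tr r0; lra.
  have dt : `|d + t| < rx.
    by apply: le_lt_trans (ler_normD _ _) _; move: yx tr; lra.
  have yt : y + t = x + (d + t) by rewrite yd; ring.
  have dr : `|d| < rx by apply: le_lt_trans yx _; lra.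
  rewrite yt (phi_lam gx dt) yd (phi_lam gx dr) -addrA; congr (_ + _).
  rewrite -(lamD mx).
  - by apply: lam_eq => s sM; rewrite krD.
  - apply: (@apx_kr _ M id M d (apx_id _)) => //; lra.
  - apply: apxM aw _; apply: (@apx_kr _ M sg (2 * M) t) => //.
(* The Taylor coefficients of phi at y are read off [phiE] by uniqueness. They identify the
   functional at y with the pushed one, as [lam_push] requires. *)
have m12 n : hmom phi y n = lam (hmom phi x) M (fun s => w s * sg s ^+ n).
  pose c n := lam (hmom phi x) M (fun s => w s * sg s ^+ n).
  pose P : {poly R} := (phi y)%:P + \sum_(i < n.+1) c i *: 'X^(i.+1).
  have Uy : U y by rewrite -[y]addr0; apply: gy.2; rewrite normr0 mulr_ge0 // ltW // gy.1.
  have hP : bigO n.+2 (fun t => phi (y + t) - P.[t]).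
    exists (2 * 4 * (2 * M) ^+ n.+1 * mom (hmom phi x) 1), (rx / 8).
    split; first by rewrite divr_gt0.
    move=> t t0 tr.
    have tM : `|t| * (2 * M) <= 1 / 2.
      by rewrite mulrA ler_pdivrMr ?mulr_gt0 //; move: tr r0; lra.
    have := @lam_kr_taylor R (hmom phi x) M mx sg w (2 * M) 4 t n.+1 asg aw sg2 w4 tM.
    rewrite phiE // /P hornerD hornerC horner_sum opprD addrACA subrr add0r.
    have -> : \sum_(i < n.+1) (c i *: 'X^(i.+1)).[t] = \sum_(i < n.+1) c i * t ^+ i.+1.
      by apply: eq_bigr => i _; rewrite hornerZ hornerXn.
    move=> /le_trans; apply.
    by rewrite le_eqVlt; apply/orP; left; apply/eqP; ring.
  rewrite /hmom /tcoef (taylor_unique openU sphi Uy hP (ltnSn _)) mulfK //.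
  rewrite coefD coefC add0r coef_sum big_ord_recr /= coefZ coefXn eqxx mulr1.
  rewrite big1 ?add0r // => i _; rewrite coefZ coefXn eqSS gtn_eqF ?mulr0 //.
(* The kernel must be approximable on a segment containing both the one for y and the image under
   [sg] of the one for x. *)
pose M' := Num.max (rad ry) (2 * M).
have sgM (s : R) : - M <= s <= M -> - M' <= sg s <= M'.
  move=> /sg2 /andP[h1 h2]; rewrite -ler_norml.
  by apply: (@le_trans _ _ (2 * M)); rewrite ?ler_norml ?h1 // /M' le_max lexx orbT.
have MM : rad ry <= M' by rewrite /M' le_max lexx.
pose tau := z - y%:C%C.
have tau0 : complex.Im tau != 0.
  by rewrite cImD (_ : complex.Im (- _) = 0) ?addr0 //= oppr0.
have M'0 : 0 < M' by apply: lt_le_trans MM; exact: rad_gt0 gy.1.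
have [e se] := sep_nonreal M' tau0.
have ak := apxc_ker se.
have push := lam_push MM my mx asg aw sgM m12.
have pushc : lamc (rad ry) (hmom phi y) (ker tau) = lamc M (hmom phi x) (fun s => (w s)%:C%C * ker tau (sg s)).
  rewrite /lamc (push _ ak.1) (push _ ak.2).
  by congr (_ +i* _)%C; apply: lam_eq => s _; rewrite ?cReM ?cImM /= mul0r ?subr0 ?addr0.
rewrite /pick -/tau -/M pushc.
have dr : `|d| < rx by apply: le_lt_trans yx _; lra.
have -> : z - x%:C%C = d%:C%C + tau by rewrite /tau yd rmorphD /=; ring.
have akd : apxc M (fun s => (kr d s)%:C%C).
  by apply: apxcR; apply: (@apx_kr _ M id M d (apx_id _)) => //; lra.
have ap : apxc M (fun s => (w s)%:C%C * ker tau (sg s)).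
  apply: apxcM; first exact: apxcR.
  by split; [exact: (apx_push asg sgM ak.1)|exact: (apx_push asg sgM ak.2)].
(* The identity behind [phiE], now with the nonreal increment [tau], which may be large: it is
   algebraic and requires only nonzero denominators. *)
have kerD (s : R) : - M <= s <= M -> ker (d%:C%C + tau) s = (kr d s)%:C%C + (w s)%:C%C * ker tau (sg s).
  move=> sM; have h1 := den s sM.
  have h2 : (1 - d * s)%:C%C != 0 by rewrite fmorph_eq0 gt_eqF //; apply: lt_le_trans h1; lra.
  have h3 : 1 - tau * (sg s)%:C%C != 0 by exact: sep_neq0 se (sgM s sM).
  have E : 1 - tau * (sg s)%:C%C = (1 - (d%:C%C + tau) * s%:C%C) / (1 - d%:C%C * s%:C%C).
    rewrite /sg !(rmorphM, rmorphB, fmorphV, rmorph1) /= in h2 *; field; exact: h2.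
  have h4 : 1 - (d%:C%C + tau) * s%:C%C != 0.
    by apply: contra_neq h3 => h; rewrite E h mul0r.
  rewrite /ker /kr /w /sg !(rmorphM, rmorphB, fmorphV, rmorph1) /= in h2 *.
  exact: kernel_shift.
rewrite (lamc_eq _ kerD) (lamcD mx akd ap) (lamcR mx) addrA -rmorphD /=.
by rewrite yd (phi_lam gx dr).
Qed.

End extension.

(** Connectedness: the sets where [g] equals [g x] and where it differs are both open in U. No
    topology on [T] is involved. *)
Lemma locally_constant (R : realType) (U : set R) (T : Type) (g : R -> T) :
  open U -> is_interval U ->
  (forall x, U x -> exists2 r : R, 0 < r & forall y, U y -> `|y - x| < r -> g y = g x) ->
  forall x y, U x -> U y -> g x = g y.
Proof.
move=> oU /connected_intervalP cU gl x y Ux Uy.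
have op (P : T -> Prop) : open [set t | U t /\ P (g t)].
  rewrite openE => t [Ut Pt]; have [r r0 gr] := gl t Ut.
  have [d d0 dU] := open_dist oU Ut.
  apply/nbhs_ballP; exists (Num.min r d) => /=; first by rewrite lt_min r0.
  move=> s; rewrite /ball /= distrC lt_min => /andP[sr sd].
  have Us : U s by rewrite -[s](subrK t) addrC; apply: dU.
  by split => //; rewrite (gr s).
have BU : [set t | U t /\ g t = g x] = U.
  apply: cU; first by exists x.
    exists [set t | U t /\ g t = g x]; first exact: (op (fun v => v = g x)).
    by apply/seteqP; split=> [t [Ut gt]|t []].
  exists (~` [set t | U t /\ g t <> g x]).
    by apply: open_closedC; exact: (op (fun v => v <> g x)).
  apply/seteqP; split=> [t [Ut gt]|t [Ut nt]]; first by split=> // -[].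
  by split=> //; apply: contrapT => gt; apply: nt.
have : [set t | U t /\ g t = g x] y by rewrite BU.
by case.
Qed.

Lemma cderiv_eq_near (R : realType) (f g : R[i] -> R[i]) z l (r : R) : 0 < r ->
  (forall h, cabs h < r -> f (z + h) = g (z + h)) -> cderiv f z l -> cderiv g z l.
Proof.
move=> r0 fg fl e e0; have [d d0 h] := fl e e0.
exists (Num.min d r) => [|k k0]; first by rewrite lt_min d0.
rewrite lt_min => /andP[kd kr].
have fz : g z = f z by have := fg 0; rewrite cabs0 addr0 => ->.
by rewrite fz -fg //; exact: h.
Qed.

(** Off the real axis one base point [x0] suffices. Differentiability at a real point x of U is seen
    from the expansion at x itself, which agrees with the one at [x0] by [pick_near] and
    connectedness. *)
Theorem psd_extension (R : realType) (U : set R) (phi : R -> R) x0 :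
  open U -> is_interval U -> U x0 -> smooth U phi ->
  (forall x y, U x -> U y -> x < y -> phi x < phi y) ->
  (forall x, U x -> 0 < derive1 phi x) ->
  (forall x, U x -> forall n, psd (hmom phi x) n) ->
  exists F : R[i] -> R[i],
    [/\ holomorphic_on (slit_plane U) F,
        (forall x : R, U x -> F (x%:C%C) = (phi x)%:C%C) &
        (forall z : R[i], 0 < complex.Im z -> 0 < complex.Im (F z))].
Proof.
move=> oU iU Ux0 sphi incr dphi psdU.
have /boolp.choice[rho rhoP] : forall x, exists r, U x -> good U x r.
  move=> x; have [Ux|nUx] := pselect (U x).
    by have [r gr] := good_exists oU Ux; exists r.
  by exists 0.
have same x y (z : R[i]) : complex.Im z != 0 -> U x -> U y ->
    pick phi x (rho x) z = pick phi y (rho y) z.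
  move=> z0; apply: (locally_constant (g := fun x => pick phi x (rho x) z) oU iU) => {}x Ux.
  have gx := rhoP x Ux; exists (rho x / 2) => [|{}y Uy yx]; first by rewrite divr_gt0 // gx.1.
  by rewrite (pick_near oU sphi incr psdU gx (rhoP y Uy) (ltW yx) z0).
(* Real points outside U do not belong to the slit plane, so the value there is arbitrary. *)
pose F (z : R[i]) := if complex.Im z == 0 then (phi (complex.Re z))%:C%C else pick phi x0 (rho x0) z.
exists F; split=> [z Uz|x Ux|z z0].
- apply/cderivP; have [z0|z0] := eqVneq (complex.Im z) 0; last first.
    have [l hl] := pick_deriv sphi incr psdU (rhoP x0 Ux0) (or_introl z0).
    exists l; apply: (cderiv_eq_near (r := `|complex.Im z|)) hl; first by rewrite normr_gt0.
    move=> h hz; rewrite /F ifF //; apply/negbTE; apply: contraTneq hz.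
    rewrite cImD -leNgt => /eqP; rewrite addr_eq0 => /eqP ->; rewrite normrN.
    exact: Im_le_cabs.
  have zE : z = (complex.Re z)%:C%C by case: (z) z0 => ? ? /= ->.
  have Ux : U (complex.Re z).
    by apply: contrapT => nU; apply: Uz; exists (complex.Re z).
  move: (complex.Re z) zE Ux => x -> Ux {z z0 Uz}.
  have gx := rhoP x Ux.
  have [|l hl] := pick_deriv sphi incr psdU gx (z := x%:C%C).
    by right; rewrite subrr cabs0 gx.1.
  exists l; apply: (cderiv_eq_near (r := rho x)) hl; first exact: gx.1.
  (* Around x the single function [pick] based at x covers both branches of [F]: real points by
     [pickR], nonreal ones by [same]. *)
  move=> h hr; rewrite /F; case: ifP => [/eqP h0|/negbT h0]; last exact: same.
  have hE : h = (complex.Re h)%:C%C.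
    by move: h0; rewrite cImD /= add0r; case: (h) => ? ? /= ->.
  rewrite hE -rmorphD /=; apply: (pickR sphi incr psdU gx).
  by apply: le_lt_trans hr; exact: Re_le_cabs.
- by rewrite /F /= eqxx.
- rewrite /F gt_eqF //; exact: (Im_pick sphi incr dphi psdU (rhoP x0 Ux0) z0).
Qed.

(** * Primitives and integrals on a segment *)

Section real_primitive.
Variable R : realType.
Implicit Types (P Q f g : R -> R) (a b : R).

Definition prim P f a b := forall t : R, a <= t <= b -> is_derive t 1 P (f t).

Lemma prim_exists f a b : a <= b ->
  (forall t : R, a <= t <= b -> {for t, continuous f}) -> exists P, prim P f a b.
Proof.
(* Clamping to [[a, b]] extends f to a continuous function on the line. Integrating it from [a - 1]
   makes a and b interior points, so the primitive has two-sided derivatives there too. *)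
move=> ab cf; pose cl (t : R) := Num.max a (Num.min b t).
have clI t : a <= cl t <= b.
  by rewrite /cl le_max lexx /= ge_max ab ge_min lexx.
have clE t : a <= t <= b -> cl t = t.
  by move=> /andP[a1 b1]; rewrite /cl (min_idPr b1) (max_idPr a1).
have cl1 s t : `|cl s - cl t| <= `|s - t|.
  rewrite /cl /Num.max /Num.min.
  by case: (ltP b s) => ?; case: (ltP b t) => ?;
    repeat (case: ifP => ?); rewrite ler_norml; apply/andP; split;
    move: (ler_norm (s - t)) (ler_norm (- (s - t))); rewrite normrN; lra.
have cg : continuous (f \o cl).
  move=> t; apply/cvgrPdist_lt => e e0.
  have [d d0 h] := continuous_dist (cf _ (clI t)) e0.
  apply/nbhs_ballP; exists d => //= s; rewrite /ball /= => st.
  rewrite distrC; have := h (cl s - cl t).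
  by rewrite [cl t + _]addrC subrK; apply; apply: le_lt_trans (cl1 _ _) _; rewrite distrC.
have a1b : a - 1 < b + 1 by lra.
have ig : (@lebesgue_measure R).-integrable `[a - 1, b + 1] (EFin \o (f \o cl)).
  apply: continuous_compact_integrable; first exact: segment_compact.
  exact: continuous_subspaceT.
exists (fun x => (\int[@lebesgue_measure R]_(t in `[(a - 1)%R, x]) (f \o cl) t)%R).
move=> t tab; have /andP[at_ tb] := tab.
have t1 : t < b + 1 by lra.
have at1 : a - 1 < t by lra.
have [h1 h2] := continuous_FTC1_closed t1 ig at1 (cg t).
by split=> //; rewrite -derive1E h2 /= clE.
Qed.

(* The choice of a primitive is irrelevant; [0] if there is none. *)
Definition int f a b :=
  let P := xget (fun=> 0) [set P | prim P f a b] in P b - P a.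

Lemma intE P f a b : a <= b -> prim P f a b -> int f a b = P b - P a.
Proof.
move=> ab pP; rewrite /int.
have : prim (xget (fun=> 0) [set P | prim P f a b]) f a b.
  exact: (xgetPex (fun=> 0) (ex_intro (fun P => prim P f a b) P pP)).
move: (xget _ _) => Q pQ.
have [|c _ E] := @mvt R (fun t => P t - Q t) (fun=> 0) a b ab.
  move=> t tab; apply: is_derive_eq (is_deriveB (pP t tab) (pQ t tab)) _; exact: subrr.
by move: E; rewrite mul0r => /eqP; rewrite subr_eq0 => /eqP; lra.
Qed.

Lemma int_bound P f a b K1 K2 : a <= b -> prim P f a b ->
  (forall t : R, a <= t <= b -> K1 <= f t <= K2) ->
  K1 * (b - a) <= int f a b <= K2 * (b - a).
Proof.
move=> ab pP fK; rewrite (intE ab pP).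
have [c cab ->] := mvt ab pP.
by have /andP[h1 h2] := fK c cab; rewrite !ler_wpM2r ?subr_ge0.
Qed.

End real_primitive.

(** * Complex-valued integrals along segments *)

Section complex_integral.
Variable R : realType.
Implicit Types (P Q f g : R -> R[i]) (a b : R).
Local Notation Re := (@complex.Re R).
Local Notation Im := (@complex.Im R).

Definition cprim P f a b :=
  prim (fun t => Re (P t)) (fun t => Re (f t)) a b /\
  prim (fun t => Im (P t)) (fun t => Im (f t)) a b.

Definition cint f a b : R[i] :=
  (int (fun t => Re (f t)) a b +i* int (fun t => Im (f t)) a b)%C.

Definition cintegrable f a b := exists P, cprim P f a b.

Lemma cintE P f a b : a <= b -> cprim P f a b -> cint f a b = P b - P a.
Proof.
move=> ab [p1 p2]; rewrite /cint (intE ab p1) (intE ab p2).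
by case: (P b) (P a) => [? ?] [? ?]; simpc.
Qed.

Lemma cprim_eq P f g a b : (forall t : R, a <= t <= b -> f t = g t) ->
  cprim P f a b -> cprim P g a b.
Proof. by move=> fg [h1 h2]; split=> t tab; rewrite -fg //; [exact: h1|exact: h2]. Qed.

Lemma cprim_sub P f a b a' b' : a <= a' -> b' <= b -> cprim P f a b -> cprim P f a' b'.
Proof.
move=> aa bb [h1 h2]; split=> t /andP[at_ tb]; [apply: h1|apply: h2];
  by rewrite (le_trans aa) // (le_trans tb).
Qed.

Lemma cprimD P Q f g a b : cprim P f a b -> cprim Q g a b ->
  cprim (fun t => P t + Q t) (fun t => f t + g t) a b.
Proof.
move=> [h1 h2] [h3 h4]; split=> t tab.
  under eq_fun do rewrite cReD; rewrite cReD.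
  exact: is_deriveD (h1 t tab) (h3 t tab).
under eq_fun do rewrite cImD; rewrite cImD.
exact: is_deriveD (h2 t tab) (h4 t tab).
Qed.

Lemma cprimZ c P f a b : cprim P f a b ->
  cprim (fun t => c * P t) (fun t => c * f t) a b.
Proof.
move=> [h1 h2]; split=> t tab.
  under eq_fun do rewrite cReM; rewrite cReM.
  exact: is_deriveB (is_deriveZ (Re c) (h1 t tab)) (is_deriveZ (Im c) (h2 t tab)).
under eq_fun do rewrite cImM; rewrite cImM.
exact: is_deriveD (is_deriveZ (Re c) (h2 t tab)) (is_deriveZ (Im c) (h1 t tab)).
Qed.

Lemma cint_eq f g a b : a <= b -> cintegrable f a b ->
  (forall t : R, a <= t <= b -> f t = g t) -> cint f a b = cint g a b.
Proof. by move=> ab [P hP] fg; rewrite (cintE ab hP) (cintE ab (cprim_eq fg hP)). Qed.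

Lemma cintD f g a b : a <= b -> cintegrable f a b -> cintegrable g a b ->
  cint (fun t => f t + g t) a b = cint f a b + cint g a b.
Proof.
move=> ab [P hP] [Q hQ].
by rewrite (cintE ab hP) (cintE ab hQ) (cintE ab (cprimD hP hQ)); ring.
Qed.

Lemma cintZ c f a b : a <= b -> cintegrable f a b ->
  cint (fun t => c * f t) a b = c * cint f a b.
Proof.
by move=> ab [P hP]; rewrite (cintE ab hP) (cintE ab (cprimZ c hP)) mulrBr.
Qed.

Lemma cint_split f a e b : a <= e -> e <= b -> cintegrable f a b ->
  cint f a b = cint f a e + cint f e b.
Proof.
move=> ae eb [P hP]; rewrite (cintE (le_trans ae eb) hP).
rewrite (cintE ae (cprim_sub (lexx _) eb hP)) (cintE eb (cprim_sub ae (lexx _) hP)).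
by ring.
Qed.

Lemma cint_norm f a b K : a <= b -> cintegrable f a b ->
  (forall t : R, a <= t <= b -> cabs (f t) <= K) -> cabs (cint f a b) <= 2 * K * (b - a).
Proof.
move=> ab [P [h1 h2]] fK; apply: le_trans (cabs_le _) _; rewrite /=.
have /(int_bound ab h1) : forall t : R, a <= t <= b -> - K <= Re (f t) <= K.
  by move=> t tab; rewrite -ler_norml (le_trans (Re_le_cabs _)) // fK.
have /(int_bound ab h2) : forall t : R, a <= t <= b -> - K <= Im (f t) <= K.
  by move=> t tab; rewrite -ler_norml (le_trans (Im_le_cabs _)) // fK.
rewrite !mulNr -!ler_norml; lra.
Qed.

Lemma Im_cint_ge f a b K : a <= b -> cintegrable f a b ->
  (forall t : R, a <= t <= b -> K <= Im (f t)) -> K * (b - a) <= Im (cint f a b).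
Proof.
move=> ab [P [h1 h2]] fK; rewrite /= (intE ab h2).
have [c cab ->] := mvt ab h2.
by rewrite ler_wpM2r ?subr_ge0 ?fK.
Qed.

Definition ccont (f : R[i] -> R[i]) z := forall e : R, 0 < e ->
  exists2 d : R, 0 < d & forall h : R[i], cabs h < d -> cabs (f (z + h) - f z) <= e.

Lemma ccontP (f : R[i] -> R[i]) z : ccont f z <->
  {for (z : R[i]^o), continuous (f : R[i]^o -> R[i]^o)}.
Proof.
have P := cvgrPdist_le (FF := nbhs_filter (z : R[i]^o)) (f : R[i]^o -> R[i]^o) (f z).
split=> [fz|/P fz e e0].
  apply/P => e e0.
  have eE : e = (complex.Re e)%:C%C by case: e e0 => a b; rewrite ltcE /= => /andP[/eqP -> _].
  have e0' : 0 < complex.Re e by rewrite -ltcR -eE.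
  apply/near_cabs; have [d d0 h] := fz _ e0'; exists d => // k kd.
  by rewrite distrC normCE eE lecR h.
have eC : (0 : R[i]) < e%:C%C by rewrite ltcR.
have /near_cabs[d d0 h] := fz _ eC; exists d => // k kd.
by rewrite -lecR -normCE distrC h.
Qed.

Lemma cderiv_ccont (f : R[i] -> R[i]) z l : cderiv f z l -> ccont f z.
Proof.
move=> /cderiv_is_derive[df _]; apply/ccontP.
exact/differentiable_continuous/derivable1_diffP.
Qed.

Lemma ccont_line (f : R[i] -> R[i]) (c z : R[i]) (t : R) :
  ccont f (c + t%:C%C * z) ->
  {for t, continuous (fun s : R => Re (f (c + s%:C%C * z)))} /\
  {for t, continuous (fun s : R => Im (f (c + s%:C%C * z)))}.
Proof.
move=> cf; have Z0 : 0 < cabs z + 1 by rewrite ltr_wpDl // cabs_ge0.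
have key e : 0 < e -> \forall s \near t, cabs (f (c + t%:C%C * z) - f (c + s%:C%C * z)) < e.
  move=> e0; have [d d0 h] := cf (e / 2) (divr_gt0 e0 (ltr0Sn _ 1)).
  apply/nbhs_ballP; exists (d / (cabs z + 1)) => /=; first by rewrite divr_gt0.
  move=> s; rewrite /ball /= => st.
  have := h ((s - t)%:C%C * z).
  rewrite cabsM cabsR distrC.
  have -> : c + t%:C%C * z + (s - t)%:C%C * z = c + s%:C%C * z.
    by rewrite rmorphB /=; ring.
  move=> h1; rewrite cabs_distC; apply: le_lt_trans (h1 _) _; last by lra.
  move: st; rewrite ltr_pdivlMr //; apply: le_lt_trans.
  by rewrite ler_wpM2l // lerDl.
split; apply/cvgrPdist_lt => e /key; apply: filterS => s; apply: le_lt_trans.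
  rewrite -[X in _ - X]opprK opprK; apply: le_trans (Re_le_cabs _).
  by rewrite cReD; case: (f (c + s%:C%C * z)).
apply: le_trans (Im_le_cabs _).
by rewrite cImD; case: (f (c + s%:C%C * z)).
Qed.

Lemma ccont_integrable (f : R[i] -> R[i]) (c z : R[i]) a b : a <= b ->
  (forall t : R, a <= t <= b -> ccont f (c + t%:C%C * z)) ->
  cintegrable (fun t => f (c + t%:C%C * z)) a b.
Proof.
move=> ab cf.
have [P pP] := prim_exists ab (fun t tab => (ccont_line (cf t tab)).1).
have [Q pQ] := prim_exists ab (fun t tab => (ccont_line (cf t tab)).2).
by exists (fun t => (P t +i* Q t)%C).
Qed.

Lemma is_derive_dist (f : R -> R) (t l : R) :
  (forall e : R, 0 < e -> exists2 d : R, 0 < d & forall h : R, h != 0 -> `|h| < d ->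
    `|f (t + h) - f t - l * h| <= e * `|h|) -> is_derive t 1 f l.
Proof.
move=> fl.
have h : h^-1 *: ((f \o shift t) (h *: (1 : R)) - f t) @[h --> 0^'] --> l.
  apply/cvgrPdist_le => e e0; have [d d0 h] := fl e e0.
  rewrite near_withinE; apply/nbhs_ballP; exists d => //= k.
  rewrite /ball /= sub0r normrN => kd k0.
  have hk := h k k0 kd; rewrite [k *: 1]mulr1 /= [k + t]addrC -(ler_pM2r (_ : 0 < `|k|)) ?normr_gt0 //.
  rewrite -normrM.
  suff -> : (l - k^-1 *: (f (t + k) - f t)) * k = - (f (t + k) - f t - l * k).
    by rewrite normrN.
  rewrite [_ *: _]/(_ * _) mulrBl mulrAC mulVf // mul1r opprB; ring.
by split; [apply/cvg_ex; exists l|exact: cvg_lim].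
Qed.

(** The chain rule along a line; its direction z appears as a factor of the integrand, as dz does in
    a contour integral. *)
Lemma cderiv_prim (F f : R[i] -> R[i]) (c z : R[i]) a b :
  (forall t : R, a <= t <= b -> cderiv F (c + t%:C%C * z) (f (c + t%:C%C * z))) ->
  cprim (fun t => F (c + t%:C%C * z)) (fun t => z * f (c + t%:C%C * z)) a b.
Proof.
move=> Ff.
have key (t : R) : a <= t <= b -> forall e : R, 0 < e -> exists2 d : R, 0 < d & forall h : R,
    h != 0 -> `|h| < d ->
    cabs (F (c + (t + h)%:C%C * z) - F (c + t%:C%C * z) - z * f (c + t%:C%C * z) * h%:C%C) <= e * `|h|.
  move=> tab e e0; have Z0 : 0 < cabs z + 1 by rewrite ltr_wpDl // cabs_ge0.
  have [d d0 h] := Ff t tab (e / (cabs z + 1)) (divr_gt0 e0 Z0).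
  exists (d / (cabs z + 1)) => [|k k0]; first by rewrite divr_gt0.
  rewrite ltr_pdivlMr // => kd.
  have -> : c + (t + k)%:C%C * z = (c + t%:C%C * z) + k%:C%C * z by rewrite rmorphD /=; ring.
  have [z0|z0] := eqVneq z 0.
    by rewrite z0 !mulr0 addr0 !mul0r subrr subr0 cabs0 mulr_ge0 // ltW.
  have kz : k%:C%C * z != 0 by rewrite mulf_neq0 // fmorph_eq0.
  have kzd : cabs (k%:C%C * z) < d.
    rewrite cabsM cabsR; apply: le_lt_trans kd; rewrite ler_wpM2l // lerDl //.
  have := h _ kz kzd; rewrite cabsM cabsR.
  have -> : f (c + t%:C%C * z) * (k%:C%C * z) = z * f (c + t%:C%C * z) * k%:C%C by ring.
  move=> /le_trans; apply.
  have -> : e / (cabs z + 1) * (`|k| * cabs z) = `|k| * (e * cabs z / (cabs z + 1)) by ring.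
  rewrite [e * `|k|]mulrC ler_wpM2l // ler_pdivrMr // ler_wpM2l ?(ltW e0) //.
  by rewrite lerDl.
have ReE (u v w : R[i]) (k : R) : Re u - Re v - Re w * k = Re (u - v - w * k%:C%C).
  by case: u v w => [? ?] [? ?] [? ?]; simpc.
have ImE (u v w : R[i]) (k : R) : Im u - Im v - Im w * k = Im (u - v - w * k%:C%C).
  by case: u v w => [? ?] [? ?] [? ?]; simpc.
split=> t tab; apply: is_derive_dist => e e0; have [d d0 h] := key t tab e e0;
  exists d => // k k0 kd; apply: le_trans (h k k0 kd).
  by rewrite ReE; exact: Re_le_cabs.
by rewrite ImE; exact: Im_le_cabs.
Qed.

End complex_integral.

(** * Integrals over the boundary of a rectangle *)

Section rectangle.
Variable R : realType.
Implicit Types (f g F : R[i] -> R[i]) (a b c d e u v : R).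
Local Notation Re := (@complex.Re R).
Local Notation Im := (@complex.Im R).

(* Parametrized as [c + u * z] so that the statements about integrals along a line
   apply to both directions. *)
Definition hint f v a b := cint (fun u => f ((0 +i* v)%C + u%:C%C * 1)) a b.
Definition vint f u c d := cint (fun v => f (u%:C%C + v%:C%C * 'i%C)) c d.

(** The contour integral taken counterclockwise; the factor ['i] is dz on the vertical sides. *)
Definition bint f a b c d :=
  hint f c a b - hint f d a b + 'i%C * (vint f b c d - vint f a c d).

Lemma hpt u v : (0 +i* v)%C + u%:C%C * 1 = (u +i* v)%C.
Proof. by rewrite mulr1; simpc. Qed.

Lemma vpt u v : u%:C%C + v%:C%C * 'i%C = (u +i* v)%C.
Proof. by simpc. Qed.

Definition inR a b c d (z : R[i]) := a <= Re z <= b /\ c <= Im z <= d.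

Definition onB a b c d (z : R[i]) := inR a b c d z /\
  (Re z = a \/ Re z = b \/ Im z = c \/ Im z = d).

Lemma hint_integrable f v a b : a <= b ->
  (forall u, a <= u <= b -> ccont f (u +i* v)%C) ->
  cintegrable (fun u => f ((0 +i* v)%C + u%:C%C * 1)) a b.
Proof. by move=> ab cf; apply: ccont_integrable => // u uab; rewrite hpt; exact: cf. Qed.

Lemma vint_integrable f u c d : c <= d ->
  (forall v, c <= v <= d -> ccont f (u +i* v)%C) ->
  cintegrable (fun v => f (u%:C%C + v%:C%C * 'i%C)) c d.
Proof. by move=> cd cf; apply: ccont_integrable => // v vcd; rewrite vpt; exact: cf. Qed.

Section boundary.
Variables (a b c d : R).
Hypotheses (ab : a <= b) (cd : c <= d).

Definition contB f := forall z, onB a b c d z -> ccont f z.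

Lemma onB_h u v : a <= u <= b -> v = c \/ v = d -> onB a b c d (u +i* v)%C.
Proof.
move=> uab [->|->]; split=> /=.
- by split=> //; rewrite lexx.
- by right; right; left.
- by split=> //; rewrite cd lexx.
- by right; right; right.
Qed.

Lemma onB_v u v : c <= v <= d -> u = a \/ u = b -> onB a b c d (u +i* v)%C.
Proof.
move=> vcd [->|->]; split=> /=.
- by split=> //; rewrite lexx.
- by left.
- by split=> //; rewrite ab lexx.
- by right; left.
Qed.

Lemma contB_h f v : contB f -> v = c \/ v = d ->
  cintegrable (fun u => f ((0 +i* v)%C + u%:C%C * 1)) a b.
Proof. by move=> cf vE; apply: hint_integrable => // u uab; apply: cf; exact: onB_h. Qed.

Lemma contB_v f u : contB f -> u = a \/ u = b ->
  cintegrable (fun v => f (u%:C%C + v%:C%C * 'i%C)) c d.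
Proof. by move=> cf uE; apply: vint_integrable => // v vcd; apply: cf; exact: onB_v. Qed.

Lemma bintD f g : contB f -> contB g ->
  bint (fun z => f z + g z) a b c d = bint f a b c d + bint g a b c d.
Proof.
move=> cf cg; rewrite /bint /hint /vint.
rewrite !cintD //; try (by apply: contB_h; auto); try (by apply: contB_v; auto).
by ring.
Qed.

Lemma bintZ k f : contB f ->
  bint (fun z => k * f z) a b c d = k * bint f a b c d.
Proof.
move=> cf; rewrite /bint /hint /vint.
rewrite !cintZ //; try (by apply: contB_h; auto); try (by apply: contB_v; auto).
by ring.
Qed.

Lemma bint_eq f g : contB f -> (forall z, onB a b c d z -> f z = g z) ->
  bint f a b c d = bint g a b c d.
Proof.
move=> cf fg; rewrite /bint /hint /vint.
congr (_ - _ + _ * (_ - _)); apply: cint_eq => //;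
  try (by apply: contB_h; auto); try (by apply: contB_v; auto);
  move=> t tab; rewrite ?hpt ?vpt; apply: fg;
  try (by apply: onB_h; auto); by apply: onB_v; auto.
Qed.

Lemma bint_norm f K : contB f -> (forall z, onB a b c d z -> cabs (f z) <= K) ->
  cabs (bint f a b c d) <= 4 * K * ((b - a) + (d - c)).
Proof.
move=> cf fK; rewrite /bint.
have hb v : v = c \/ v = d -> cabs (hint f v a b) <= 2 * K * (b - a).
  move=> vE; apply: cint_norm => //; first exact: contB_h.
  by move=> u uab; rewrite hpt; apply: fK; exact: onB_h.
have vb u : u = a \/ u = b -> cabs (vint f u c d) <= 2 * K * (d - c).
  move=> uE; apply: cint_norm => //; first exact: contB_v.
  by move=> v vcd; rewrite vpt; apply: fK; exact: onB_v.
have h1 := hb c (or_introl erefl); have h2 := hb d (or_intror erefl).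
have h3 := vb a (or_introl erefl); have h4 := vb b (or_intror erefl).
apply: le_trans (cabsD _ _) _; rewrite cabsM.
have -> : cabs 'i%C = 1 :> R by rewrite /cabs /= expr0n add0r expr1n sqrtr1.
rewrite mul1r; have := cabsB (hint f c a b) (hint f d a b).
have := cabsB (vint f b c d) (vint f a c d); lra.
Qed.

Lemma hint_prim F f v : (forall u, a <= u <= b -> cderiv F (u +i* v)%C (f (u +i* v)%C)) ->
  hint f v a b = F (b +i* v)%C - F (a +i* v)%C.
Proof.
move=> Ff; rewrite /hint (cintE (P := fun u => F ((0 +i* v)%C + u%:C%C * 1)) ab) ?hpt //.
apply: (cprim_eq (f := fun u => 1 * f ((0 +i* v)%C + u%:C%C * 1))); first by move=> *; rewrite mul1r.
by apply: cderiv_prim => u uab; rewrite hpt; exact: Ff.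
Qed.

Lemma vint_prim F f u : (forall v, c <= v <= d -> cderiv F (u +i* v)%C (f (u +i* v)%C)) ->
  'i%C * vint f u c d = F (u +i* d)%C - F (u +i* c)%C.
Proof.
move=> Ff.
have h : cprim (fun v => F (u%:C%C + v%:C%C * 'i%C)) (fun v => 'i%C * f (u%:C%C + v%:C%C * 'i%C)) c d.
  by apply: cderiv_prim => v vcd; rewrite vpt; exact: Ff.
have ii : (- 'i%C) * 'i%C = 1 :> R[i] by simpc.
have h2 : cintegrable (fun v => f (u%:C%C + v%:C%C * 'i%C)) c d.
  exists (fun v => (- 'i%C) * F (u%:C%C + v%:C%C * 'i%C)).
  by apply: cprim_eq (cprimZ (- 'i%C) h) => v _; rewrite mulrA ii mul1r.
by rewrite /vint -(cintZ _ cd h2) (cintE cd h) !vpt.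
Qed.

(** Each side contributes the difference of F at its ends, and the four corners cancel. *)
Lemma bint_prim0 F f : (forall z, onB a b c d z -> cderiv F z (f z)) -> bint f a b c d = 0.
Proof.
move=> Ff; rewrite /bint mulrBr.
rewrite !(hint_prim (F := F)) ?(vint_prim (F := F)); try by ring.
all: move=> t tab; apply: Ff; try (by apply: onB_h; auto); by apply: onB_v; auto.
Qed.

End boundary.

Lemma bint_splith f a e b c d : a <= e -> e <= b -> c <= d ->
  (forall z, inR a b c d z -> ccont f z) ->
  bint f a b c d = bint f a e c d + bint f e b c d.
Proof.
move=> ae eb cd cf; have ab := le_trans ae eb.
have ih v : c <= v <= d -> cintegrable (fun u => f ((0 +i* v)%C + u%:C%C * 1)) a b.
  by move=> vcd; apply: hint_integrable => // u uab; apply: cf; split.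
rewrite /bint /hint (cint_split ae eb (ih c _)) ?lexx //.
rewrite (cint_split ae eb (ih d _)) ?lexx ?cd //; ring.
Qed.

Lemma bint_splitv f a b c e d : a <= b -> c <= e -> e <= d ->
  (forall z, inR a b c d z -> ccont f z) ->
  bint f a b c d = bint f a b c e + bint f a b e d.
Proof.
move=> ab ce ed cf; have cd := le_trans ce ed.
have iv u : a <= u <= b -> cintegrable (fun v => f (u%:C%C + v%:C%C * 'i%C)) c d.
  by move=> uab; apply: vint_integrable => // v vcd; apply: cf; split.
rewrite /bint /vint (cint_split ce ed (iv a _)) ?lexx //.
rewrite (cint_split ce ed (iv b _)) ?lexx ?ab //; ring.
Qed.

(** A bisection principle: if P failed, a nested sequence of failing quarters would shrink to a
    point, and P holds for all small rectangles around that point. *)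
Lemma bisect2 (P : R -> R -> R -> R -> Prop) a b c d : a <= b -> c <= d ->
  (forall a b c d, a <= b -> c <= d ->
    P a ((a + b) / 2) c ((c + d) / 2) -> P ((a + b) / 2) b c ((c + d) / 2) ->
    P a ((a + b) / 2) ((c + d) / 2) d -> P ((a + b) / 2) b ((c + d) / 2) d -> P a b c d) ->
  (forall x y, a <= x <= b -> c <= y <= d -> exists2 r : R, 0 < r &
    forall a' b' c' d', a <= a' <= x -> x <= b' <= b -> c <= c' <= y -> y <= d' <= d ->
      b' - a' < r -> d' - c' < r -> P a' b' c' d') ->
  P a b c d.
Proof.
move=> ab cd comb loc; apply: contrapT => nP.
pose T := (R * R * (R * R))%type.
pose A (q : T) := q.1.1; pose B (q : T) := q.1.2; pose C (q : T) := q.2.1; pose D (q : T) := q.2.2.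
pose inv (q : T) := [/\ ~ P (A q) (B q) (C q) (D q), A q <= B q & C q <= D q].
(* Or rather, the step relation is conditional on [inv q]: a successor then exists for every
   quadruple, as dependent choice demands. *)
pose sub (q q' : T) := inv q -> [/\ inv q', A q <= A q' /\ B q' <= B q, C q <= C q' /\ D q' <= D q,
  B q' - A q' = (B q - A q) / 2 & D q' - C q' = (D q - C q) / 2].
have step q : exists q', sub q q'.
  have [iq|niq] := pselect (inv q); last by exists q => /niq.
  have [nPq abq cdq] := iq.
  have mk a' b' c' d' : ~ P a' b' c' d' -> A q <= a' /\ b' <= B q -> C q <= c' /\ d' <= D q ->
      b' - a' = (B q - A q) / 2 -> d' - c' = (D q - C q) / 2 -> exists q', sub q q'.
    move=> nP' ha hc hb hd; exists ((a', b'), (c', d')) => _; split => //.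
    by split => //; rewrite /A /B /C /D /=; lra.
  have [p1|p1] := pselect (P (A q) ((A q + B q) / 2) (C q) ((C q + D q) / 2)); last first.
    by apply: mk p1 _ _ _ _; lra.
  have [p2|p2] := pselect (P ((A q + B q) / 2) (B q) (C q) ((C q + D q) / 2)); last first.
    by apply: mk p2 _ _ _ _; lra.
  have [p3|p3] := pselect (P (A q) ((A q + B q) / 2) ((C q + D q) / 2) (D q)); last first.
    by apply: mk p3 _ _ _ _; lra.
  have [p4|p4] := pselect (P ((A q + B q) / 2) (B q) ((C q + D q) / 2) (D q)); last first.
    by apply: mk p4 _ _ _ _; lra.
  by exfalso; apply: nPq; exact: comb.
have [q [q0 qS]] := dependent_choice (fun x => cid (step x)) ((a, b), (c, d)).
have iq n : inv (q n).
  elim: n => [|n IHn]; first by rewrite q0.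
  by have [] := qS n IHn.
have hab n : B (q n) - A (q n) = (b - a) / 2 ^+ n.
  elim: n => [|n IHn]; first by rewrite q0 expr0 divr1.
  by have [_ _ _ -> _] := qS n (iq n); rewrite IHn exprSr invfM mulrA.
have hcd n : D (q n) - C (q n) = (d - c) / 2 ^+ n.
  elim: n => [|n IHn]; first by rewrite q0 expr0 divr1.
  by have [_ _ _ _ ->] := qS n (iq n); rewrite IHn exprSr invfM mulrA.
have mono n m : (n <= m)%N -> [/\ A (q n) <= A (q m), B (q m) <= B (q n), C (q n) <= C (q m) & D (q m) <= D (q n)].
  move=> /subnK <-; elim: (m - n)%N => [|k [h1 h2 h3 h4]]; first by rewrite add0n.
  have [_ [h5 h6] [h7 h8] _ _] := qS _ (iq (k + n)%N).
  by split; [exact: le_trans h5|exact: le_trans h2|exact: le_trans h7|exact: le_trans h4].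
have limit (X Y : T -> R) : (forall n m, (n <= m)%N -> X (q n) <= X (q m) /\ Y (q m) <= Y (q n)) ->
    (forall n, X (q n) <= Y (q n)) -> exists x, forall n, X (q n) <= x <= Y (q n).
  move=> mXY XY.
  have XYall n m : X (q n) <= Y (q m).
    have [nm|mn] := leqP n m.
      by apply: le_trans (XY m); have [] := mXY n m nm.
    by apply: le_trans (XY n) _; have [] := mXY m n (ltnW mn).
  exists (sup (range (fun n => X (q n)))) => n; apply/andP; split.
    by apply: ub_le_sup; [exists (Y (q 0%N)) => _ [k _ <-]|exists n].
  by apply: ge_sup; [exists (X (q 0%N)), 0%N|move=> _ [k _ <-]].
have [x xP] : exists x, forall n, A (q n) <= x <= B (q n).
  by apply: limit => [n m /mono[]|n] //; have [] := iq n.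
have [y yP] : exists y, forall n, C (q n) <= y <= D (q n).
  by apply: limit => [n m /mono[]|n] //; have [] := iq n.
have x0 := xP 0%N; have y0 := yP 0%N; rewrite q0 /A /B /C /D /= in x0 y0.
have [r r0 hr] := loc x y x0 y0.
have S0 : 0 < (b - a) + (d - c) + 1 by move: ab cd; lra.
have [n rn] : exists n, (1 / 2 : R) ^+ n <= r / 2 / ((b - a) + (d - c) + 1).
  by apply: expr_small; [lra|rewrite !divr_gt0].
have [nPn _ _] := iq n; apply: nPn.
have [h1 h2 h3 h4] := mono 0%N n (leq0n n); rewrite q0 /A /B /C /D /= in h1 h2 h3 h4.
have small w : 0 <= w -> w <= (b - a) + (d - c) + 1 -> w / 2 ^+ n < r.
  move=> w0 wS; rewrite ler_pdivlMr // in rn.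
  apply: (@le_lt_trans _ _ (r / 2)); last by lra.
  apply: le_trans rn; rewrite expr_div_n expr1n div1r mulrC ler_wpM2l // invr_ge0 exprn_ge0 //.
have /andP[xa xb] := xP n; have /andP[yc yd] := yP n.
apply: hr; rewrite ?h1 ?h2 ?h3 ?h4 ?xa ?xb ?yc ?yd //.
  by rewrite hab; apply: small; move: ab cd; lra.
by rewrite hcd; apply: small; move: ab cd; lra.
Qed.

End rectangle.

(** * Rules for complex derivatives *)

Section cderiv_rules.
Variable R : realType.
Implicit Types (f g F : R[i] -> R[i]) (z w l m k : R[i]).

Lemma cderiv_ext f g z l m : (forall w, f w = g w) -> l = m ->
  cderiv f z l -> cderiv g z m.
Proof. by move=> fg <- fl e /fl[d d0 h]; exists d => // k k0 kd; rewrite -!fg; exact: h. Qed.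

Lemma cderiv_cst k z : cderiv (fun=> k) z 0.
Proof. by move=> e e0; exists 1 => // h _ _; rewrite subrr mul0r subr0 cabs0 mulr_ge0 ?cabs_ge0 // ltW. Qed.

Lemma cderiv_id z : cderiv id z 1.
Proof.
move=> e e0; exists 1 => // h _ _.
have -> : id (z + h) - id z - 1 * h = 0 by rewrite /=; ring.
by rewrite cabs0 mulr_ge0 ?cabs_ge0 // ltW.
Qed.

Lemma cderivD f g z l m : cderiv f z l -> cderiv g z m ->
  cderiv (fun z => f z + g z) z (l + m).
Proof. by move=> /cderiv_is_derive hf /cderiv_is_derive hg; apply/cderiv_is_derive; exact: is_deriveD hf hg. Qed.

Lemma ccontD f g z : ccont f z -> ccont g z -> ccont (fun z => f z + g z) z.
Proof. by move=> /ccontP hf /ccontP hg; apply/ccontP; have := cvgD hf hg; apply. Qed.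

Lemma ccontM f g z : ccont f z -> ccont g z -> ccont (fun z => f z * g z) z.
Proof. by move=> /ccontP hf /ccontP hg; apply/ccontP; have := cvgM hf hg; apply. Qed.

Lemma cderivM f g z l m : cderiv f z l -> cderiv g z m ->
  cderiv (fun z => f z * g z) z (l * g z + f z * m).
Proof.
move=> /cderiv_is_derive hf /cderiv_is_derive hg.
have [_ +] := cderiv_is_derive (fun z => f z * g z) z (l * g z + f z * m); apply.
by apply: is_derive_eq (is_deriveM hf hg) _; rewrite addrC [in LHS]/GRing.scale /= [l * _]mulrC.
Qed.

Lemma cderiv_comp f g z l m : cderiv g z l -> cderiv f (g z) m ->
  cderiv (fun z => f (g z)) z (m * l).
Proof.
move=> hg hf e e0.
(* The two errors add up to [e' (|l| + 1) |h| + |m| e' |h| = e' K |h|]; the first uses [e' <= 1]. *)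
pose K := cabs l + cabs m + 1.
have K0 : 0 < K by rewrite /K ltr_wpDl // addr_ge0 ?cabs_ge0.
pose e' := Num.min 1 (e / K).
have e'0 : 0 < e' by rewrite lt_min ltr01 divr_gt0.
have e'1 : e' <= 1 by rewrite ge_min lexx.
have [d1 d10 h1] := hg _ e'0; have [d2 d20 h2] := hf _ e'0.
exists (Num.min d1 (d2 / K)) => [|h h0]; first by rewrite lt_min d10 divr_gt0.
rewrite lt_min ltr_pdivlMr // => /andP[hd1 hd2].
set k := g (z + h) - g z.
have a1 : cabs (k - l * h) <= e' * cabs h by exact: h1.
have hh := cabs_ge0 h.
have kh : cabs k <= (cabs l + 1) * cabs h.
  have := cabsD (k - l * h) (l * h); rewrite subrK cabsM.
  have : e' * cabs h <= 1 * cabs h by rewrite ler_wpM2r.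
  lra.
have kd : cabs k < d2.
  apply: le_lt_trans kh _; apply: le_lt_trans hd2.
  rewrite mulrC ler_wpM2l //; rewrite /K; have := cabs_ge0 m; lra.
have a2 : cabs (f (g z + k) - f (g z) - m * k) <= e' * cabs k.
  have [->|k0] := eqVneq k 0; last exact: h2.
  by rewrite addr0 subrr mulr0 subr0 cabs0 mulr0.
have -> : f (g (z + h)) - f (g z) - m * l * h =
    (f (g z + k) - f (g z) - m * k) + m * (k - l * h).
  by rewrite /k [g z + _]addrC subrK; ring.
apply: le_trans (cabsD _ _) _; rewrite cabsM.
have b2 : cabs m * cabs (k - l * h) <= cabs m * (e' * cabs h) by rewrite ler_wpM2l ?cabs_ge0.
have b3 : e' * cabs k <= e' * ((cabs l + 1) * cabs h) by rewrite ler_wpM2l // ltW.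
have b4 : e' * K <= e by rewrite -ler_pdivlMr // ge_min lexx orbT.
have b5 : e' * K * cabs h <= e * cabs h by rewrite ler_wpM2r.
apply: le_trans b5; rewrite /K; lra.
Qed.

Lemma cderiv_inv z : z != 0 -> cderiv (fun z => z^-1) z (- (z ^- 2)).
Proof.
move=> z0; have Z0 : 0 < cabs z by rewrite cabs_gt0.
apply: (@cderiv_quadratic _ _ _ _ (cabs z ^- 2 * (2 / cabs z)) (cabs z / 2)); first by rewrite divr_gt0.
move=> h h0 hz.
have zh : cabs z / 2 <= cabs (z + h).
  by have := cabs_lerB z (- h); rewrite opprK cabsN; lra.
have zh0 : z + h != 0 by rewrite -cabs_gt0 (lt_le_trans _ zh) // divr_gt0.
have -> : (z + h)^-1 - z^-1 - - z ^- 2 * h = z ^- 2 * (z + h)^-1 * h ^+ 2.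
  by field; rewrite z0 zh0.
rewrite cabsM [cabs (h ^+ 2)]cabsX cabsM [cabs (z ^- 2)]cabsV cabsX cabsV ler_wpM2r ?exprn_ge0 ?cabs_ge0 // ler_wpM2l ?invr_ge0 ?exprn_ge0 ?cabs_ge0 //.
by rewrite -[2 / _]invrK invf_div lef_pV2 ?posrE ?divr_gt0 // (lt_le_trans _ zh) // divr_gt0.
Qed.

Lemma cderivZ k f z l : cderiv f z l -> cderiv (fun z => k * f z) z (k * l).
Proof. by move=> /(cderivM (cderiv_cst k z)); rewrite mul0r add0r. Qed.

Lemma cderivX n z : cderiv (fun z => z ^+ n.+1) z (n.+1%:R * z ^+ n).
Proof.
elim: n => [|n IHn]; first by rewrite expr0 mulr1; exact: cderiv_id.
apply: cderiv_ext (cderivM (cderiv_id z) IHn) => [w|]; first by rewrite [RHS]exprS.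
by rewrite -[n.+2%:R]natr1 [z ^+ n.+1]exprS /=; ring.
Qed.

Lemma cderiv_poly (p : {poly R[i]}) z : cderiv (horner p) z p^`().[z].
Proof.
elim/poly_ind: p => [|p c IHp].
  by apply: cderiv_ext (cderiv_cst 0 z) => [w|]; rewrite ?deriv0 horner0.
apply: cderiv_ext (cderivD (cderivM IHp (cderiv_id z)) (cderiv_cst c z)) => [w|].
  by rewrite hornerMXaddC.
by rewrite derivMXaddC hornerD hornerMX /= mulr1 addr0 addrC.
Qed.

Lemma cderiv_Xn z n : z != 0 -> cderiv (fun z => z^-1 ^+ n.+1) z (- (n.+1%:R * z^-1 ^+ n.+2)).
Proof.
move=> z0; apply: cderiv_ext (cderiv_comp (cderiv_inv z0) (cderivX n z^-1)) => //.
by rewrite -exprVn [in RHS]exprS [in RHS]exprS; ring.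
Qed.

Lemma ccont_cst k z : ccont (fun=> k) z. Proof. exact: cderiv_ccont (cderiv_cst k z). Qed.

Lemma ccontB f g z : ccont f z -> ccont g z -> ccont (fun z => f z - g z) z.
Proof.
move=> hf /(ccontM (ccont_cst (- 1) z)) hg e e0.
by have [d d0 h] := ccontD hf hg e0; exists d => // k /h; rewrite !mulN1r.
Qed.

Definition cdiff f z := exists l, cderiv f z l.

Lemma cdiff_ccont f z : cdiff f z -> ccont f z. Proof. by move=> [l]; exact: cderiv_ccont. Qed.

Lemma cdiffM f g z : cdiff f z -> cdiff g z -> cdiff (fun z => f z * g z) z.
Proof. by move=> [l hl] [m hm]; eexists; exact: cderivM hl hm. Qed.

Lemma cdiffD f g z : cdiff f z -> cdiff g z -> cdiff (fun z => f z + g z) z.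
Proof. by move=> [l hl] [m hm]; eexists; exact: cderivD hl hm. Qed.

Lemma cdiff_cst k z : cdiff (fun=> k) z. Proof. by eexists; exact: cderiv_cst. Qed.

Lemma cdiff_id z : cdiff id z. Proof. by eexists; exact: cderiv_id. Qed.

Lemma cdiffB f g z : cdiff f z -> cdiff g z -> cdiff (fun z => f z - g z) z.
Proof.
move=> hf /(cdiffM (cdiff_cst (- 1) z)) hg; have [l hl] := cdiffD hf hg.
by exists l; apply: cderiv_ext hl => // w; rewrite mulN1r.
Qed.

Lemma cdiff_comp f g z : cdiff g z -> cdiff f (g z) -> cdiff (fun z => f (g z)) z.
Proof. by move=> [l hl] [m hm]; eexists; exact: cderiv_comp hl hm. Qed.

Lemma cdiffV f z : cdiff f z -> f z != 0 -> cdiff (fun z => (f z)^-1) z.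
Proof.
move=> hf f0; apply: (cdiff_comp (f := fun z => z^-1)) hf _.
by eexists; exact: cderiv_inv.
Qed.

Lemma cdiffX f z n : cdiff f z -> cdiff (fun z => f z ^+ n) z.
Proof.
move=> hf; elim: n => [|n IHn]; first exact: cdiff_cst.
by have [l hl] := cdiffM hf IHn; exists l; apply: cderiv_ext hl => // w; rewrite exprS.
Qed.

Lemma cdiff_poly (p : {poly R[i]}) z : cdiff (horner p) z.
Proof. by eexists; exact: cderiv_poly. Qed.

Lemma cdiff_near f g z (r : R) : 0 < r -> (forall h, cabs h < r -> f (z + h) = g (z + h)) ->
  cdiff f z -> cdiff g z.
Proof. by move=> r0 fg [l hl]; exists l; exact: cderiv_eq_near r0 fg hl. Qed.

End cderiv_rules.

(** * Goursat's theorem *)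

Section goursat.
Variable R : realType.
Implicit Types (f : R[i] -> R[i]) (a b c d : R).
Local Notation Re := (@complex.Re R).
Local Notation Im := (@complex.Im R).

(** The bound e times the squared half-perimeter passes from four quarters to the whole, since
    [4 (s / 2)^2 = s^2]. It holds for small rectangles because the affine part of f has a primitive
    and its remainder is small relative to their size. *)
Theorem goursat f a b c d : a <= b -> c <= d ->
  (forall z, inR a b c d z -> cdiff f z) -> bint f a b c d = 0.
Proof.
move=> ab cd fd.
have fc z : inR a b c d z -> ccont f z by move=> /fd/cdiff_ccont.
suff main e : 0 < e -> cabs (bint f a b c d) <= e * ((b - a) + (d - c)) ^+ 2.
  apply/eqP; rewrite -cabs_eq0 eq_le cabs_ge0 andbT.
  apply: (@small_le0 _ _ (((b - a) + (d - c)) ^+ 2) 1) => // e e0 _.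
  by rewrite mulrC main.
move=> e0.
pose P a' b' c' d' := a <= a' -> b' <= b -> c <= c' -> d' <= d ->
  cabs (bint f a' b' c' d') <= e * ((b' - a') + (d' - c')) ^+ 2.
suff : P a b c d by apply.
apply: bisect2 => // [a' b' c' d' ab' cd' p1 p2 p3 p4 ha hb hc hd|x y xab ycd].
  set m := (a' + b') / 2; set k := (c' + d') / 2.
  have [am mb] : a' <= m /\ m <= b' by rewrite /m; lra.
  have [ck kd] : c' <= k /\ k <= d' by rewrite /k; lra.
  have sub a1 b1 c1 d1 z : a' <= a1 -> b1 <= b' -> c' <= c1 -> d1 <= d' -> inR a1 b1 c1 d1 z -> ccont f z.
    move=> ha1 hb1 hc1 hd1 [/andP[z1 z2] /andP[z3 z4]]; apply: fc; split; apply/andP; split; lra.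
  rewrite (bint_splith am mb cd'); last by move=> z; apply: sub.
  rewrite (bint_splitv am ck kd); last by move=> z; apply: sub.
  rewrite (bint_splitv mb ck kd); last by move=> z; apply: sub.
  have q1 := p1 ha (le_trans mb hb) hc (le_trans kd hd).
  have q2 := p2 (le_trans ha am) hb hc (le_trans kd hd).
  have q3 := p3 ha (le_trans mb hb) (le_trans hc ck) hd.
  have q4 := p4 (le_trans ha am) hb (le_trans hc ck) hd.
  apply: le_trans (cabsD _ _) _.
  apply: le_trans (lerD (cabsD _ _) (cabsD _ _)) _.
  apply: le_trans (lerD (lerD q1 q3) (lerD q2 q4)) _.
  have -> : m - a' = (b' - a') / 2 by rewrite /m; field.
  have -> : b' - m = (b' - a') / 2 by rewrite /m; field.
  have -> : k - c' = (d' - c') / 2 by rewrite /k; field.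
  have -> : d' - k = (d' - c') / 2 by rewrite /k; field.
  by rewrite le_eqVlt; apply/orP; left; apply/eqP; field.
pose z0 := (x +i* y)%C.
have [l hl] : cdiff f z0 by apply: fd; split.
(* The quarter absorbs the factor 4 of [bint_norm]. *)
have [r r0 hr] := hl (e / 4) (divr_gt0 e0 (ltr0Sn _ 3)).
exists (r / 2) => [|a' b' c' d' /andP[ha hax] /andP[hxb hb] /andP[hc hcy] /andP[hyd hd] wr hr' _ _ _ _]; first by rewrite divr_gt0.
have ab' := le_trans hax hxb; have cd' := le_trans hcy hyd.
pose aff (z : R[i]) := f z0 + l * (z - z0).
have Daff z : cderiv (fun z => f z0 * z + l / 2 * ((z - z0) * (z - z0))) z (aff z).
  have h1 := cderivD (cderiv_id z) (cderiv_cst (- z0) z).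
  have h2 := cderivD (cderivZ (f z0) (cderiv_id z)) (cderivZ (l / 2) (cderivM h1 h1)).
  have -> : aff z = f z0 * 1 + l / 2 * ((1 + 0) * (z - z0) + (z - z0) * (1 + 0)).
    by rewrite /aff; field.
  exact: h2.
have affc z : ccont aff z.
  apply: ccontD (ccont_cst _ _) _; apply: ccontM (ccont_cst _ _) _.
  exact: cdiff_ccont (cdiffB (cdiff_id z) (cdiff_cst z0 z)).
have Bc z : onB a' b' c' d' z -> ccont f z.
  move=> [[/andP[z1 z2] /andP[z3 z4]] _]; apply: fc; split; apply/andP; split; lra.
pose rf z := f z - aff z.
have rfc : contB a' b' c' d' rf by move=> z /Bc zc; exact: ccontB.
have -> : bint f a' b' c' d' = bint rf a' b' c' d'.
  rewrite -[RHS]addr0 -(bint_prim0 ab' cd' (fun z _ => Daff z)).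
  rewrite -(bintD ab' cd' rfc (fun z _ => affc z)).
  by apply: bint_eq => // z _; rewrite /rf subrK.
have -> : e * ((b' - a') + (d' - c')) ^+ 2 = 4 * (e / 4 * ((b' - a') + (d' - c'))) * ((b' - a') + (d' - c')) by field.
apply: bint_norm => // z [[/andP[z1 z2] /andP[z3 z4]] _].
have zz : cabs (z - z0) <= (b' - a') + (d' - c').
  apply: le_trans (cabs_le _) _; case: z z1 z2 z3 z4 => u v /= *.
  by apply: lerD; rewrite ler_norml; lra.
rewrite /rf /aff opprD addrA.
have [->|zn] := eqVneq z z0.
  by rewrite !subrr mulr0 subr0 cabs0 !mulr_ge0 ?(ltW e0) //; lra.
have := hr (z - z0); rewrite subr_eq0 [z0 + _]addrC subrK => /(_ zn) h.
apply: le_trans (h _) _; first by apply: le_lt_trans zz _; lra.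
by rewrite ler_wpM2l // divr_ge0 // ltW.
Qed.

(** A square of half-side t around [z0] is cut out. The other four pieces integrate to 0, and the
    square contributes at most [16 K t] since f is bounded near [z0]. *)
Lemma goursat_except f a b c d z0 : a < Re z0 < b -> c < Im z0 < d ->
  (forall z, inR a b c d z -> ccont f z) ->
  (forall z, inR a b c d z -> z != z0 -> cdiff f z) -> bint f a b c d = 0.
Proof.
case: z0 => x y /= /andP[ax xb] /andP[cy yd] fc fd; set z0 := (x +i* y)%C.
have iz0 : inR a b c d z0 by split; apply/andP; split; rewrite ltW.
have [r r0 hr] := fc z0 iz0 1 ltr01.
pose K := cabs (f z0) + 1.
pose s := Num.min (r / 2) (Num.min (Num.min (x - a) (b - x)) (Num.min (y - c) (d - y))).
have s0 : 0 < s by rewrite !lt_min divr_gt0 //= !subr_gt0 ax xb cy yd.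
apply/eqP; rewrite -cabs_eq0 eq_le cabs_ge0 andbT.
apply: (@small_le0 _ _ (16 * K) s) => // t t0 ts.
move: ts; rewrite !lt_min => /and3P[tr /andP[ta tb] /andP[tc td]].
have sub a1 b1 c1 d1 z : a <= a1 -> b1 <= b -> c <= c1 -> d1 <= d -> inR a1 b1 c1 d1 z -> inR a b c d z.
  by move=> ha1 hb1 hc1 hd1 [/andP[z1 z2] /andP[z3 z4]]; split; apply/andP; split; lra.
have [kk1 kk2 kk3] : [/\ a <= x - t, x - t <= x + t & x + t <= b] by split; lra.
have [kk4 kk5 kk6] : [/\ c <= y - t, y - t <= y + t & y + t <= d] by split; lra.
have kk7 : c <= d by lra.
rewrite (bint_splith kk1 (le_trans kk2 kk3) kk7 fc).
rewrite (bint_splith kk2 kk3 kk7); last by move=> z /sub h; apply: fc; apply: h.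
rewrite (bint_splitv kk2 kk4 (le_trans kk5 kk6)); last by move=> z /sub h; apply: fc; apply: h.
rewrite (bint_splitv kk2 kk5 kk6); last by move=> z /sub h; apply: fc; apply: h.
have off a1 b1 c1 d1 : a <= a1 -> b1 <= b -> c <= c1 -> d1 <= d -> a1 <= b1 -> c1 <= d1 ->
    (b1 < x \/ x < a1 \/ d1 < y \/ y < c1) -> bint f a1 b1 c1 d1 = 0.
  move=> h1 h2 h3 h4 h5 h6 h7; apply: goursat => // z iz.
  apply: fd; first exact: sub iz.
  apply/eqP => zE; move: iz; rewrite zE /z0 => -[/= /andP[u1 u2] /andP[u3 u4]].
  by case: h7 => [|[|[|]]]; lra.
rewrite (off a (x - t) c d) ?(off (x + t) b c d) //; try lra.
rewrite (off (x - t) (x + t) c (y - t)) ?(off (x - t) (x + t) (y + t) d) //; try lra.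
rewrite add0r addr0 add0r addr0.
have -> : 16 * K * t = 4 * K * ((x + t - (x - t)) + (y + t - (y - t))) by ring.
apply: bint_norm => // z [iz _].
  by apply: fc; apply: sub iz.
have zz : cabs (z - z0) < r.
  apply: le_lt_trans (cabs_le _) _; case: iz => /andP[u1 u2] /andP[u3 u4].
  have v1 : `|Re (z - z0)| <= t by rewrite cReD /= ler_norml; lra.
  have v2 : `|Im (z - z0)| <= t by rewrite cImD /= ler_norml; lra.
  lra.
have := hr (z - z0) zz; rewrite [z0 + _]addrC subrK => h.
by rewrite -[f z](subrK (f z0)) addrC; apply: le_trans (cabsD _ _) _; rewrite lerD2l.
Qed.

End goursat.

(** * Cauchy's formula and Taylor expansion of holomorphic functions *)

Section cauchy.
Variable R : realType.
Implicit Types (f g : R[i] -> R[i]) (a b c d K : R) (z w : R[i]).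
Local Notation Re := (@complex.Re R).
Local Notation Im := (@complex.Im R).
Local Notation inv := (fun z : R[i] => z^-1).

Lemma ccont_inv z : z != 0 -> ccont inv z.
Proof. by move=> z0; apply: cdiff_ccont; exists (- (z ^- 2)); exact: cderiv_inv. Qed.

Lemma Re_inv (u v : R) : Re ((u +i* v)%C^-1) = u / (u ^+ 2 + v ^+ 2).
Proof. by []. Qed.

Lemma Im_inv (u v : R) : Im ((u +i* v)%C^-1) = - (v / (u ^+ 2 + v ^+ 2)).
Proof. by []. Qed.

Lemma pt_neq0 (u v : R) : (u != 0) || (v != 0) -> (u +i* v)%C != 0.
Proof. by rewrite eq_complex /= negb_and. Qed.

Lemma half_bound K u : 0 < K -> - K <= u <= K -> 1 / (2 * K) <= K / (u ^+ 2 + K ^+ 2).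
Proof.
move=> K0 uK; have K2 : 0 < K ^+ 2 by rewrite exprn_gt0.
have u2 : 0 <= u ^+ 2 <= K ^+ 2.
  by rewrite sqr_ge0 -[u ^+ 2]real_normK ?num_real // lerXn2r ?nnegrE ?(ltW K0) // ler_norml.
rewrite ler_pdivrMr ?mulr_gt0 // mulrAC ler_pdivlMr; last by lra.
lra.
Qed.

(** The integrand is [K / (u^2 + K^2) >= 1 / (2 K)] on a side of length 2K. The exact value is pi /
    2; a positive bound independent of K suffices. *)
Lemma Im_hint_inv_top K : 0 < K -> 1 <= Im (- hint inv K (- K) K).
Proof.
move=> K0; have ab : - K <= K by lra.
have ci : cintegrable (fun u => inv ((0 +i* K)%C + u%:C%C * 1)) (- K) K.
  by apply: hint_integrable => // u _; apply: ccont_inv; apply: pt_neq0; rewrite (gt_eqF K0) orbT.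
rewrite -mulN1r /hint -cintZ //.
have -> : (1 : R) = 1 / (2 * K) * (K - - K) by field; rewrite gt_eqF.
apply: Im_cint_ge => //; first by have [P hP] := ci; exists (fun t => -1 * P t); exact: cprimZ.
by move=> u uK; rewrite mulN1r hpt /= opprK; exact: half_bound.
Qed.

Lemma Im_hint_inv_bottom K : 0 < K -> 1 <= Im (hint inv (- K) (- K) K).
Proof.
move=> K0; have ab : - K <= K by lra.
have -> : (1 : R) = 1 / (2 * K) * (K - - K) by field; rewrite gt_eqF.
apply: Im_cint_ge => //.
  by apply: hint_integrable => // u _; apply: ccont_inv; apply: pt_neq0; rewrite oppr_eq0 (gt_eqF K0) orbT.
by move=> u uK; rewrite hpt Im_inv sqrrN mulNr opprK; exact: half_bound.
Qed.

(** The factor u turns the imaginary part of the integrand into [u^2 / (u^2 + v^2)], which treats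
    the right and left sides at once. *)
Lemma Im_vint_inv (u c d : R) : c <= d -> u != 0 ->
  Im (u%:C%C * ('i%C * vint inv u c d)) >= 0.
Proof.
move=> cd u0.
have ci : cintegrable (fun v => inv (u%:C%C + v%:C%C * 'i%C)) c d.
  by apply: vint_integrable => // v _; apply: ccont_inv; apply: pt_neq0; rewrite u0.
rewrite mulrA /vint -cintZ //.
apply: le_trans (@Im_cint_ge _ _ _ _ 0 cd _ _); first by rewrite mul0r.
  by have [P hP] := ci; exists (fun t => u%:C%C * 'i%C * P t); exact: (cprimZ (u%:C%C * 'i%C) hP).
move=> v _; rewrite vpt cImM Re_inv Im_inv /=.
rewrite !(mul0r, mulr0, mulr1, addr0, subr0, add0r, oppr0).
by rewrite mulrA -expr2 divr_ge0 ?addr_ge0 ?sqr_ge0.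
Qed.

Lemma Im_vint_right (u c d : R) : c <= d -> 0 < u -> 0 <= Im ('i%C * vint inv u c d).
Proof.
move=> cd u0; have := Im_vint_inv cd (lt0r_neq0 u0).
by case: ('i%C * _) => x y /=; rewrite mul0r addr0 pmulr_rge0.
Qed.

Lemma Im_vint_left (u c d : R) : c <= d -> u < 0 -> 0 <= Im (- ('i%C * vint inv u c d)).
Proof.
move=> cd u0; have u0' : u != 0 by rewrite lt_eqF.
have := Im_vint_inv cd u0'.
by case: ('i%C * _) => x y /=; rewrite mul0r addr0 oppr_ge0 nmulr_rge0.
Qed.

Lemma ccont_line_bounded f (c0 z : R[i]) a b : a <= b ->
  (forall t : R, a <= t <= b -> ccont f (c0 + t%:C%C * z)) ->
  exists K, forall t : R, a <= t <= b -> cabs (f (c0 + t%:C%C * z)) <= K.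
Proof.
move=> ab cf.
have cn (g : R -> R) : (forall t : R, a <= t <= b -> {for t, continuous g}) ->
    exists K, forall t : R, a <= t <= b -> `|g t| <= K.
  move=> cg; have wc : {within `[a, b], continuous g}.
    apply: continuous_in_subspaceT => t; rewrite inE /= in_itv /=; exact: cg.
  have [x1 _ h1] := EVT_max ab wc; have [x2 _ h2] := EVT_min ab wc.
  exists (`|g x1| + `|g x2|) => t tab.
  have := h1 t; have := h2 t; rewrite in_itv /= => /(_ tab) q2 /(_ tab) q1.
  rewrite ler_norml; have := ler_norm (g x1); have := ler_norm (- g x2); rewrite normrN.
  by have := normr_ge0 (g x1); have := normr_ge0 (g x2); lra.
have [K1 h1] := cn _ (fun t tab => (ccont_line (cf t tab)).1).
have [K2 h2] := cn _ (fun t tab => (ccont_line (cf t tab)).2).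
exists (K1 + K2) => t tab; apply: le_trans (cabs_le _) _.
by rewrite lerD // ?h1 ?h2.
Qed.

Lemma contB_bounded f a b c d : a <= b -> c <= d -> contB a b c d f ->
  exists2 K, 0 <= K & forall z, onB a b c d z -> cabs (f z) <= K.
Proof.
move=> ab cd cf.
have hb v : v = c \/ v = d -> exists K, forall u, a <= u <= b -> cabs (f (u +i* v)%C) <= K.
  move=> vE; have [|K hK] := @ccont_line_bounded f (0 +i* v)%C 1 a b ab.
    by move=> u uab; rewrite hpt; apply: cf; exact: onB_h.
  by exists K => u uab; rewrite -hpt hK.
have vb u : u = a \/ u = b -> exists K, forall v, c <= v <= d -> cabs (f (u +i* v)%C) <= K.
  move=> uE; have [|K hK] := @ccont_line_bounded f u%:C%C 'i%C c d cd.
    by move=> v vcd; rewrite vpt; apply: cf; exact: onB_v.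
  by exists K => v vcd; rewrite -vpt hK.
have [K1 h1] := hb c (or_introl erefl); have [K2 h2] := hb d (or_intror erefl).
have [K3 h3] := vb a (or_introl erefl); have [K4 h4] := vb b (or_intror erefl).
exists (`|K1| + `|K2| + `|K3| + `|K4|); first by rewrite !addr_ge0.
move=> [u v] [[/= uab vcd] E].
have n1 := normr_ge0 K1; have n2 := normr_ge0 K2; have n3 := normr_ge0 K3; have n4 := normr_ge0 K4.
case: E => [E|[E|[E|E]]]; rewrite {1}E.
- by apply: le_trans (h3 v vcd) _; have := ler_norm K3; lra.
- by apply: le_trans (h4 v vcd) _; have := ler_norm K4; lra.
- by apply: le_trans (h1 u uab) _; have := ler_norm K1; lra.
- by apply: le_trans (h2 u uab) _; have := ler_norm K2; lra.
Qed.

Section square.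
Variable k : R.
Hypothesis k0 : 0 < k.
Let kk : - k <= k. Proof. exact: (ge0_cp (ltW k0)).2. Qed.
Local Notation B := (onB (- k) k (- k) k).
Local Notation J f := (bint f (- k) k (- k) k).
Local Notation cB := (contB (- k) k (- k) k).

Lemma B_ge z : B z -> k <= cabs z.
Proof.
move=> [_ E]; have kN : `|k| = k by rewrite ger0_norm // ltW.
case: E => [E|[E|[E|E]]].
- by apply: le_trans (Re_le_cabs z); rewrite E normrN kN.
- by apply: le_trans (Re_le_cabs z); rewrite E kN.
- by apply: le_trans (Im_le_cabs z); rewrite E normrN kN.
- by apply: le_trans (Im_le_cabs z); rewrite E kN.
Qed.

Lemma B_neq0 z : B z -> z != 0.
Proof. by move=> /B_ge h; rewrite -cabs_gt0 (lt_le_trans k0). Qed.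

Lemma B_sub w z : cabs w < k / 2 -> B z -> k / 2 <= cabs (z - w).
Proof. by move=> wk /B_ge h; have := cabs_lerB z w; lra. Qed.

Lemma B_sub_neq0 w z : cabs w < k / 2 -> B z -> z - w != 0.
Proof.
by move=> wk /(B_sub wk) h; rewrite -cabs_gt0 (lt_le_trans _ h) // divr_gt0.
Qed.

Lemma cB_inv : cB inv.
Proof. by move=> z /B_neq0 z0; exact: ccont_inv. Qed.

Lemma cdiff_subinv w z : z - w != 0 -> cdiff (fun z => (z - w)^-1) z.
Proof.
by move=> h; apply: cdiffV => //; exact: cdiffB (cdiff_id z) (cdiff_cst w z).
Qed.

Lemma cB_subinv w : cabs w < k / 2 -> cB (fun z => (z - w)^-1).
Proof. by move=> wk z /(B_sub_neq0 wk) h; exact: cdiff_ccont (cdiff_subinv h). Qed.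

Lemma cB_M f g : cB f -> cB g -> cB (fun z => f z * g z).
Proof. by move=> hf hg z Bz; apply: ccontM; [exact: hf|exact: hg]. Qed.

Lemma cB_X f n : cB f -> cB (fun z => f z * z^-1 ^+ n).
Proof.
move=> hf z Bz; apply: ccontM (hf z Bz) _; apply: cdiff_ccont; apply: cdiffX.
by exists (- (z ^- 2)); apply: cderiv_inv; exact: B_neq0.
Qed.

(** Iterates [1 / (z - w) = 1 / z + (w / z) / (z - w)]; the expansion is finite with an exact
    remainder, so no series has to be integrated. *)
Lemma bint_cauchy_expand f w n : cB f -> cabs w < k / 2 ->
  J (fun z => f z * (z - w)^-1) = \sum_(i < n) w ^+ i * J (fun z => f z * z^-1 ^+ i.+1) +
    w ^+ n * J (fun z => f z * z^-1 ^+ n * (z - w)^-1).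
Proof.
move=> cf wk; elim: n => [|n IHn].
  rewrite big_ord0 add0r expr0 mul1r; apply: bint_eq => // [|z _].
    by apply: cB_M cf _; exact: cB_subinv.
  by rewrite expr0 mulr1.
rewrite IHn big_ord_recr /= -addrA; congr (_ + _); rewrite exprSr -mulrA -mulrDr; congr (_ * _).
rewrite -(bintZ kk kk); last by apply: cB_M; [exact: cB_X|exact: cB_subinv].
rewrite -(bintD kk kk).
- apply: bint_eq => // [|z Bz].
    by apply: cB_M; [exact: cB_X|exact: cB_subinv].
  have z0 := B_neq0 Bz; have zw := B_sub_neq0 wk Bz.
  by rewrite exprS; field; rewrite z0 zw.
- exact: cB_X.
- move=> z Bz; apply: ccontM (ccont_cst _ _) _; move: z Bz.
  by apply: cB_M; [exact: cB_X|exact: cB_subinv].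
Qed.

Lemma bint_cauchy_bound f w n K : cB f -> cabs w < k / 2 -> 0 <= K ->
  (forall z, B z -> cabs (f z) <= K) ->
  cabs (J (fun z => f z * z^-1 ^+ n * (z - w)^-1)) <=
    4 * (K * (k^-1 ^+ n) * (2 / k)) * ((k - - k) + (k - - k)).
Proof.
move=> cf wk K0 fK; apply: bint_norm => // [|z Bz].
  by apply: cB_M; [exact: cB_X|exact: cB_subinv].
rewrite !cabsM cabsX !cabsV.
have h1 : (cabs z)^-1 <= k^-1.
  by rewrite lef_pV2 ?posrE // ?B_ge // (lt_le_trans k0) // B_ge.
have h2 : (cabs (z - w))^-1 <= 2 / k.
  have := B_sub wk Bz => h; rewrite -[2 / k]invrK invf_div lef_pV2 ?posrE ?divr_gt0 //.
  by apply: lt_le_trans h; rewrite divr_gt0.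
apply: ler_pM; rewrite ?mulr_ge0 ?exprn_ge0 ?invr_ge0 ?cabs_ge0 //.
apply: ler_pM; rewrite ?exprn_ge0 ?invr_ge0 ?cabs_ge0 // ?fK //.
by rewrite lerXn2r ?nnegrE ?invr_ge0 ?cabs_ge0 // ltW.
Qed.

(** From exponent 2 on, powers of [z^-1] have primitives. The factor 1 matches [bint_cauchy_expand]
    for the constant function. *)
Lemma bint_inv_pow n : J (fun z => 1 * z^-1 ^+ n.+2) = 0.
Proof.
apply: (@bint_prim0 _ _ _ _ _ kk kk (fun z => - (n.+1%:R^-1) * z^-1 ^+ n.+1)) => z Bz.
apply: cderiv_ext (cderivZ (- (n.+1%:R^-1)) (cderiv_Xn n (B_neq0 Bz))) => //.
by rewrite mulrNN mulrA mulVf // pnatr_eq0.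
Qed.

Lemma bint_inv_neq0 : J (fun z => 1 * z^-1 ^+ 1) != 0.
Proof.
have -> : J (fun z => 1 * z^-1 ^+ 1) = J inv.
  by apply/esym; apply: bint_eq => // [|z _]; [exact: cB_inv|rewrite mul1r expr1].
suff : 0 < Im (J inv) by apply: contraTneq => ->; rewrite ltxx.
rewrite /bint mulrBr !cImD.
have h1 := Im_hint_inv_top k0; have h2 := Im_hint_inv_bottom k0.
have h3 := Im_vint_right kk k0; have h4 : 0 <= Im (- ('i%C * vint inv (- k) (- k) k)).
  by apply: Im_vint_left => //; rewrite oppr_lt0.
lra.
Qed.

(* The integral of [1 / (z - w)] is not evaluated: only its nonvanishing at [w = 0] matters. *)
Lemma cauchy_formula f w : cabs w < k / 2 ->
  (forall z, inR (- k) k (- k) k z -> cdiff f z) ->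
  J (fun z => f z * (z - w)^-1) = f w * J (fun z => 1 * (z - w)^-1).
Proof.
move=> wk fd.
have iw : - k < Re w < k /\ - k < Im w < k.
  by have := Re_le_cabs w; have := Im_le_cabs w; rewrite !ler_norml; lra.
have [l hl] : cdiff f w.
  by apply: fd; case: iw => /andP[? ?] /andP[? ?]; split; apply/andP; split; exact: ltW.
(* The difference quotient, completed by the derivative at w: continuous there and differentiable
   elsewhere, as [goursat_except] requires. *)
pose g z := if z == w then l else (f z - f w) * (z - w)^-1.
have gE z : z != w -> cdiff f z -> cdiff g z.
  move=> zw fz; have zw0 : 0 < cabs (z - w) by rewrite cabs_gt0 subr_eq0.
  apply: (@cdiff_near _ (fun z => (f z - f w) * (z - w)^-1) g z _ zw0).
    move=> h hz; rewrite /g ifF //; apply/negbTE; apply: contraTneq hz => E.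
    by rewrite -leNgt -E opprD addNKr cabsN.
  apply: cdiffM; first exact: cdiffB fz (cdiff_cst _ _).
  by apply: cdiff_subinv; rewrite subr_eq0.
have gw : ccont g w.
  move=> e e0; have [d d0 h] := hl e e0; exists d => // u ud.
  have gww : g w = l by rewrite /g eqxx.
  have [->|u0] := eqVneq u 0; first by rewrite addr0 subrr cabs0 ltW.
  have U0 : 0 < cabs u by rewrite cabs_gt0.
  rewrite gww /g ifF; last by rewrite -subr_eq0 addrAC subrr add0r (negbTE u0).
  have := h u u0 ud; rewrite -ler_pdivrMr // -cabsV -cabsM.
  by rewrite [w + u - w]addrAC subrr add0r mulrBl mulfK.
have Jg : J g = 0.
  apply: (@goursat_except _ g _ _ _ _ w iw.1 iw.2) => [z iz|z iz zw]; last exact: gE (fd z iz).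
  have [->//|zw] := eqVneq z w; exact: cdiff_ccont (gE z zw (fd z iz)).
have cf : cB f by move=> z [iz _]; exact: cdiff_ccont (fd z iz).
have c1 : cB (fun z => f z * (z - w)^-1) by apply: cB_M cf _; exact: cB_subinv.
have c2 : cB (fun z => 1 * (z - w)^-1).
  by apply: cB_M (cB_subinv wk) => z _; exact: ccont_cst.
apply/eqP; rewrite -subr_eq0 -mulNr; apply/eqP; rewrite -[RHS]Jg.
rewrite -(bintZ kk kk _ c2) -(bintD kk kk c1); last first.
  by move=> z Bz; apply: ccontM (ccont_cst _ _) (c2 z Bz).
apply: bint_eq => // [z Bz|z Bz].
  by apply: ccontD (c1 z Bz) _; apply: ccontM (ccont_cst _ _) (c2 z Bz).
rewrite /g ifF; last by rewrite -subr_eq0; exact/negbTE/B_sub_neq0.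
by ring.
Qed.

End square.

(** Both sides of [cauchy_formula] are expanded in w. On the side of the constant function only the
    first term [W] survives; dividing by it leaves the Taylor polynomial and remainders of order n +
    1. *)
Theorem holo_taylor f (r : R) n : 0 < r -> (forall z, cabs z < r -> cdiff f z) ->
  exists (a : nat -> R[i]) (C d : R), [/\ 0 < d, 0 <= C &
    forall z, cabs z < d -> cabs (f z - \sum_(i < n.+1) a i * z ^+ i) <= C * cabs z ^+ n.+1].
Proof.
(* Points of the square of half-side k have modulus at most 2k < r. *)
move=> r0 fd; pose k := r / 3; have k0 : 0 < k by rewrite divr_gt0.
have kk : - k <= k by lra.
have fR z : inR (- k) k (- k) k z -> cdiff f z.
  move=> [/andP[? ?] /andP[? ?]]; apply: fd; apply: le_lt_trans (cabs_le _) _.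
  have h1 : `|Re z| <= k by rewrite ler_norml; apply/andP.
  have h2 : `|Im z| <= k by rewrite ler_norml; apply/andP.
  by move: h1 h2; rewrite /k; lra.
have cf : contB (- k) k (- k) k f by move=> z [iz _]; exact: cdiff_ccont (fR z iz).
have c1 : contB (- k) k (- k) k (fun=> 1) by move=> z _; exact: ccont_cst.
have [K K0 fK] := contB_bounded kk kk cf.
have f0c : ccont f 0 by apply: cdiff_ccont; apply: fd; rewrite cabs0.
have [d1 d10 h1] := f0c 1 ltr01.
pose W := bint (fun z => 1 * z^-1 ^+ 1) (- k) k (- k) k.
have W0 : W != 0 := bint_inv_neq0 k0.
have Wp : 0 < cabs W by rewrite cabs_gt0.
(* [W] stands for 2 pi i in the usual coefficient formula. *)
pose a i := bint (fun z => f z * z^-1 ^+ i.+1) (- k) k (- k) k / W.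
pose E (K : R) := 4 * (K * (k^-1 ^+ n.+1) * (2 / k)) * ((k - - k) + (k - - k)).
have E0 (K' : R) : 0 <= K' -> 0 <= E K'.
  by move=> K'0; rewrite /E !mulr_ge0 ?exprn_ge0 ?invr_ge0 ?(ltW k0) //; lra.
pose C := (E K + (cabs (f 0) + 1) * E 1) / cabs W.
exists a, C, (Num.min (k / 2) d1); split; first by rewrite lt_min divr_gt0.
  by rewrite divr_ge0 ?cabs_ge0 // addr_ge0 ?E0 // mulr_ge0 ?E0 // addr_ge0 ?cabs_ge0.
move=> z; rewrite lt_min => /andP[zk zd].
have e1 := bint_cauchy_expand k0 n.+1 cf zk.
have e2 := bint_cauchy_expand k0 n.+1 c1 zk.
have b1 := bint_cauchy_bound k0 n.+1 cf zk K0 fK.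
have b2 := bint_cauchy_bound k0 n.+1 c1 zk ler01 (fun z _ => eq_ind_r (fun v => v <= 1) (lexx 1) (cabs1 R)).
have := cauchy_formula k0 zk fR; rewrite e1 e2.
rewrite [\sum_(i < n.+1) z ^+ i * bint (fun z => 1 * _) _ _ _ _]big_ord_recl expr0 mul1r -/W.
rewrite [\sum_(i < n) _]big1 ?addr0; last first.
  by move=> i _; have := bint_inv_pow k0 i; rewrite lift0 => ->; rewrite mulr0.
move: b1 b2; rewrite -/(E K) -/(E 1); set E1 := bint _ _ _ _ _; set E2 := bint _ _ _ _ _.
move=> b1 b2 main.
have fz : cabs (f z) <= cabs (f 0) + 1.
  have := h1 z zd; rewrite add0r => h; rewrite -[f z](subrK (f 0)) addrC.
  by apply: le_trans (cabsD _ _) _; rewrite lerD2l.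
have -> : f z - \sum_(i < n.+1) a i * z ^+ i = z ^+ n.+1 * ((E1 - f z * E2) / W).
  have -> : \sum_(i < n.+1) a i * z ^+ i = (\sum_(i < n.+1) z ^+ i * bint (fun z => f z * z^-1 ^+ i.+1) (- k) k (- k) k) / W.
    by rewrite mulr_suml; apply: eq_bigr => i _; rewrite /a mulrC mulrA.
  move: main; move: (\sum_(i < n.+1) _) => S main.
  have -> : S = f z * (W + z ^+ n.+1 * E2) - z ^+ n.+1 * E1 by rewrite -main addrK.
  by field.
rewrite cabsM cabsX mulrC ler_wpM2r ?exprn_ge0 ?cabs_ge0 // cabsM cabsV /C.
rewrite ler_wpM2r ?invr_ge0 ?cabs_ge0 //.
apply: le_trans (cabsB _ _) _; rewrite cabsM lerD //.
by apply: ler_pM; rewrite ?cabs_ge0.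
Qed.

End cauchy.

(** * From the extension back to positivity *)

Section converse.
Variable R : realType.
Implicit Types (U : set R) (F G : R[i] -> R[i]) (p B : {poly R}) (z w s : R[i]).
Local Notation Re := (@complex.Re R).
Local Notation Im := (@complex.Im R).
Local Notation toC := (map_poly (fun x : R => x%:C%C)).

Lemma slit_planeP U z : Im z != 0 \/ U (Re z) -> slit_plane U z.
Proof. by move=> + [y Uy zE]; rewrite -zE /= eqxx; case. Qed.

Lemma cint_approx (f h : R -> R[i]) c (a b eta : R) : a <= b ->
  cintegrable f a b -> cintegrable h a b ->
  (forall t : R, a <= t <= b -> cabs (f t - c * h t) <= eta) ->
  cabs (cint f a b - c * cint h a b) <= 2 * eta * (b - a).
Proof.
move=> ab hf hh fh; have [P hP] := hf; have [Q hQ] := hh.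
have hQ' := cprimZ (- c) hQ.
rewrite -mulNr -cintZ // -cintD //; last by exists (fun t => - c * Q t).
apply: cint_norm => // [|t tab]; last by rewrite mulNr; exact: fh.
by exists (fun t => P t + - c * Q t); exact: cprimD.
Qed.

(** On the top and vertical sides f is close to b / z. The imaginary part of the integral of 1 / z
    over them is at least 1, already from the top. Since the full integral is 0, the bottom must
    compensate, yet its imaginary part is at least [- 2 delta K]. *)
Lemma contour_residue_le f (b e K eta delta : R) : 0 < e -> e <= K -> 0 <= b -> 0 <= eta ->
  (forall z, inR (- K) K e K z -> cdiff f z) ->
  (forall z, onB (- K) K e K z -> K <= cabs z -> cabs (f z - b%:C%C * z^-1) <= eta) ->
  (forall u : R, - K <= u <= K -> - delta <= Im (f (u +i* e)%C)) ->
  b <= 2 * delta * K + 8 * eta * K.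
Proof.
move=> e0 eK b0 eta0 fd fb fe; have K0 : 0 < K by lra.
have KK : - K <= K by lra.
have cf : contB (- K) K e K f by move=> z [iz _]; exact: cdiff_ccont (fd z iz).
have ci : contB (- K) K e K (fun z => z^-1).
  move=> [u v] [[_ /andP[/= ev _]] _]; apply: ccont_inv; apply: pt_neq0.
  by rewrite orbC gt_eqF // (lt_le_trans e0).
have Ke (v : R) : e <= v <= K -> K <= cabs (K +i* v)%C /\ K <= cabs (- K +i* v)%C.
  move=> _; have := Re_le_cabs (K +i* v)%C; have := Re_le_cabs (- K +i* v)%C.
  by rewrite /= normrN ger0_norm ?(ltW K0).
have hA : cabs (hint f K (- K) K - b%:C%C * hint (fun z => z^-1) K (- K) K) <= 2 * eta * (K - - K).
  apply: cint_approx => //.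
  - by apply: contB_h cf _; auto.
  - exact: (@contB_h _ (- K) K e K KK eK (fun z => z^-1) K ci (or_intror erefl)).
  move=> u uK; rewrite hpt; apply: fb; first by apply: onB_h; auto.
  by apply: le_trans (Im_le_cabs _); rewrite /= ger0_norm ?(ltW K0).
have hV (u : R) : u = - K \/ u = K ->
    cabs (vint f u e K - b%:C%C * vint (fun z => z^-1) u e K) <= 2 * eta * (K - e).
  move=> uE; apply: cint_approx => //; first exact: contB_v cf _.
    exact: (@contB_v _ (- K) K e K KK eK (fun z => z^-1) u ci uE).
  move=> v veK; rewrite vpt; apply: fb; first exact: onB_v.
  by have [h1 h2] := Ke v veK; case: uE => ->.
have hB : - delta * (K - - K) <= Im (hint f e (- K) K).
  apply: Im_cint_ge => // [|u uK]; last by rewrite hpt fe.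
  by apply: contB_h cf _; auto.
have := goursat KK eK fd; rewrite /bint mulrBr => J0.
have t1 := Im_hint_inv_top K0.
have t2 := Im_vint_right eK K0.
have t3 : 0 <= Im (- ('i%C * vint (fun z => z^-1) (- K) e K)) by apply: Im_vint_left; rewrite ?oppr_lt0.
have v1 := hV K (or_intror erefl); have v2 := hV (- K) (or_introl erefl).
move: hB J0 t1 t2 t3 v1 v2 hA.
set hb := hint f e _ _; set hK := hint f K _ _; set vr := vint f K _ _; set vl := vint f (- K) _ _.
set iK := hint _ K _ _; set ir := vint _ K _ _; set il := vint _ (- K) _ _.
move=> hB J0 t1 t2 t3 /(le_trans (Re_le_cabs _)) v1 /(le_trans (Re_le_cabs _)) v2 /(le_trans (Im_le_cabs _)) hA.
have {}J0 := congr1 Im J0; move: J0 t1 t2 t3 v1 v2 hA hB.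
case: hb hK vr vl iK ir il => [hb1 hb2] [hK1 hK2] [r1 r2] [l1 l2] [a1 a2] [c1 c2] [d1 d2] /=.
rewrite !(mul0r, mul1r, add0r, addr0, subr0, sub0r) !ler_norml => J0 t1 t2 t3.
move=> /andP[v1 _] /andP[_ v2] /andP[_ hA] hB.
have q1 : b * 1 <= b * - a2 by rewrite ler_wpM2l.
have q2 : 0 <= b * c1 by rewrite mulr_ge0.
have q3 : 0 <= b * - d1 by rewrite mulr_ge0.
have q4 : 0 <= eta * e by rewrite mulr_ge0 // ltW.
nra.
Qed.

Lemma poly_lipschitz (p : {poly R[i]}) (M : R) : exists2 L : R, 0 <= L &
  forall z w, cabs z <= M -> cabs w <= M ->
    cabs p.[z] <= L /\ cabs (p.[z] - p.[w]) <= L * cabs (z - w).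
Proof.
have [M0|M0] := leP 0 M; last first.
  by exists 0 => // z w zM; have := cabs_ge0 z; lra.
elim/poly_ind: p => [|p c [L L0 IHp]].
  by exists 0 => // z w _ _; rewrite !horner0 subrr cabs0 mul0r.
exists (L * M + L + cabs c) => [|z w zM wM].
  by rewrite !addr_ge0 ?mulr_ge0 ?cabs_ge0.
rewrite !hornerMXaddC; have [h1 h2] := IHp z w zM wM; split.
  apply: le_trans (cabsD _ _) _; rewrite lerD2r cabsM.
  by rewrite ler_wpDr // ler_pM ?cabs_ge0.
have -> : p.[z] * z + c - (p.[w] * w + c) = p.[z] * (z - w) + (p.[z] - p.[w]) * w by ring.
apply: le_trans (cabsD _ _) _; rewrite !cabsM mulrDl.
have n0 := cabs_ge0 (z - w).
apply: le_trans (_ : L * cabs (z - w) + L * cabs (z - w) * M <= _).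
  by rewrite lerD // ?ler_wpM2r // ler_pM ?cabs_ge0.
have : 0 <= cabs c * cabs (z - w) by rewrite mulr_ge0 ?cabs_ge0.
lra.
Qed.

(** The polynomial part [B] has real coefficients, hence is real on the real axis and has small
    imaginary part on a bottom side close to it. *)
Definition residue G (b : R) := exists B (C K0 : R), [/\ 0 <= C, 0 < K0 &
  forall s, K0 <= cabs s -> cabs (G s - (toC B).[s] - b%:C%C * s^-1) <= C / cabs s ^+ 2].

Lemma residueD G H b c : residue G b -> residue H c -> residue (fun s => G s + H s) (b + c).
Proof.
move=> [B [C [K [C0 K0 h]]]] [B' [C' [K' [C'0 K'0 h']]]].
exists (B + B'), (C + C'), (Num.max K K'); split; rewrite ?addr_ge0 ?lt_max ?K0 // => s.
rewrite ge_max => /andP[/h hs /h' hs'].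
rewrite mulrDl; apply: le_trans (lerD hs hs'); apply: le_trans (cabsD _ _).
by rewrite !rmorphD hornerD mulrDl /=; rewrite le_eqVlt; apply/orP; left; apply/eqP/congr1; ring.
Qed.

Lemma residueZ G b (c : R) : residue G b -> residue (fun s => c%:C%C * G s) (c * b).
Proof.
move=> [B [C [K [C0 K0 h]]]]; exists (c *: B), (`|c| * C), K; split => // [|s /h hs].
  by rewrite mulr_ge0.
rewrite -mulrA; apply: le_trans (ler_wpM2l (normr_ge0 c) hs).
rewrite -cabsR -cabsM map_polyZ hornerZ rmorphM /=; rewrite le_eqVlt; apply/orP; left; apply/eqP/congr1; ring.
Qed.

Lemma residue_eq G H b : (forall s, G s = H s) -> residue G b -> residue H b.
Proof.
by move=> GH [B [C [K [C0 K0 h]]]]; exists B, C, K; split=> // s /h; rewrite GH.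
Qed.

Lemma residue_mom G m : (forall j, residue (fun s => G s * s ^+ j) (m j)) ->
  forall p, residue (fun s => G s * (toC p).[s]) (mom m p).
Proof.
move=> h p; rewrite /mom.
have: residue (fun s => \sum_(i < size p) ((p`_i)%:C%C * (G s * s ^+ i))) (\sum_(i < size p) p`_i * m i).
  elim: (size p) => [|n IHn].
    exists 0, 0, 1; split=> // s _; rewrite big_ord0 rmorph0 horner0 !subr0 big_ord0.
    by rewrite mul0r subrr cabs0 mul0r.
  rewrite big_ord_recr /=; apply: residue_eq (residueD IHn (residueZ (p`_n) (h n))) => s.
  by rewrite big_ord_recr.
apply: residue_eq => s; rewrite horner_coef size_map_poly mulr_sumr.
by apply: eq_bigr => i _; rewrite coef_map /=; ring.
Qed.

Section taylor.
Variables (U : set R) (phi : R -> R) (F : R[i] -> R[i]) (x : R).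
Hypotheses (openU : open U) (sphi : smooth U phi) (Ux : U x).
Hypothesis holF : holomorphic_on (slit_plane U) F.
Hypothesis Fphi : forall x : R, U x -> F (x%:C%C) = (phi x)%:C%C.

Lemma extension_cdiff z : Im z != 0 \/ U (Re z) -> cdiff F z.
Proof. by move=> /slit_planeP /holF /cderivP. Qed.

(** On the real axis the holomorphic expansion is one of phi: uniqueness gives the real parts of its
    coefficients, and the imaginary parts form a polynomial of too high order, so they vanish. *)
Lemma extension_taylor n : exists C d : R, [/\ 0 < d, 0 <= C & forall w, cabs w < d ->
  cabs (F (x%:C%C + w) - \sum_(i < n.+1) (tcoef phi x i)%:C%C * w ^+ i) <= C * cabs w ^+ n.+1].
Proof.
have [r r0 Ur] := open_dist openU Ux.
have [|a [C [d [d0 C0 h]]]] := @holo_taylor _ (fun w => F (x%:C%C + w)) r n r0.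
  move=> w wr; apply: cdiff_comp; first exact: cdiffD (cdiff_cst _ _) (cdiff_id _).
  apply: extension_cdiff; have [w0|w0] := eqVneq (Im w) 0; last by left; rewrite cImD add0r.
  by right; rewrite cReD; apply: Ur; apply: le_lt_trans wr; exact: Re_le_cabs.
have Fa (t : R) : `|t| < Num.min d r ->
    cabs ((phi (x + t))%:C%C - \sum_(i < n.+1) a i * t%:C%C ^+ i) <= C * `|t| ^+ n.+1.
  rewrite lt_min => /andP[td tr]; have := h t%:C%C; rewrite cabsR -rmorphD Fphi; last exact: Ur.
  exact.
have re (t : R) : Re (\sum_(i < n.+1) a i * t%:C%C ^+ i) = (\poly_(i < n.+1) Re (a i)).[t].
  rewrite horner_poly (raddf_sum (@complex.Re R)); apply: eq_bigr => i _.
  by rewrite -rmorphXn; case: (a i) => u v /=; rewrite mulr0 subr0.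
have im (t : R) : Im (\sum_(i < n.+1) a i * t%:C%C ^+ i) = (\poly_(i < n.+1) Im (a i)).[t].
  rewrite horner_poly (raddf_sum (@complex.Im R)); apply: eq_bigr => i _.
  by rewrite -rmorphXn; case: (a i) => u v /=; rewrite mulr0 add0r.
have aE i : (i < n.+1)%N -> a i = (tcoef phi x i)%:C%C.
  move=> ilt; have dr0 : 0 < Num.min d r by rewrite lt_min d0 r0.
  have O1 : bigO n.+1 (fun t => phi (x + t) - (\poly_(i < n.+1) Re (a i)).[t]).
    exists C, (Num.min d r); split=> // t _ /Fa ht.
    apply: le_trans ht; apply: le_trans (Re_le_cabs _).
    by rewrite raddfB -re /=.
  have O2 : bigO n.+1 (horner (\poly_(i < n.+1) Im (a i))).
    exists C, (Num.min d r); split=> // t _ /Fa ht.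
    apply: le_trans ht; apply: le_trans (Im_le_cabs _).
    by rewrite raddfB -im /= sub0r normrN.
  have := taylor_unique openU sphi Ux O1 ilt; rewrite coef_poly ilt => E.
  have := bigO_poly_coef O2 ilt; rewrite coef_poly ilt => E'.
  rewrite /tcoef E mulfK ?pnatr_eq0 -?lt0n ?fact_gt0 //.
  by move: E'; case: (a i) => u v /= ->.
exists C, d; split=> // w /h; congr (cabs (_ - _) <= _).
by apply: eq_bigr => i _; rewrite aE.
Qed.

(** Put w = 1/s in the expansion of order j + 1 and multiply by [s^j]: the terms i <= j form the
    polynomial part, and i = j + 1 gives the coefficient of 1/s, which is why the moments start at
    the first derivative. *)
Lemma residue_extension j :
  residue (fun s => F (x%:C%C + s^-1) * s ^+ j) (hmom phi x j).
Proof.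
have [C [d [d0 C0 h]]] := extension_taylor j.+1.
exists (\poly_(i < j.+1) tcoef phi x (j - i)), C, (2 / d); split=> //; first by rewrite divr_gt0.
move=> s sK; have S0 : 0 < cabs s by rewrite (lt_le_trans _ sK) // divr_gt0.
have s0 : s != 0 by rewrite -cabs_gt0.
have sd : cabs s^-1 < d.
  rewrite cabsV invf_plt ?posrE //; apply: lt_le_trans sK.
  by rewrite ltr_pMl ?invr_gt0 // ltr1n.
have := h _ sd; rewrite big_ord_recr /= cabsV.
have -> : (toC (\poly_(i < j.+1) tcoef phi x (j - i))).[s] =
    s ^+ j * \sum_(i < j.+1) (tcoef phi x i)%:C%C * s^-1 ^+ i.
  rewrite poly_def rmorph_sum /= horner_sum mulr_sumr (reindex_inj rev_ord_inj) /=.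
  apply: eq_bigr => i _; have ij : (i <= j)%N by rewrite -ltnS.
  rewrite map_polyZ map_polyXn hornerZ hornerXn subSS subKn //.
  have -> : s ^+ j = s ^+ (j - i) * s ^+ i by rewrite -exprD subnK.
  by rewrite exprVn; field; rewrite expf_neq0.
move=> /(ler_wpM2l (ltW (exprn_gt0 j S0))); rewrite -(cabsX s j) -cabsM.
have -> : cabs (s ^+ j) * (C * (cabs s)^-1 ^+ j.+2) = C / cabs s ^+ 2.
  rewrite cabsX !exprVn; have -> : j.+2 = (j + 2)%N by rewrite addn2.
  by rewrite exprD; field; rewrite expf_neq0 ?gt_eqF.
apply: le_trans; rewrite le_eqVlt; apply/orP; left; apply/eqP/congr1.
rewrite /hmom mulrBr mulrDr opprD addrA [F _ * _]mulrC; congr (_ - _ - _).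
by rewrite exprVn exprS; field; rewrite s0 expf_neq0.
Qed.

Hypothesis F_upper : forall z, 0 < Im z -> 0 < Im (F z).

(* The residue of [F (x - 1/s) * p (- s) ^+ 2] at infinity is [- mom (p ^+ 2)].
   On the bottom [Im s = e] of a rectangle, [2 * 'i * e - s] is the conjugate of
   [- s], so replacing one factor [p (- s)] by [p (2 * 'i * e - s)] makes the
   integrand [F (x - 1/s) * cabs (p (- s)) ^+ 2] there. *)
Theorem extension_psd n : psd (hmom phi x) n.
Proof.
move=> p _; set P := toC p; rewrite leNgt; apply/negP => mom_lt0.
pose b := - mom (hmom phi x) (p ^+ 2); have b0 : 0 < b by rewrite oppr_gt0.
have [B [C [K0 [C0 K00 hB]]]] := residue_mom residue_extension (p ^+ 2).
have [C1 [d [d0 C10 hd]]] := extension_taylor 0.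
pose N := cabs (tcoef phi x 0)%:C%C + C1 * d.
have N0 : 0 <= N by rewrite addr_ge0 ?cabs_ge0 // mulr_ge0 // ltW.
(* Beyond this radius both the expansion at infinity and the bound [N] on F are available. *)
pose K1 := Num.max K0 (2 / d); have K10 : 0 < K1 by rewrite lt_max K00.
have FN s : K1 <= cabs s -> cabs (F (x%:C%C + s^-1)) <= N.
  rewrite ge_max => /andP[_ sK].
  have sd : cabs s^-1 < d.
    have S0 : 0 < cabs s by rewrite (lt_le_trans _ sK) // divr_gt0.
    rewrite cabsV invf_plt ?posrE //; apply: lt_le_trans sK.
    by rewrite ltr_pMl ?invr_gt0 // ltr1n.
  have := hd _ sd; rewrite big_ord1 expr0 mulr1 expr1 => h.
  have -> : F (x%:C%C + s^-1) = (tcoef phi x 0)%:C%C + (F (x%:C%C + s^-1) - (tcoef phi x 0)%:C%C) by ring.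
  apply: le_trans (cabsD _ _) _; rewrite lerD2l; apply: le_trans h _.
  by rewrite ler_wpM2l // ltW.
have main K : K1 <= K -> b <= 8 * C / K.
  move=> K1K; have Kp : 0 < K by lra.
  (* The radius 4K covers both arguments of [P], as [|s| <= 2 K] and [2 e < 2 K]. *)
  have [L L0 hL] := poly_lipschitz P (4 * K).
  have [L' L'0 hL'] := poly_lipschitz (toC B) (4 * K).
  (* K is fixed and e tends to 0: this removes the error of the reflected factor and the imaginary
     part of [B] on the bottom side. *)
  rewrite -subr_le0; apply: (@small_le0 _ _ (2 * L' * K + 16 * N * L ^+ 2 * K) K) => // e e0 eK.
  pose f s := F (x%:C%C + (- s)^-1) * (P.[- s] * P.[(0 +i* (2 * e))%C - s]) - (toC B).[- s].
  have inK s : inR (- K) K e K s -> cabs s <= 2 * K.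
    move=> [/andP[? ?] /andP[? ?]]; apply: le_trans (cabs_le _) _.
    have h1 : `|Re s| <= K by rewrite ler_norml; apply/andP.
    have h2 : `|Im s| <= K by rewrite ler_norml; lra.
    lra.
  have c2e : cabs (0 +i* (2 * e))%C <= 2 * e.
    by apply: le_trans (cabs_le _) _; rewrite /= normr0 add0r ger0_norm; lra.
  have ims s : inR (- K) K e K s -> 0 < Im ((- s)^-1).
    case: s => u v [_ /andP[sv _]]; have ev : e <= v := sv.
    rewrite (_ : - (u +i* v)%C = (- u +i* - v)%C) // Im_inv.
    rewrite !sqrrN mulNr opprK divr_gt0 //; first by lra.
    by rewrite ltr_wpDl ?sqr_ge0 // exprn_gt0 //; lra.
  have := @contour_residue_le f b e K (C / K ^+ 2 + 2 * N * L ^+ 2 * e) (L' * e) e0 (ltW eK) (ltW b0).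
  have -> : b - 8 * C / K <= (2 * L' * K + 16 * N * L ^+ 2 * K) * e =
      (b <= 2 * (L' * e) * K + 8 * (C / K ^+ 2 + 2 * N * L ^+ 2 * e) * K).
    rewrite lerBlDr; congr (_ <= _); field; exact: lt0r_neq0.
  apply.
  - by rewrite addr_ge0 ?divr_ge0 ?exprn_ge0 ?mulr_ge0 ?exprn_ge0 ?(ltW Kp) ?(ltW e0).
  - move=> s sR.
    have s0 : - s != 0.
      by apply: contraTneq (ims _ sR) => ->; rewrite invr0 ltxx.
    have oppd : cdiff (fun s => - s) s.
      by have [l hl] := cdiffB (cdiff_cst 0 s) (cdiff_id s); exists l; apply: cderiv_ext hl => // w; rewrite sub0r.
    apply: cdiffB; last exact: cdiff_comp oppd (cdiff_poly _ _).
    apply: cdiffM.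
      apply: cdiff_comp; first by apply: cdiffD (cdiff_cst _ _) _; exact: cdiffV.
      by apply: extension_cdiff; left; rewrite cImD add0r gt_eqF // ims.
    apply: cdiffM; first exact: cdiff_comp oppd (cdiff_poly _ _).
    by apply: cdiff_comp (cdiff_poly _ _); exact: cdiffB (cdiff_cst _ _) (cdiff_id _).
  - move=> s [sR _] sK.
    have sK1 : K1 <= cabs (- s) by rewrite cabsN; lra.
    have s4 : cabs (- s) <= 4 * K by rewrite cabsN; have := inK s sR; lra.
    have s4' : cabs ((0 +i* (2 * e))%C - s) <= 4 * K.
      by apply: le_trans (cabsB _ _) _; have := inK s sR; lra.
    have h1 : K0 <= cabs (- s) by apply: le_trans sK1; rewrite le_max lexx.
    have h2 := hB _ h1; have h3 := FN _ sK1.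
    have [h4 h5] := hL _ _ s4' s4; have [h6 _] := hL _ _ s4 s4.
    have -> : f s - b%:C%C / s = F (x%:C%C + (- s)^-1) * (toC (p ^+ 2)).[- s] - (toC B).[- s] -
        (mom (hmom phi x) (p ^+ 2))%:C%C * (- s)^-1 +
        F (x%:C%C + (- s)^-1) * (P.[- s] * (P.[(0 +i* (2 * e))%C - s] - P.[- s])).
      by rewrite /f /b rmorphXn /= horner_exp -/P rmorphN /= invrN; ring.
    apply: le_trans (cabsD _ _) _; apply: lerD.
      apply: le_trans h2 _; rewrite cabsN ler_wpM2l // lef_pV2 ?posrE ?exprn_gt0 //; last by lra.
      by rewrite lerXn2r ?nnegrE ?cabs_ge0 // ltW.
    rewrite !cabsM.
    have -> : 2 * N * L ^+ 2 * e = N * (L * (L * (2 * e))) by ring.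
    apply: ler_pM; rewrite ?mulr_ge0 ?cabs_ge0 //.
    apply: ler_pM; rewrite ?cabs_ge0 //; apply: le_trans h5 _.
    by rewrite ler_wpM2l // opprK subrK.
  move=> u uK; set s := (u +i* e)%C.
  have sR : inR (- K) K e K s by split; rewrite //= lexx (ltW eK).
  have cs : (0 +i* (2 * e))%C - s = conjc (- s).
    by apply/eqP; rewrite eq_complex /= sub0r eqxx /=; apply/eqP; ring.
  have cP w : P.[conjc w] = conjc P.[w].
    rewrite -horner_map /P -map_poly_comp; congr (_.[_]).
    by apply/polyP => i; rewrite !coef_map /= oppr0.
  have sN : cabs (- s) <= 4 * K by rewrite cabsN; have := inK s sR; lra.
  have uN : cabs (- u)%:C%C <= 4 * K.
    by rewrite cabsR normrN; have : `|u| <= K by [rewrite ler_norml]; lra.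
  have [_ hB'] := hL' _ _ sN uN.
  have imF : 0 < Im (F (x%:C%C + (- s)^-1)) by apply: F_upper; rewrite cImD add0r ims.
  have BR : Im (toC B).[(- u)%:C%C] = 0 by rewrite horner_map.
  have hB2 : `|Im (toC B).[- s]| <= L' * e.
    have -> : Im (toC B).[- s] = Im ((toC B).[- s] - (toC B).[(- u)%:C%C]) by rewrite raddfB /= BR subr0.
    apply: le_trans (Im_le_cabs _) _; apply: le_trans hB' _; rewrite ler_wpM2l //.
    apply: le_trans (cabs_le _) _; rewrite /= opprK addNr normr0 add0r oppr0 addr0 normrN.
    by rewrite ger0_norm // ltW.
  have -> : Im (f s) = Im (F (x%:C%C + (- s)^-1) * (P.[- s] * conjc P.[- s])) - Im (toC B).[- s].
    by rewrite /f raddfB /= cs cP.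
  have : 0 <= Im (F (x%:C%C + (- s)^-1) * (P.[- s] * conjc P.[- s])).
    case: (F _) imF => a1 a2 /= imF; case: (P.[_]) => c1 c2 /=.
    have -> : c1 * - c2 + c2 * c1 = 0 by ring.
    rewrite mulr0 add0r mulr_ge0 ?(ltW imF) //.
    by rewrite mulrN opprK addr_ge0 // -expr2 sqr_ge0.
  by move: hB2; rewrite ler_norml; lra.
suff: b <= 0 by rewrite leNgt b0.
(* Now K tends to infinity, with t = 1/K. *)
apply: (@small_le0 _ b (8 * C) K1^-1) => [|t t0 tK]; first by rewrite invr_gt0.
by rewrite -[t in leRHS]invrK; apply: main; rewrite -[K1]invrK lef_pV2 ?posrE ?invr_gt0 // ltW.
Qed.

End taylor.

End converse.

(** * The equivalence *)

Lemma diffeo_derive_gt0 (R : realType) (U : set R) (phi : R -> R) x : open U ->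
  increasing_diffeo U phi -> U x -> 0 < derive1 phi x.
Proof.
move=> oU [incr sphi [g [sg gphi]]] Ux.
have dphi y : U y -> derivable phi y 1 by move=> /sphi /(_ 1%N) [].
have [_ dg] : nderivable 1 g (phi x) by apply: sg; exists x.
(* Monotonicity gives only a nonnegative derivative; the differentiable inverse excludes 0. *)
have := derive1_comp (dphi x Ux) dg.
have -> : derive1 (g \o phi) x = 1.
  rewrite derive1E (@near_eq_derive _ _ _ _ id) ?derive_id //.
  by apply: filterS (open_nbhs_nbhs (conj oU Ux)) => y /gphi.
rewrite lt_def => gf; apply/andP; split.
  by apply/eqP => p0; move: gf; rewrite p0 mulr0 => /eqP; rewrite oner_eq0.
apply: (@incr_derive1_ge0 _ _ U).
- by move=> y; rewrite inE => /interior_subset /dphi.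
- by move=> y z; rewrite !inE; exact: incr.
- exact: open_nbhs_nbhs (conj oU Ux).
Qed.

Lemma Pinfty_schwarzian (R : realType) (U : set R) (phi : R -> R) :
  smooth_on U phi -> (forall x, U x -> derive1 phi x != 0) ->
  Pinfty U phi <-> forall x, U x -> forall k, (0 < k)%N ->
    exists2 s, is_schwarzian k phi x s & 0 <= s.
Proof.
move=> sphi dphi; split=> [h x Ux k k0|h d _ x Ux].
  have [_ _ hk] := h k k0 x Ux; have [|s [? ?]] := hk k; first by rewrite k0 leqnn.
  by exists s.
split; [exact: sphi|exact: dphi|move=> k /andP[k0 _]].
by have [s ? ?] := h x Ux k k0; exists s.
Qed.

Theorem proposition1 (R : realType) (U : set R) (phi : R -> R)
    (openU : open U) (itvU : is_interval U)
    (phi_diffeo : increasing_diffeo U phi) :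
  Pinfty U phi <->
  exists F : R[i] -> R[i],
    [/\ holomorphic_on (slit_plane U) F,
        (forall x : R, U x -> F (x%:C%C) = (phi x)%:C%C) &
        (forall z : R[i], 0 < complex.Im z -> 0 < complex.Im (F z))].
Proof.
have dphi x (Ux : U x) : 0 < derive1 phi x := diffeo_derive_gt0 openU phi_diffeo Ux.
have [incr sonphi _] := phi_diffeo; have sphi : smooth U phi by apply/(smooth_onP phi openU).
have dphi0 x (Ux : U x) : derive1 phi x != 0 := lt0r_neq0 (dphi x Ux).
apply: iff_trans (Pinfty_schwarzian sonphi dphi0) _; split=> [h|[F [Fhol Fphi Fim]] x Ux].
  have [[x0 Ux0]|U0] := pselect (exists x, U x).
    apply: (psd_extension openU itvU Ux0 sphi incr dphi) => x Ux.
    by apply/(schwarzian_psd openU sphi Ux (dphi x Ux)); exact: h.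
  (* For empty U there is no base point; the identity preserves the upper half-plane. *)
  exists id; split=> // x Ux.
  by case: U0; exists x.
apply/(schwarzian_psd openU sphi Ux (dphi x Ux)) => n.
exact: (extension_psd openU sphi Ux Fhol Fphi Fim).
Qed.
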